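(* For every $n\in\mathbb{N}$: $\mathrm{NE}^{ap}_{\mathfrak{D}_{n+1}\cup\overline{\mathfrak{D}_{n+1}}}\equiv_W\mathrm{C}_{\{0,1\}^\mathbb{N}}^{[n]}\times\left(\mathrm{LPO}^{[n]}\right)^*$.
   Context: $f\leq_W g$ iff there are computable partial $K,H$ on $\mathbb{N}^\mathbb{N}$ such that for every realizer $G$ of $g$, $p\mapsto K(\langle p,G(H(p))\rangle)$ realizes $f$ (realizers $F$ of $f:X\rightrightarrows Y$ on represented spaces $(X,\delta_X)$ satisfy $\delta_Y(F(p))\in f(\delta_X(p))$). $\times$ product; $f^*$: $f^0=\mathrm{id}$, $f^{n+1}=f\times f^n$, $f^*(n,x)=f^n(x)$. $\lim(p)(n)=\lim_i p(\langle n,i\rangle)$; jump $(X,\delta_X)'=(X,\delta_X\circ\lim)$, $X^{(n)}$ the $n$-fold jump; $f^{[n]}:X^{(n)}\rightrightarrows Y$ is $f$ with input space replaced by its $n$-th jump. $\mathrm{LPO}(p)=1$ iff $p=0^\mathbb{N}$. $\mathrm{C}_{\{0,1\}^\mathbb{N}}$ maps a nonempty closed subset of $\{0,1\}^\mathbb{N}$ (named by an enumeration of cylinders covering its complement) to any element. $\mathfrak{D}_m$: sets $D\subseteq\{0,1\}^\mathbb{N}$ for which there are open $U_0,\ldots,U_{m-1}$ with $x\in D\iff\min\{\beta\mid x\in U_\beta\}\not\equiv m\pmod2$ ($\min\emptyset=m$), named by names of the $U_i$; $\overline{\mathfrak{D}_m}$: complements, same names; the union class is named by a tag and a name. Games: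 two-player infinite sequential games with choices $\{0,1\}$, turn function $d$, finitely many outcomes, valuation $v$, linear antagonistic preferences ($\prec_1=\prec_2^{-1}$); strategy profiles $s:\{0,1\}^*\to\{0,1\}$; Nash equilibrium: no player can unilaterally deviate to a strictly preferred outcome. $\mathrm{NE}^{ap}_\Gamma$ takes such a game, named by the number of outcomes, $d$ and preferences as tables, and for each player and each upper set $U$ w.r.t. its preference a $\Gamma$-name of $v^{-1}(U)$, and outputs any Nash equilibrium. *)

(* Defs.v *)
From Stdlib Require Import Arith List PArith Cantor.
Import ListNotations.

Definition B := nat -> nat.

Definition npair (a b : nat) : nat := Cantor.to_nat (a, b).

Definition bpair (p q : B) : B :=
  fun n => if Nat.even n then p (Nat.div2 n) else q (Nat.div2 n).
Definition bfst (p : B) : B := fun n => p (2 * n).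
Definition bsnd (p : B) : B := fun n => p (2 * n + 1).

Definition comp (p : B) (i : nat) : B := fun j => p (npair i j).
Definition tl (p : B) : B := fun k => p (S k).

Definition b2n (b : bool) : nat := if b then 1 else 0.

(* bijective coding nat -> finite binary words, through positive *)
Fixpoint word_of_pos (x : positive) : list bool :=
  match x with
  | xH => []
  | xO y => false :: word_of_pos y
  | xI y => true :: word_of_pos y
  end.
Definition word_of (n : nat) : list bool := word_of_pos (Pos.of_succ_nat n).

Definition is_prefix (w : list bool) (x : nat -> bool) : Prop :=
  forall i, i < length w -> nth i w false = x i.

(* the open set enumerated by p: p i = 0 means "nothing", p i = k+1 means cylinder [word_of k] *)
Definition covered (p : B) (x : nat -> bool) : Prop :=
  exists i k, p i = S k /\ is_prefix (word_of k) x.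

Inductive prog : Type :=
| PZero | PSucc | PId | PFst | PSnd | POracle
| PComp (f g : prog) | PPair (f g : prog) | PRec (f g : prog) | PMu (f : prog).

Inductive eval (o : B) : prog -> nat -> nat -> Prop :=
| e_zero x : eval o PZero x 0
| e_succ x : eval o PSucc x (S x)
| e_id x : eval o PId x x
| e_fst a b : eval o PFst (npair a b) a
| e_snd a b : eval o PSnd (npair a b) b
| e_oracle x : eval o POracle x (o x)
| e_comp f g x y z : eval o g x y -> eval o f y z -> eval o (PComp f g) x z
| e_pair f g x y z : eval o f x y -> eval o g x z -> eval o (PPair f g) x (npair y z)
| e_rec0 f g x y : eval o f x y -> eval o (PRec f g) (npair x 0) y
| e_recS f g x m r y :
    eval o (PRec f g) (npair x m) r -> eval o g (npair (npair x m) r) y ->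
    eval o (PRec f g) (npair x (S m)) y
| e_mu f x y :
    eval o f (npair x y) 0 ->
    (forall z, z < y -> exists v, v <> 0 /\ eval o f (npair x z) v) ->
    eval o (PMu f) x y.

(* partial functions on Baire space: a domain and values (meaningful on the domain) *)
Record pfun := { pdom : B -> Prop; pval : B -> B }.

Definition computable (F : pfun) : Prop :=
  exists e : prog, forall p, pdom F p -> forall n, eval p e n (pval F p n).

Record rspace := { carrier : Type; names : B -> carrier -> Prop }.

Definition mvf (X Y : rspace) := carrier X -> carrier Y -> Prop.

Definition in_dom {X Y : rspace} (f : mvf X Y) (x : carrier X) : Prop :=
  exists y, f x y.

Definition realizes {X Y : rspace} (F : pfun) (f : mvf X Y) : Prop :=
  forall p x, names X p x -> in_dom f x ->
    pdom F p /\ exists y, names Y (pval F p) y /\ f x y.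

Definition W_le {X Y X' Y' : rspace} (f : mvf X Y) (g : mvf X' Y') : Prop :=
  exists K H : pfun, computable K /\ computable H /\
    forall G : pfun, realizes G g ->
      realizes {| pdom := fun p => pdom H p /\ pdom G (pval H p)
                                   /\ pdom K (bpair p (pval G (pval H p)));
                  pval := fun p => pval K (bpair p (pval G (pval H p))) |} f.

Definition W_equiv {X Y X' Y' : rspace} (f : mvf X Y) (g : mvf X' Y') : Prop :=
  W_le f g /\ W_le g f.

Definition prod_space (X Y : rspace) : rspace :=
  {| carrier := carrier X * carrier Y;
     names := fun p z => names X (bfst p) (fst z) /\ names Y (bsnd p) (snd z) |}.

Definition prod_mvf {X Y X' Y' : rspace} (f : mvf X Y) (g : mvf X' Y')
  : mvf (prod_space X X') (prod_space Y Y') :=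
  fun z w => f (fst z) (fst w) /\ g (snd z) (snd w).

Definition unit_space : rspace := {| carrier := unit; names := fun _ _ => True |}.

Fixpoint pow_space (X : rspace) (n : nat) : rspace :=
  match n with
  | 0 => unit_space
  | S m => prod_space X (pow_space X m)
  end.

Fixpoint pow_mvf {X Y : rspace} (f : mvf X Y) (n : nat)
  : mvf (pow_space X n) (pow_space Y n) :=
  match n with
  | 0 => fun _ _ => True
  | S m => prod_mvf f (pow_mvf f m)
  end.

Definition star_space (X : rspace) : rspace :=
  {| carrier := { n : nat & carrier (pow_space X n) };
     names := fun p z => p 0 = projT1 z /\ names (pow_space X (projT1 z)) (tl p) (projT2 z) |}.

Definition star_mvf {X Y : rspace} (f : mvf X Y) : mvf (star_space X) (star_space Y) :=
  fun z w => exists y, w = existT _ (projT1 z) y /\ pow_mvf f (projT1 z) (projT2 z) y.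

Definition is_lim (p q : B) : Prop :=
  forall n, exists i0, forall i, i0 <= i -> p (npair n i) = q n.

Fixpoint lim_iter (n : nat) (p q : B) : Prop :=
  match n with
  | 0 => forall k, p k = q k
  | S m => exists r, is_lim p r /\ lim_iter m r q
  end.

Definition jumpn (X : rspace) (n : nat) : rspace :=
  {| carrier := carrier X;
     names := fun p x => exists q, lim_iter n p q /\ names X q x |}.

Definition jump_mvf {X Y : rspace} (f : mvf X Y) (n : nat) : mvf (jumpn X n) Y := f.

Definition baire_space : rspace := {| carrier := B; names := fun p q => forall n, p n = q n |}.
Definition bool_space : rspace := {| carrier := bool; names := fun p b => p 0 = b2n b |}.
Definition cantor_space : rspace :=
  {| carrier := nat -> bool; names := fun p x => forall n, p n = b2n (x n) |}.

Definition LPO : mvf baire_space bool_space :=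
  fun p b => (b = true <-> forall n, p n = 0).

Definition closed_space : rspace :=
  {| carrier := (nat -> bool) -> Prop;
     names := fun p A => forall x, A x <-> ~ covered p x |}.

Definition C2 : mvf closed_space cantor_space := fun A x => A x.

(* with U_i := the open set named by comp q i:
   x in D  iff  min{beta | x in U_beta} (min of empty = m) is not = m mod 2 *)
Definition Dm (m : nat) (q : B) (x : nat -> bool) : Prop :=
  exists beta, beta <= m
    /\ (beta < m -> covered (comp q beta) x)
    /\ (forall g, g < beta -> ~ covered (comp q g) x)
    /\ Nat.odd beta <> Nat.odd m.

Definition Dunion_name (m : nat) (p : B) (S : (nat -> bool) -> Prop) : Prop :=
  (p 0 = 0 /\ forall x, S x <-> Dm m (tl p) x) \/
  (p 0 = 1 /\ forall x, S x <-> ~ Dm m (tl p) x).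

(* players: false = player 1, true = player 2; outcomes 0..k-1;
   g_pref a b = true means a <_1 b (player 1 strictly prefers b);
   player 2 has the inverse preference. *)
Record game := {
  g_k : nat;
  g_d : list bool -> bool;
  g_pref : nat -> nat -> bool;
  g_v : (nat -> bool) -> nat }.

Definition better (G : game) (a : bool) (o o' : nat) : Prop :=
  if a then g_pref G o' o = true else g_pref G o o' = true.

Definition valid_game (G : game) : Prop :=
  (forall x, g_v G x < g_k G) /\
  (forall a, a < g_k G -> g_pref G a a = false) /\
  (forall a b c, a < g_k G -> b < g_k G -> c < g_k G ->
     g_pref G a b = true -> g_pref G b c = true -> g_pref G a c = true) /\
  (forall a b, a < g_k G -> b < g_k G -> a <> b ->
     g_pref G a b = true \/ g_pref G b a = true).

Definition in_code (c o : nat) : Prop := Nat.testbit c o = true.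

Definition upper_code (G : game) (a : bool) (c : nat) : Prop :=
  c < 2 ^ g_k G /\
  forall o o', o < g_k G -> o' < g_k G -> in_code c o -> better G a o o' -> in_code c o'.

Definition game_space (gname : B -> ((nat -> bool) -> Prop) -> Prop) : rspace :=
  {| carrier := game;
     names := fun p G =>
       comp p 0 0 = g_k G /\
       (forall j, comp p 1 j = b2n (g_d G (word_of j))) /\
       (forall a b, a < g_k G -> b < g_k G -> comp p 2 (npair a b) = b2n (g_pref G a b)) /\
       (forall (a : bool) c, upper_code G a c ->
          gname (fun j => comp p 3 (npair (npair (b2n a) c) j))
                (fun x => in_code c (g_v G x))) |}.

Definition strategy_space : rspace :=
  {| carrier := list bool -> bool;
     names := fun q s => forall j, q j = b2n (s (word_of j)) |}.

Fixpoint hist (s : list bool -> bool) (n : nat) : list bool :=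
  match n with
  | 0 => []
  | S m => hist s m ++ [s (hist s m)]
  end.
Definition play (s : list bool -> bool) : nat -> bool := fun n => s (hist s n).

Definition isNE (G : game) (s : list bool -> bool) : Prop :=
  forall (a : bool) (s' : list bool -> bool),
    (forall w, g_d G w <> a -> s' w = s w) ->
    ~ better G a (g_v G (play s)) (g_v G (play s')).

Definition NE_ap (m : nat) : mvf (game_space (Dunion_name m)) strategy_space :=
  fun G s => valid_game G /\ isNE G s.

(* Main.v *)
From Stdlib Require Import Arith List PArith Cantor Lia Bool.
From Stdlib Require Import Classical ClassicalEpsilon FunctionalExtensionality Eqdep_dec.
Require Import Defs.
Import ListNotations.

(** By continuity, applying a total computable functional [F] to the approximations [p_i] of
    [lim p] converges to [F (lim p)], so [F] lifts to names in any jump of its input space.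

    Upper bound.  In the order of decreasing priority let [U_0, ..., U_n] be the open sets of a
    game, the player favoured by [U_l] alternating with [l].  Let [V_l] be the set of positions
    from which the player favoured by [U_l] can force the play into a position that lies in
    [V_(l-2)], or that lies in [U_l] and outside [V_(l-1)].  Given [V_0, ..., V_(l-1)], membership
    in [V_l] is semi-decidable, so [n] jumps decide [V_0, ..., V_(n-1)] together with the ranks of
    their positions.  The least [l <= n] with the root in [V_l] (or [n+1]) tells the winner, and
    reducing the rank (or, outside [V_n], staying outside) is optimal.  Relative to the [n]-th jump
    the profiles that are optimal for both players form a nonempty closed set, whoever wins, and
    "the root is not in [V_n]" is an instance of LPO.  Doing this for all threshold games at once
    and combining the profiles at the value of the game gives a Nash equilibrium.

    Lower bound.  Player 1 claims which of the [N] instances of LPO have answer 1 and then plays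
    a point [x] of Cantor space bit by bit; after each bit player 2 may challenge the claims or
    the current prefix of [x].  A challenge starts [n+1] alternating picks of natural numbers in
    unary, which debate the value of an [n]-fold limit at a point chosen by player 2.  If player 1
    loses the debate, or stops picking, the outcome is 0, and otherwise it is one plus the number
    of positive claims.  In an equilibrium the claims are exactly the true ones and [x] lies in
    the closed set. *)

(** * Choice and pairing *)

Lemma fun_choice {A C : Type} (R : A -> C -> Prop) :
  (forall x, exists y, R x y) -> exists f, forall x, R x (f x).
Proof.
  intro H. exists (fun x => proj1_sig (constructive_indefinite_description _ (H x))).
  intro x. apply proj2_sig.
Qed.

Definition p1 (z : nat) : nat := fst (Cantor.of_nat z).
Definition p2 (z : nat) : nat := snd (Cantor.of_nat z).

Lemma p1_pair a b : p1 (npair a b) = a.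
Proof. unfold p1, npair. now rewrite Cantor.cancel_of_to. Qed.
Lemma p2_pair a b : p2 (npair a b) = b.
Proof. unfold p2, npair. now rewrite Cantor.cancel_of_to. Qed.
Lemma npair_surj z : npair (p1 z) (p2 z) = z.
Proof. unfold p1, p2, npair. rewrite <- surjective_pairing. apply Cantor.cancel_to_of. Qed.
Lemma npair_inj a b c d : npair a b = npair c d -> a = c /\ b = d.
Proof.
  intro H. split.
  - rewrite <- (p1_pair a b), H. apply p1_pair.
  - rewrite <- (p2_pair a b), H. apply p2_pair.
Qed.
Global Opaque npair p1 p2.

#[global] Hint Rewrite p1_pair p2_pair npair_surj : pr.

Ltac npinj := repeat match goal with
  | H : npair _ _ = npair _ _ |- _ => apply npair_inj in H; destruct H; subst
  end.

(** * Evaluation *)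

Lemma eval_comp_inv o f g x z : eval o (PComp f g) x z ->
  exists y, eval o g x y /\ eval o f y z.
Proof. intro H; inversion H; subst; eauto. Qed.
Lemma eval_pair_inv o f g x w : eval o (PPair f g) x w ->
  exists y z, eval o f x y /\ eval o g x z /\ w = npair y z.
Proof. intro H; inversion H; subst; eauto. Qed.
Lemma eval_rec_inv o f g z y : eval o (PRec f g) z y ->
  match p2 z with
  | 0 => eval o f (p1 z) y
  | S m => exists r, eval o (PRec f g) (npair (p1 z) m) r /\
                     eval o g (npair (npair (p1 z) m) r) y
  end.
Proof. intro H; inversion H; subst; autorewrite with pr; eauto. Qed.
Lemma eval_mu_inv o f x y : eval o (PMu f) x y ->
  eval o f (npair x y) 0 /\
  (forall z, z < y -> exists v, v <> 0 /\ eval o f (npair x z) v).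
Proof. intro H; inversion H; subst; eauto. Qed.

Lemma eval_det o e : forall x y y', eval o e x y -> eval o e x y' -> y = y'.
Proof.
  induction e as [| | | | | |f IHf g IHg|f IHf g IHg|f IHf g IHg|f IHf]; intros x y y' H H';
    try (inversion H; inversion H'; subst; npinj; congruence).
  - apply eval_comp_inv in H as (u & H1 & H2). apply eval_comp_inv in H' as (u' & H1' & H2').
    assert (u = u') by eauto. subst. eauto.
  - apply eval_pair_inv in H as (u & v & H1 & H2 & ->).
    apply eval_pair_inv in H' as (u' & v' & H1' & H2' & ->).
    f_equal; eauto.
  - rewrite <- (npair_surj x) in H, H'. set (a := p1 x) in *.
    revert y y' H H'. induction (p2 x) as [|m IH]; intros y y' H H';
      apply eval_rec_inv in H; apply eval_rec_inv in H'; autorewrite with pr in *.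
    + eauto.
    + destruct H as (r & H1 & H2). destruct H' as (r' & H1' & H2').
      assert (r = r') by eauto. subst. eauto.
  - apply eval_mu_inv in H as (H1 & H2). apply eval_mu_inv in H' as (H1' & H2').
    destruct (Nat.lt_trichotomy y y') as [L|[L|L]]; auto; exfalso.
    + destruct (H2' _ L) as (v & Hv & E). apply Hv. eauto.
    + destruct (H2 _ L) as (v & Hv & E). apply Hv. eauto.
Qed.

(** Use principle: a terminating computation is a finite derivation and reads finitely many oracle
    entries. The bounds of the subcomputations are added up, for [PMu] including those of all failed
    tests. *)
Lemma eval_use o e : forall x y, eval o e x y ->
  exists N, forall o', (forall z, z < N -> o' z = o z) -> eval o' e x y.
Proof.
  induction e as [| | | | | |f IHf g IHg|f IHf g IHg|f IHf g IHg|f IHf]; intros x y H.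
  1-5: exists 0; intros; inversion H; subst; constructor.
  - exists (S x). intros o' E. inversion H; subst. rewrite <- E by lia. constructor.
  - apply eval_comp_inv in H as (u & H1 & H2).
    apply IHg in H1 as [N1 H1]. apply IHf in H2 as [N2 H2].
    exists (N1 + N2). intros o' E. econstructor; [apply H1|apply H2]; intros; apply E; lia.
  - apply eval_pair_inv in H as (u & v & H1 & H2 & ->).
    apply IHf in H1 as [N1 H1]. apply IHg in H2 as [N2 H2].
    exists (N1 + N2). intros o' E. econstructor; [apply H1|apply H2]; intros; apply E; lia.
  - rewrite <- (npair_surj x) in *. set (a := p1 x) in *.
    revert y H. induction (p2 x) as [|m IH]; intros y H;
      apply eval_rec_inv in H; autorewrite with pr in *.
    + apply IHf in H as [N1 H]. exists N1. intros. constructor. auto.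
    + destruct H as (r & H1 & H2). apply IH in H1 as [N1 H1]. apply IHg in H2 as [N2 H2].
      exists (N1 + N2). intros o' E. econstructor; [apply H1|apply H2]; intros; apply E; lia.
  - apply eval_mu_inv in H as (H1 & H2). apply IHf in H1 as [N1 H1].
    assert (K : exists N, forall o', (forall z, z < N -> o' z = o z) ->
              forall z, z < y -> exists v, v <> 0 /\ eval o' f (npair x z) v).
    { clear H1. induction y as [|y IHy].
      - exists 0. intros. lia.
      - destruct IHy as [N IHy]. { intros; apply H2; lia. }
        destruct (H2 y) as (v & Hv & E); [lia|]. apply IHf in E as [N' E].
        exists (N + N'). intros o' Eo z Lz.
        destruct (Nat.eq_dec z y) as [->|].
        + exists v. split; auto. apply E. intros; apply Eo; lia.
        + apply IHy; [intros; apply Eo; lia|lia]. }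
    destruct K as [N2 K]. exists (N1 + N2). intros o' E. constructor.
    + apply H1. intros; apply E; lia.
    + apply K. intros; apply E; lia.
Qed.

(** * Computable functionals *)

(** Only functionals that are total on Baire space are considered: they are continuous everywhere
    and no domain has to be tracked. *)
Definition cf (f : B -> nat -> nat) : Prop :=
  exists e, forall p x, eval p e x (f p x).
Definition cfb (f : B -> nat -> bool) : Prop := cf (fun p x => b2n (f p x)).

Lemma cf_ext f g : cf f -> (forall p x, g p x = f p x) -> cf g.
Proof. intros [e H] E. exists e. intros. rewrite E. apply H. Qed.

Fixpoint num (k : nat) : prog :=
  match k with 0 => PZero | S m => PComp PSucc (num m) end.
Lemma cf_const k : cf (fun _ _ => k).
Proof.
  exists (num k). intros p x. induction k; simpl; [constructor|].
  econstructor; [eassumption|constructor].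
Qed.
Lemma cf_id : cf (fun _ x => x).
Proof. exists PId. constructor. Qed.
Lemma cf_app f g : cf f -> cf g -> cf (fun p x => f p (g p x)).
Proof. intros [e H] [e' H']. exists (PComp e e'). intros. econstructor; eauto. Qed.
Lemma cf_S f : cf f -> cf (fun p x => S (f p x)).
Proof. intros [e H]. exists (PComp PSucc e). intros. econstructor; eauto. constructor. Qed.
Lemma cf_p1 f : cf f -> cf (fun p x => p1 (f p x)).
Proof.
  intros [e H]. exists (PComp PFst e). intros. econstructor; eauto.
  rewrite <- (npair_surj (f p x)) at 1. constructor.
Qed.
Lemma cf_p2 f : cf f -> cf (fun p x => p2 (f p x)).
Proof.
  intros [e H]. exists (PComp PSnd e). intros. econstructor; eauto.
  rewrite <- (npair_surj (f p x)) at 1. constructor.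
Qed.
Lemma cf_npair f g : cf f -> cf g -> cf (fun p x => npair (f p x) (g p x)).
Proof. intros [e H] [e' H']. exists (PPair e e'). intros. constructor; auto. Qed.
Lemma cf_oracle f : cf f -> cf (fun p x => p (f p x)).
Proof. intros [e H]. exists (PComp POracle e). intros. econstructor; eauto. constructor. Qed.

Definition prec (b : nat) (g : nat -> nat -> nat) (k : nat) : nat :=
  nat_rect (fun _ => nat) b g k.
Lemma prec_S b g k : prec b g (S k) = g k (prec b g k).
Proof. reflexivity. Qed.

(** The hypothesis on [g] uncurries it in the layout [<<x,m>,r>] that [PRec] hands to its step
    program. *)
Lemma cf_prec b g h : cf b -> cf h ->
  cf (fun p y => g p (p1 (p1 y)) (p2 (p1 y)) (p2 y)) ->
  cf (fun p x => prec (b p x) (fun m r => g p x m r) (h p x)).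
Proof.
  intros [eb Hb] [eh Hh] [eg Hg].
  exists (PComp (PRec eb eg) (PPair PId eh)). intros p x.
  econstructor. { constructor; [constructor|apply Hh]. }
  induction (h p x) as [|m IH]; simpl.
  - constructor. apply Hb.
  - econstructor; [apply IH|].
    pose proof (Hg p (npair (npair x m) (prec (b p x) (fun m0 r => g p x m0 r) m))) as H.
    autorewrite with pr in H. exact H.
Qed.

(* [sub c e] runs [e] on the second component of the input, with oracle calls
   answered by [c], which also receives the first component. *)
Fixpoint sub (c e : prog) : prog :=
  match e with
  | PZero => PZero
  | PSucc => PComp PSucc PSnd
  | PId => PSnd
  | PFst => PComp PFst PSnd
  | PSnd => PComp PSnd PSnd
  | POracle => c
  | PComp f g => PComp (sub c f) (PPair PFst (sub c g))
  | PPair f g => PPair (sub c f) (sub c g)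
  | PRec f g =>
      PComp (PRec (sub c f)
               (PComp (sub c g)
                  (PPair (PComp PFst (PComp PFst PFst))
                     (PPair (PPair (PComp PSnd (PComp PFst PFst)) (PComp PSnd PFst)) PSnd))))
            (PPair (PPair PFst (PComp PFst PSnd)) (PComp PSnd PSnd))
  | PMu f =>
      PMu (PComp (sub c f)
             (PPair (PComp PFst PFst) (PPair (PComp PSnd PFst) PSnd)))
  end.

Lemma eval_sub o o' c i e : (forall x, eval o c (npair i x) (o' x)) ->
  forall x y, eval o' e x y -> eval o (sub c e) (npair i x) y.
Proof.
  intro Hc.
  induction e as [| | | | | |f IHf g IHg|f IHf g IHg|f IHf g IHg|f IHf]; intros x y H; cbn [sub].
  1-5: inversion H; subst; repeat (econstructor || eassumption).
  - inversion H; subst. apply Hc.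
  - apply eval_comp_inv in H as (u & H1 & H2).
    repeat (econstructor; eauto).
  - apply eval_pair_inv in H as (u & v & H1 & H2 & ->). constructor; auto.
  - rewrite <- (npair_surj x) in *. set (a := p1 x) in *.
    econstructor. { repeat econstructor. }
    revert y H. induction (p2 x) as [|m IH]; intros y H;
      apply eval_rec_inv in H; autorewrite with pr in *.
    + constructor. auto.
    + destruct H as (r & H1 & H2). econstructor; [apply IH; eauto|].
      econstructor; [|apply IHg; eassumption]. repeat econstructor.
  - apply eval_mu_inv in H as (H1 & H2). constructor.
    + econstructor; [|apply IHf; eassumption]. repeat econstructor.
    + intros z Lz. destruct (H2 z Lz) as (v & Hv & E). exists v. split; auto.
      econstructor; [|apply IHf; eassumption]. repeat econstructor.
Qed.

(** Runs [F] on a sequence that is itself computed from [p] and the input [x]. Composition of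
    functionals and [lift] are instances. *)
Lemma cf_sub F G h : cf F -> cf (fun p z => G p (p1 z) (p2 z)) -> cf h ->
  cf (fun p x => F (fun y => G p x y) (h p x)).
Proof.
  intros [e H] [c Hc] [eh Hh].
  exists (PComp (sub c e) (PPair PId eh)). intros p x.
  econstructor. { constructor; [constructor|apply Hh]. }
  apply eval_sub with (o' := fun y => G p x y); [|apply H].
  intro y. pose proof (Hc p (npair x y)) as E. autorewrite with pr in E. exact E.
Qed.

Create HintDb cf discriminated.
#[global] Hint Constants Opaque : cf.
#[global] Hint Resolve cf_const cf_id cf_S cf_p1 cf_p2 cf_npair cf_oracle cf_prec : cf.

Ltac cfs := solve [typeclasses eauto with cf nocore].


Lemma cf_pred f : cf f -> cf (fun p x => pred (f p x)).
Proof.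
  intro H. apply (cf_ext (fun p x => prec 0 (fun m _ => m) (f p x))); [cfs|].
  intros p x. now destruct (f p x).
Qed.
#[global] Hint Resolve cf_pred : cf.

Lemma cf_add f g : cf f -> cf g -> cf (fun p x => f p x + g p x).
Proof.
  intros Hf Hg.
  apply (cf_ext (fun p x => prec (g p x) (fun _ r => S r) (f p x))); [cfs|].
  intros p x. induction (f p x) as [|m IH]; simpl; auto.
Qed.
#[global] Hint Resolve cf_add : cf.

Lemma cf_mul f g : cf f -> cf g -> cf (fun p x => f p x * g p x).
Proof.
  intros Hf Hg.
  apply (cf_ext (fun p x => prec 0 (fun _ r => g p x + r) (f p x))).
  - apply cf_prec; try cfs. apply cf_add; [|cfs].
    apply (cf_app g); cfs.
  - intros p x. induction (f p x) as [|m IH]; simpl; auto.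
Qed.
#[global] Hint Resolve cf_mul : cf.

Lemma cf_sub_nat f g : cf f -> cf g -> cf (fun p x => f p x - g p x).
Proof.
  intros Hf Hg.
  apply (cf_ext (fun p x => prec (f p x) (fun _ r => pred r) (g p x))); [cfs|].
  intros p x. induction (g p x) as [|m IH]; simpl; lia.
Qed.
#[global] Hint Resolve cf_sub_nat : cf.

Lemma cf_if b f g : cfb b -> cf f -> cf g -> cf (fun p x => if b p x then f p x else g p x).
Proof.
  intros Hb Hf Hg. unfold cfb in Hb.
  (* Both branches are total, so both may be evaluated and the choice made by arithmetic. *)
  apply (cf_ext (fun p x => b2n (b p x) * f p x + (1 - b2n (b p x)) * g p x)); [cfs|].
  intros p x. destruct (b p x); simpl; lia.
Qed.
Lemma cf_b2n b : cfb b -> cf (fun p x => b2n (b p x)).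
Proof. auto. Qed.
#[global] Hint Resolve cf_if cf_b2n : cf.

Lemma cfb_ext f g : cfb f -> (forall p x, g p x = f p x) -> cfb g.
Proof. intros H E. apply (cf_ext _ _ H). intros. now rewrite E. Qed.
Lemma cfb_const b : cfb (fun _ _ => b).
Proof. apply (cf_const (b2n b)). Qed.
Lemma cfb_neqb0 f : cf f -> cfb (fun p x => negb (f p x =? 0)).
Proof.
  intro H. apply (cf_ext (fun p x => prec 0 (fun _ _ => 1) (f p x))); [cfs|].
  intros p x. now destruct (f p x).
Qed.
Lemma cfb_negb f : cfb f -> cfb (fun p x => negb (f p x)).
Proof.
  intro H. apply (cf_ext (fun p x => 1 - b2n (f p x))); [cfs|].
  intros p x. now destruct (f p x).
Qed.
#[global] Hint Resolve cfb_const cfb_negb : cf.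
Lemma cfb_if b f g : cfb b -> cfb f -> cfb g ->
  cfb (fun p x => if b p x then f p x else g p x).
Proof.
  intros Hb Hf Hg.
  apply (cf_ext (fun p x => if b p x then b2n (f p x) else b2n (g p x))); [cfs|].
  intros p x. now destruct (b p x).
Qed.
#[global] Hint Resolve cfb_if : cf.
Lemma cfb_andb f g : cfb f -> cfb g -> cfb (fun p x => f p x && g p x).
Proof.
  intros Hf Hg. apply (cfb_ext (fun p x => if f p x then g p x else false)); [cfs|].
  reflexivity.
Qed.
Lemma cfb_orb f g : cfb f -> cfb g -> cfb (fun p x => f p x || g p x).
Proof.
  intros Hf Hg. apply (cfb_ext (fun p x => if f p x then true else g p x)); [cfs|].
  reflexivity.
Qed.
Lemma cfb_xorb f g : cfb f -> cfb g -> cfb (fun p x => xorb (f p x) (g p x)).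
Proof.
  intros Hf Hg. apply (cfb_ext (fun p x => if f p x then negb (g p x) else g p x)); [cfs|].
  intros p x. now destruct (f p x), (g p x).
Qed.
Lemma cfb_leb f g : cf f -> cf g -> cfb (fun p x => f p x <=? g p x).
Proof.
  intros Hf Hg.
  apply (cfb_ext (fun p x => negb (negb (f p x - g p x =? 0)))).
  - apply cfb_negb, cfb_neqb0. cfs.
  - intros p x. rewrite negb_involutive.
    destruct (Nat.leb_spec (f p x) (g p x)), (Nat.eqb_spec (f p x - g p x) 0); auto; lia.
Qed.
#[global] Hint Resolve cfb_andb cfb_orb cfb_xorb cfb_leb : cf.
Lemma cfb_ltb f g : cf f -> cf g -> cfb (fun p x => f p x <? g p x).
Proof. intros. change (cfb (fun p x => S (f p x) <=? g p x)). cfs. Qed.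
Lemma cfb_eqb f g : cf f -> cf g -> cfb (fun p x => f p x =? g p x).
Proof.
  intros Hf Hg. apply (cfb_ext (fun p x => (f p x <=? g p x) && (g p x <=? f p x))); [cfs|].
  intros p x.
  destruct (Nat.leb_spec (f p x) (g p x)), (Nat.leb_spec (g p x) (f p x)),
    (Nat.eqb_spec (f p x) (g p x)); simpl; auto; lia.
Qed.
Lemma cfb_beqb f g : cfb f -> cfb g -> cfb (fun p x => Bool.eqb (f p x) (g p x)).
Proof.
  intros Hf Hg. apply (cfb_ext (fun p x => if f p x then g p x else negb (g p x))); [cfs|].
  intros p x. now destruct (f p x), (g p x).
Qed.
#[global] Hint Resolve cfb_ltb cfb_eqb cfb_beqb : cf.
Lemma cfb_odd f : cf f -> cfb (fun p x => Nat.odd (f p x)).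
Proof.
  intro H. apply (cf_ext (fun p x => prec 0 (fun _ r => 1 - r) (f p x))); [cfs|].
  intros p x. induction (f p x) as [|m IH]; [reflexivity|].
  rewrite prec_S, <- IH, Nat.odd_succ, <- Nat.negb_odd. now destruct (Nat.odd m).
Qed.
#[global] Hint Resolve cfb_odd : cf.
Lemma cfb_even f : cf f -> cfb (fun p x => Nat.even (f p x)).
Proof.
  intro H. apply (cfb_ext (fun p x => negb (Nat.odd (f p x)))); [cfs|].
  intros p x. now rewrite Nat.negb_odd.
Qed.
Lemma cf_div2 f : cf f -> cf (fun p x => Nat.div2 (f p x)).
Proof.
  intro H. apply (cf_ext (fun p x => prec 0 (fun m r => r + b2n (Nat.odd m)) (f p x))); [cfs|].
  intros p x. induction (f p x) as [|m IH]; [reflexivity|].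
  rewrite prec_S, <- IH.
  assert (E : forall m, Nat.div2 (S m) = Nat.div2 m + b2n (Nat.odd m)).
  { clear. intro m. pose proof (Nat.div2_odd m). pose proof (Nat.div2_odd (S m)) as E.
    rewrite Nat.odd_succ, <- Nat.negb_odd in E. destruct (Nat.odd m); simpl in *; lia. }
  apply E.
Qed.
Lemma cf_pow2 f : cf f -> cf (fun p x => 2 ^ f p x).
Proof.
  intro H. apply (cf_ext (fun p x => prec 1 (fun _ r => 2 * r) (f p x))); [cfs|].
  intros p x. induction (f p x) as [|m IH]; [reflexivity|].
  rewrite prec_S, <- IH. simpl. lia.
Qed.
#[global] Hint Resolve cfb_even cf_div2 cf_pow2 : cf.

(** * Bounded search *)

Fixpoint bexists (f : nat -> bool) (k : nat) : bool :=
  match k with 0 => false | S m => bexists f m || f m end.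
Lemma bexists_spec f k : bexists f k = true <-> exists m, m < k /\ f m = true.
Proof.
  induction k as [|k IH]; simpl.
  - split; [discriminate|]. intros (m & L & _). lia.
  - rewrite orb_true_iff, IH. split.
    + intros [(m & L & E)|E]; eauto.
    + intros (m & L & E). destruct (Nat.eq_dec m k) as [->|]; auto. left. exists m. split; auto; lia.
Qed.
Lemma cfb_bexists f k : cf k -> cfb (fun p z => f p (p1 z) (p2 z)) ->
  cfb (fun p x => bexists (f p x) (k p x)).
Proof.
  intros Hk Hf.
  apply (cf_ext (fun p x => prec 0 (fun m r => if f p x m then 1 else r) (k p x))).
  - apply cf_prec; try cfs. apply cf_if; try cfs.
    apply (cf_ext (fun p y => (fun p z => b2n (f p (p1 z) (p2 z))) p
       (npair (p1 (p1 y)) (p2 (p1 y))))).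
    + apply (cf_app (fun p z => b2n (f p (p1 z) (p2 z)))); [exact Hf|cfs].
    + intros. now rewrite p1_pair, p2_pair.
  - intros p x. induction (k p x) as [|m IH]; simpl; auto.
    rewrite <- IH. now destruct (f p x m), (bexists (f p x) m).
Qed.

(* least [m < k] satisfying [f], and [k] if there is none *)
Fixpoint bmin (f : nat -> bool) (k : nat) : nat :=
  match k with
  | 0 => 0
  | S m => if bmin f m <? m then bmin f m else if f m then m else S m
  end.
Lemma bmin_le f k : bmin f k <= k.
Proof. induction k; simpl; auto. destruct (Nat.ltb_spec (bmin f k) k), (f k); lia. Qed.
Lemma bmin_lt f k m : m < bmin f k -> f m = false.
Proof.
  induction k as [|k IH]; simpl; [lia|].
  pose proof (bmin_le f k).
  destruct (Nat.ltb_spec (bmin f k) k); auto.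
  assert (bmin f k = k) by lia. destruct (f k) eqn:E; intro L.
  - apply IH. lia.
  - destruct (Nat.eq_dec m k) as [->|]; auto. apply IH. lia.
Qed.
Lemma bmin_true f k : bmin f k < k -> f (bmin f k) = true.
Proof.
  induction k as [|k IH]; simpl; [lia|].
  destruct (Nat.ltb_spec (bmin f k) k); auto.
  destruct (f k) eqn:E; auto. lia.
Qed.
Lemma cf_bmin f k : cf k -> cfb (fun p z => f p (p1 z) (p2 z)) ->
  cf (fun p x => bmin (f p x) (k p x)).
Proof.
  intros Hk Hf.
  apply (cf_ext (fun p x => prec 0
     (fun m r => if r <? m then r else if f p x m then m else S m) (k p x))).
  - apply cf_prec; try cfs. apply cf_if; try cfs. apply cf_if; try cfs.
    apply (cf_ext (fun p y => (fun p z => b2n (f p (p1 z) (p2 z))) p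
       (npair (p1 (p1 y)) (p2 (p1 y))))).
    + apply (cf_app (fun p z => b2n (f p (p1 z) (p2 z)))); [exact Hf|cfs].
    + intros. now rewrite p1_pair, p2_pair.
  - intros p x. induction (k p x) as [|m IH]; simpl; auto. now rewrite IH.
Qed.
#[global] Hint Resolve cfb_bexists cf_bmin : cf.

(** The [cf_call] family reduces a call with compound arguments to computability in one tupled
    variable, so that each defined function has to be unfolded only once. *)
Lemma cf_call1 (F : B -> nat -> nat) a : cf F -> cf a -> cf (fun p x => F p (a p x)).
Proof. exact (cf_app F a). Qed.
Lemma cf_call2 (F : B -> nat -> nat -> nat) a b :
  cf (fun p z => F p (p1 z) (p2 z)) -> cf a -> cf b ->
  cf (fun p x => F p (a p x) (b p x)).
Proof.
  intros H Ha Hb.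
  apply (cf_ext (fun p x => (fun p z => F p (p1 z) (p2 z)) p (npair (a p x) (b p x)))).
  - apply (cf_app (fun p z => F p (p1 z) (p2 z))); [exact H|cfs].
  - intros. now autorewrite with pr.
Qed.
Lemma cf_call3 (F : B -> nat -> nat -> nat -> nat) a b c :
  cf (fun p z => F p (p1 z) (p1 (p2 z)) (p2 (p2 z))) -> cf a -> cf b -> cf c ->
  cf (fun p x => F p (a p x) (b p x) (c p x)).
Proof.
  intros H Ha Hb Hc.
  apply (cf_ext (fun p x => (fun p u v => F p u (p1 v) (p2 v)) p (a p x)
     (npair (b p x) (c p x)))).
  - apply (cf_call2 (fun p u v => F p u (p1 v) (p2 v))); [exact H|cfs|cfs].
  - intros. now autorewrite with pr.
Qed.
Lemma cf_call4 (F : B -> nat -> nat -> nat -> nat -> nat) a b c d :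
  cf (fun p z => F p (p1 z) (p1 (p2 z)) (p1 (p2 (p2 z))) (p2 (p2 (p2 z)))) ->
  cf a -> cf b -> cf c -> cf d ->
  cf (fun p x => F p (a p x) (b p x) (c p x) (d p x)).
Proof.
  intros H Ha Hb Hc Hd.
  apply (cf_ext (fun p x => (fun p u v w => F p u v (p1 w) (p2 w)) p (a p x) (b p x)
     (npair (c p x) (d p x)))).
  - apply (cf_call3 (fun p u v w => F p u v (p1 w) (p2 w))); [exact H|cfs|cfs|cfs].
  - intros. now autorewrite with pr.
Qed.
Lemma cfb_call1 (F : B -> nat -> bool) a : cfb F -> cf a -> cfb (fun p x => F p (a p x)).
Proof. exact (cf_call1 (fun p x => b2n (F p x)) a). Qed.
Lemma cfb_call2 (F : B -> nat -> nat -> bool) a b :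
  cfb (fun p z => F p (p1 z) (p2 z)) -> cf a -> cf b ->
  cfb (fun p x => F p (a p x) (b p x)).
Proof. exact (cf_call2 (fun p x y => b2n (F p x y)) a b). Qed.
Lemma cfb_call3 (F : B -> nat -> nat -> nat -> bool) a b c :
  cfb (fun p z => F p (p1 z) (p1 (p2 z)) (p2 (p2 z))) -> cf a -> cf b -> cf c ->
  cfb (fun p x => F p (a p x) (b p x) (c p x)).
Proof. exact (cf_call3 (fun p x y z => b2n (F p x y z)) a b c). Qed.
Lemma cfb_call4 (F : B -> nat -> nat -> nat -> nat -> bool) a b c d :
  cfb (fun p z => F p (p1 z) (p1 (p2 z)) (p1 (p2 (p2 z))) (p2 (p2 (p2 z)))) ->
  cf a -> cf b -> cf c -> cf d ->
  cfb (fun p x => F p (a p x) (b p x) (c p x) (d p x)).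
Proof. exact (cf_call4 (fun p x y z t => b2n (F p x y z t)) a b c d). Qed.

(** * Limits of computable functionals *)

Lemma cf_use f p x : cf f ->
  exists N, forall q, (forall z, z < N -> q z = p z) -> f q x = f p x.
Proof.
  intros [e H]. destruct (eval_use p e x (f p x) (H p x)) as [N HN].
  exists N. intros q E. exact (eval_det q e x _ _ (H q x) (HN q E)).
Qed.

(** Entry [<x,i>] is the value at [x] of [f] on the [i]-th approximation [y |-> p <y,i>], in the
    layout of [is_lim]. *)
Definition lift (f : B -> nat -> nat) : B -> nat -> nat :=
  fun p z => f (fun y => p (npair y (p2 z))) (p1 z).

Lemma cf_lift f : cf f -> cf (lift f).
Proof.
  intro H. unfold lift.
  apply (cf_sub f (fun p z y => p (npair y (p2 z))) (fun _ z => p1 z)); auto; cfs.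
Qed.

(** The value [f r x] depends on finitely many entries of [r], and finitely many entries of the
    approximations become stable simultaneously. *)
Lemma lift_lim f p r : cf f -> is_lim p r -> is_lim (lift f p) (f r).
Proof.
  intros Hf Hl x. destruct (cf_use f r x Hf) as [N HN].
  assert (K : exists i0, forall i, i0 <= i -> forall z, z < N -> p (npair z i) = r z).
  { clear HN. induction N as [|N [i0 IH]].
    - exists 0. intros; lia.
    - destruct (Hl N) as [i1 H1]. exists (i0 + i1). intros i L z Lz.
      destruct (Nat.eq_dec z N) as [->|]; [apply H1; lia|apply IH; lia]. }
  destruct K as [i0 K]. exists i0. intros i L. unfold lift. autorewrite with pr.
  apply HN. intros z Lz. now apply K.
Qed.

Definition liftn (n : nat) (f : B -> nat -> nat) : B -> nat -> nat := Nat.iter n lift f.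

Lemma cf_liftn n f : cf f -> cf (liftn n f).
Proof. intro H. induction n; simpl; auto. now apply cf_lift. Qed.

Lemma liftn_lim n f : cf f -> forall p r, lim_iter n p r -> lim_iter n (liftn n f p) (f r).
Proof.
  intro Hf. induction n as [|n IH]; intros p r H; simpl in *.
  - intro k. destruct (cf_use f r k Hf) as [N HN]. apply HN. auto.
  - destruct H as (q & Hq & Hr). exists (liftn n f q). split; auto.
    apply lift_lim; auto. now apply cf_liftn.
Qed.

(** The recursion of [lim_iter] adds a limit on the side of the name. Adding one on the side of the
    result is what the passage from [stagelim l] to [stagelim (S l)] requires. *)
Lemma lim_iter_is_lim n : forall p q r,
  lim_iter n p q -> is_lim q r -> lim_iter (S n) p r.
Proof.
  induction n as [|n IH]; intros p q r H L.
  - exists r. split; [|intro; reflexivity]. simpl in H.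
    intro m. destruct (L m) as [i0 Hi]. exists i0. intros. rewrite H. auto.
  - destruct H as (q' & H1 & H2). exists q'. split; auto. apply (IH q' q r); auto.
Qed.

Lemma lim_iter_const n c : lim_iter n (fun _ => c) (fun _ => c).
Proof.
  induction n as [|n IH]; simpl; auto. exists (fun _ => c). split; auto.
  intro. exists 0. auto.
Qed.

(* [shuf n] re-indexes a family [a_i] of [n]-fold limit names into one
   [n]-fold limit name of [<i,k> |-> b_i k]; [unshuf n i] extracts component [i]. *)
Fixpoint shuf (n x : nat) : nat :=
  match n with
  | 0 => x
  | S m => npair (p1 (shuf m (p1 x))) (npair (p2 (shuf m (p1 x))) (p2 x))
  end.
Fixpoint unshuf (n i x : nat) : nat :=
  match n with
  | 0 => npair i x
  | S m => npair (unshuf m i (p1 x)) (p2 x)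
  end.

Lemma cf_shuf n f : cf f -> cf (fun p x => shuf n (f p x)).
Proof. revert f. induction n as [|n IH]; intros f H; simpl; [auto|].
  pose proof (IH (fun p x => p1 (f p x)) ltac:(cfs)). cfs. Qed.
Lemma cf_unshuf n f g : cf f -> cf g -> cf (fun p x => unshuf n (f p x) (g p x)).
Proof. revert g. induction n as [|n IH]; intros g Hf Hg; simpl; [cfs|].
  pose proof (IH (fun p x => p1 (g p x)) Hf ltac:(cfs)). cfs. Qed.
#[global] Hint Resolve cf_shuf cf_unshuf : cf.

Lemma shuf_lim n : forall (a b : nat -> B), (forall i, lim_iter n (a i) (b i)) ->
  lim_iter n (fun x => a (p1 (shuf n x)) (p2 (shuf n x))) (fun x => b (p1 x) (p2 x)).
Proof.
  induction n as [|n IH]; intros a b H; simpl in *; auto.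
  assert (C : forall i, exists r, is_lim (a i) r /\ lim_iter n r (b i)) by exact H.
  apply fun_choice in C as [r Hr].
  exists (fun x => r (p1 (shuf n x)) (p2 (shuf n x))). split.
  - intro m. destruct (Hr (p1 (shuf n m))) as [L _].
    destruct (L (p2 (shuf n m))) as [i0 Hi]. exists i0. intros i Li.
    autorewrite with pr. auto.
  - apply IH. apply Hr.
Qed.

Lemma unshuf_lim n i : forall z b, lim_iter n z b ->
  lim_iter n (fun x => z (unshuf n i x)) (fun k => b (npair i k)).
Proof.
  induction n as [|n IH]; intros z b H; simpl in *; auto.
  destruct H as (r & L & H). exists (fun x => r (unshuf n i x)). split; auto.
  intro m. destruct (L (unshuf n i m)) as [i0 Hi]. exists i0. intros.
  autorewrite with pr. auto.
Qed.

(** * Codes of words *)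

Lemma word_of_S m : word_of (S m) = Nat.odd m :: word_of (Nat.div2 m).
Proof.
  unfold word_of.
  assert (E : Pos.of_succ_nat (S m) = if Nat.odd m then xI (Pos.of_succ_nat (Nat.div2 m))
                                      else xO (Pos.of_succ_nat (Nat.div2 m))).
  { apply Pos2Nat.inj. rewrite SuccNat2Pos.id_succ.
    pose proof (Nat.div2_odd m) as D.
    destruct (Nat.odd m); simpl Nat.b2n in D;
      [rewrite Pos2Nat.inj_xI|rewrite Pos2Nat.inj_xO]; rewrite SuccNat2Pos.id_succ; lia. }
  rewrite E. now destruct (Nat.odd m).
Qed.

Lemma div2_lt m : Nat.div2 m < S m.
Proof. pose proof (Nat.div2_odd m). lia. Qed.

Fixpoint code_of (w : list bool) : nat :=
  match w with [] => 0 | b :: v => S (2 * code_of v + b2n b) end.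

Lemma odd_2m m b : Nat.odd (2 * m + b2n b) = b.
Proof. rewrite Nat.odd_add, Nat.odd_mul. now destruct b. Qed.
Lemma div2_2m m b : Nat.div2 (2 * m + b2n b) = m.
Proof.
  pose proof (Nat.div2_odd (2 * m + b2n b)) as D. rewrite odd_2m in D. destruct b; simpl in *; lia.
Qed.

Lemma word_of_code w : word_of (code_of w) = w.
Proof.
  induction w as [|b w IH]; [reflexivity|].
  change (code_of (b :: w)) with (S (2 * code_of w + b2n b)).
  rewrite word_of_S, odd_2m, div2_2m. congruence.
Qed.
Lemma code_of_word c : code_of (word_of c) = c.
Proof.
  induction c as [[|m] IH] using lt_wf_ind; [reflexivity|].
  rewrite word_of_S. cbn [code_of]. rewrite IH by apply div2_lt.
  pose proof (Nat.div2_odd m) as D. unfold b2n. unfold Nat.b2n in D. lia.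
Qed.

(** The fold becomes a primitive recursion whose state pairs the accumulator with the code of the
    unread rest. A word has at most as many letters as its code, so [c] rounds suffice, and the
    state idles once the rest is empty. *)
Lemma cf_fold (step : B -> nat -> nat -> bool -> nat) s0 c :
  cf s0 -> cf c ->
  cf (fun p z => step p (p1 z) (p1 (p2 z)) (Nat.odd (p2 (p2 z)))) ->
  cf (fun p x => fold_left (step p x) (word_of (c p x)) (s0 p x)).
Proof.
  intros Hs Hc Hst.
  pose (stp := fun p x y => if p2 y =? 0 then y
     else npair (step p x (p1 y) (Nat.odd (pred (p2 y)))) (Nat.div2 (pred (p2 y)))).
  apply (cf_ext (fun p x => p1 (prec (npair (s0 p x) (c p x)) (fun _ y => stp p x y) (c p x)))).
  - apply cf_p1, cf_prec; try cfs. unfold stp. apply cf_if; try cfs. apply cf_npair; try cfs.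
    apply (cf_call3 (fun p x s y => step p x s (Nat.odd y)) (fun _ x => p1 (p1 x))
      (fun _ x => p1 (p2 x)) (fun _ x => pred (p2 (p2 x)))); auto; cfs.
  - intros p x. generalize (s0 p x), (c p x). clear. intros s c.
    assert (H : forall k c, c <= k -> forall s,
        fold_left (step p x) (word_of c) s = p1 (Nat.iter k (stp p x) (npair s c))).
    { clear. induction k as [|k IH]; intros c L s.
      - replace c with 0 by lia. simpl. now rewrite p1_pair.
      - rewrite Nat.iter_succ_r. destruct c as [|m].
        + replace (stp p x (npair s 0)) with (npair s 0).
          * apply (IH 0); lia.
          * unfold stp. now rewrite p2_pair.
        + rewrite word_of_S. simpl fold_left. rewrite (IH (Nat.div2 m)).
          * f_equal. f_equal. unfold stp. now rewrite p1_pair, p2_pair.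
          * pose proof (div2_lt m). lia. }
    exact (H c c (le_n c) s).
Qed.

Definition len (c : nat) : nat := length (word_of c).

Lemma fold_left_S (w : list bool) : forall k, fold_left (fun s _ => S s) w k = length w + k.
Proof. induction w as [|b w IH]; intro k; simpl; auto. rewrite IH. lia. Qed.

Lemma cf_len f : cf f -> cf (fun p x => len (f p x)).
Proof.
  intro H. apply (cf_ext (fun p x => fold_left (fun s _ => S s) (word_of (f p x)) 0)).
  - apply (cf_fold (fun _ _ s _ => S s) (fun _ _ => 0) f); cfs.
  - intros. rewrite fold_left_S. unfold len. lia.
Qed.
#[global] Hint Resolve cf_len : cf.

(** Codes are bijective binary numerals with digits [1] and [2], lowest first. Appending a letter at
    the end adds its digit with weight [2 ^ len c]. *)
Definition ch (c : nat) (b : bool) : nat := c + 2 ^ len c * S (b2n b).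

Lemma word_of_ch c b : word_of (ch c b) = word_of c ++ [b].
Proof.
  unfold ch, len. induction c as [[|m] IH] using lt_wf_ind.
  - now destruct b.
  - rewrite (word_of_S m). cbn [length app Nat.pow].
    set (K := 2 ^ length (word_of (Nat.div2 m)) * S (b2n b)).
    replace (S m + 2 * 2 ^ length (word_of (Nat.div2 m)) * S (b2n b)) with (S (m + 2 * K))
      by (unfold K; lia).
    rewrite word_of_S, <- IH by apply div2_lt. fold K.
    f_equal.
    + rewrite Nat.odd_add, Nat.odd_mul. simpl. now destruct (Nat.odd m).
    + f_equal. pose proof (Nat.div2_odd m) as D.
      replace (m + 2 * K) with (2 * (Nat.div2 m + K) + b2n (Nat.odd m)).
      * apply div2_2m.
      * unfold b2n. unfold Nat.b2n in D. lia.
Qed.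
Lemma code_of_snoc w b : code_of (w ++ [b]) = ch (code_of w) b.
Proof. rewrite <- (code_of_word (ch _ _)), word_of_ch, word_of_code. reflexivity. Qed.
Lemma len_ch c b : len (ch c b) = S (len c).
Proof. unfold len. rewrite word_of_ch, length_app. simpl. lia. Qed.
Lemma ch_gt c b : c < ch c b.
Proof. unfold ch. pose proof (Nat.pow_nonzero 2 (len c)). nia. Qed.

Lemma cf_ch c b : cf c -> cfb b -> cf (fun p x => ch (c p x) (b p x)).
Proof. intros. unfold ch. cfs. Qed.
#[global] Hint Resolve cf_ch : cf.

Definition bit (c i : nat) : bool := nth i (word_of c) false.

Lemma cfb_bit c i : cf c -> cf i -> cfb (fun p x => bit (c p x) (i p x)).
Proof.
  intros Hc Hi.
  (* The state holds the index of the next letter and the letter found at index [i]; its initial [0]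
     matches the default of [nth]. *)
  pose (st := fun (i s : nat) (b : bool) => npair (S (p1 s)) (if p1 s =? i then b2n b else p2 s)).
  apply (cf_ext (fun p x => p2 (fold_left (st (i p x)) (word_of (c p x)) (npair 0 0)))).
  - apply (cf_call2 (fun p c i => p2 (fold_left (st i) (word_of c) (npair 0 0)))); auto.
    apply cf_p2. apply (cf_fold (fun _ x => st (p2 x)) (fun _ _ => npair 0 0) (fun _ x => p1 x)); cfs.
  - intros p x. generalize (i p x) as j, (c p x) as d. clear. intros j d. unfold bit.
    assert (H : forall w k v, p2 (fold_left (st j) w (npair k v)) =
      if k <=? j then if j - k <? length w then b2n (nth (j - k) w false) else v else v).
    { clear. induction w as [|b w IH]; intros k v; simpl fold_left.
      - rewrite p2_pair. now destruct (k <=? j).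
      - unfold st at 2. autorewrite with pr. rewrite IH.
        destruct (Nat.leb_spec (S k) j), (Nat.leb_spec k j), (Nat.eqb_spec k j); try lia.
        + replace (j - k) with (S (j - S k)) by lia. cbn [length nth].
          change (S (j - S k) <? S (length w)) with (j - S k <? length w). reflexivity.
        + subst. rewrite Nat.sub_diag. reflexivity. }
    rewrite H. simpl. rewrite Nat.sub_0_r.
    destruct (Nat.ltb_spec j (length (word_of d))); auto.
    now rewrite nth_overflow by lia.
Qed.
#[global] Hint Resolve cfb_bit : cf.

(* The state is [0] on a mismatch and [S k] while the word with code [k] remains to be read. *)
Definition prefstep (s : nat) (b : bool) : nat :=
  match s with
  | 0 => 0
  | S 0 => 1
  | S (S m) => if Bool.eqb (Nat.odd m) b then S (Nat.div2 m) else 0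
  end.
Definition prefb (k c : nat) : bool := fold_left prefstep (word_of c) (S k) =? 1.

Lemma prefb_spec k c : prefb k c = true <-> exists v, word_of c = word_of k ++ v.
Proof.
  unfold prefb.
  (* The states [0] and [1] are absorbing: a mismatch is final, and an exhausted pattern accepts
     every continuation. *)
  assert (Z : forall w, fold_left prefstep w 0 = 0) by (induction w; auto).
  assert (O : forall w, fold_left prefstep w 1 = 1) by (induction w; auto).
  revert k. induction (word_of c) as [|b w IH]; intro k.
  - simpl. rewrite Nat.eqb_eq. destruct k as [|m]; split; intro H; try lia.
    + now exists [].
    + destruct H as [v H]. now rewrite word_of_S in H.
  - destruct k as [|m]; cbn [fold_left prefstep].
    + rewrite O. simpl. split; eauto.
    + rewrite word_of_S. destruct (Bool.eqb (Nat.odd m) b) eqn:E.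
      * apply eqb_prop in E. rewrite IH, E. simpl. split; intros [v H]; exists v; congruence.
      * rewrite Z. split; [discriminate|]. intros [v H]. simpl in H.
        injection H as H _. rewrite H, eqb_reflx in E. discriminate.
Qed.

Lemma cfb_prefb k c : cf k -> cf c -> cfb (fun p x => prefb (k p x) (c p x)).
Proof.
  intros Hk Hc. unfold prefb. apply cfb_eqb; [|cfs].
  apply (cf_fold (fun _ _ => prefstep) (fun p x => S (k p x)) c); try cfs.
  apply (cf_ext (fun p z => let s := p1 (p2 z) in let b := Nat.odd (p2 (p2 z)) in
     if s =? 0 then 0 else if s =? 1 then 1 else
     if Bool.eqb (Nat.odd (pred (pred s))) b then S (Nat.div2 (pred (pred s))) else 0)).
  - cbv zeta. cfs.
  - intros p z. cbv zeta. destruct (p1 (p2 z)) as [|[|m]]; reflexivity.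
Qed.
#[global] Hint Resolve cfb_prefb : cf.

Definition pre (x : nat -> bool) (t : nat) : nat := code_of (map x (seq 0 t)).

Lemma pre_S x t : pre x (S t) = ch (pre x t) (x t).
Proof. unfold pre. rewrite seq_S, map_app. simpl. apply code_of_snoc. Qed.
Lemma word_of_pre x t : word_of (pre x t) = map x (seq 0 t).
Proof. apply word_of_code. Qed.
Lemma len_pre x t : len (pre x t) = t.
Proof. unfold len. now rewrite word_of_pre, length_map, length_seq. Qed.
Lemma bit_pre x t i : i < t -> bit (pre x t) i = x i.
Proof.
  intro L. unfold bit. rewrite word_of_pre.
  rewrite (nth_indep _ false (x 0)) by now rewrite length_map, length_seq.
  rewrite map_nth, seq_nth; auto.
Qed.
Lemma hist_play s t : word_of (pre (play s) t) = hist s t.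
Proof. induction t as [|t IH]; simpl; auto. now rewrite pre_S, word_of_ch, IH. Qed.

Lemma is_prefix_pre w x : is_prefix w x <-> w = map x (seq 0 (length w)).
Proof.
  split.
  - intro H. apply nth_ext with (d := false) (d' := x 0).
    + now rewrite length_map, length_seq.
    + intros i L. rewrite map_nth, seq_nth by auto. now apply H.
  - intros H i L. rewrite H. rewrite (nth_indep _ false (x 0)) by now rewrite length_map, length_seq.
    rewrite map_nth, seq_nth; auto.
Qed.
Lemma is_prefix_word k x : is_prefix (word_of k) x <-> exists t, k = pre x t.
Proof.
  rewrite is_prefix_pre. split.
  - intro H. exists (length (word_of k)). unfold pre. rewrite <- H. symmetry. apply code_of_word.
  - intros [t ->]. now rewrite word_of_pre, length_map, length_seq.
Qed.
Lemma prefb_pre k x t : prefb k (pre x t) = true <-> exists u, u <= t /\ k = pre x u.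
Proof.
  rewrite prefb_spec. split.
  - intros [v H]. exists (len k). rewrite word_of_pre in H.
    assert (L : len k <= t).
    { apply (f_equal (@length bool)) in H.
      rewrite length_map, length_seq, length_app in H. unfold len. lia. }
    split; auto. unfold pre.
    replace t with (len k + (t - len k)) in H by lia. rewrite seq_app, map_app in H.
    apply (f_equal (firstn (len k))) in H. rewrite !firstn_app, !firstn_all2 in H
      by (rewrite ?length_map, ?length_seq; unfold len; lia).
    rewrite length_map, length_seq, Nat.sub_diag in H. fold (len k) in H.
    rewrite Nat.sub_diag, !app_nil_r in H. rewrite H.
    unfold len. rewrite firstn_all. symmetry. apply code_of_word.
  - intros (u & L & ->). rewrite !word_of_pre. exists (map x (seq u (t - u))).
    rewrite <- map_app. f_equal. replace t with (u + (t - u)) at 1 by lia. apply seq_app.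
Qed.

(* The bound [len c] makes this decidable and monotone in the position [c]. *)
Definition seen (U : nat -> nat) (c : nat) : bool :=
  bexists (fun i => negb (U i =? 0) && prefb (pred (U i)) c) (S (len c)).

Lemma seen_ch U c b : seen U c = true -> seen U (ch c b) = true.
Proof.
  unfold seen. rewrite !bexists_spec. intros (i & L & H). exists i. rewrite len_ch.
  split; [lia|]. rewrite andb_true_iff in *. destruct H as [H1 H2]. split; auto.
  rewrite prefb_spec in *. destruct H2 as [v H2]. exists (v ++ [b]).
  now rewrite word_of_ch, H2, app_assoc.
Qed.
Lemma seen_covered U x : covered U x <-> exists t, seen U (pre x t) = true.
Proof.
  unfold covered, seen. split.
  - intros (i & k & E & H). apply is_prefix_word in H as [t ->].
    (* A prefix of length [i + t] is long enough both to contain the cylinder and to admit the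
       enumeration index [i]. *)
    exists (i + t). apply bexists_spec. exists i. rewrite len_pre. split; [lia|].
    rewrite E. simpl. apply prefb_pre. exists t. split; auto. lia.
  - intros [t H]. apply bexists_spec in H as (i & _ & H).
    apply andb_true_iff in H as [H1 H2]. apply prefb_pre in H2 as (u & _ & H2).
    exists i, (pre x u). split.
    + destruct (U i); [discriminate|]. simpl in H2. congruence.
    + apply is_prefix_word. eauto.
Qed.

(** * Attractors *)

(** A table is a list nested to the right by [npair], with the newest entry in front. *)
Definition tget (T i : nat) : nat := p1 (Nat.iter i p2 T).

(* [attrtab goal own M j] lists the values at positions [M-j], ..., [M-1]
   of the game truncated at [M]; a child has a larger code than its parent. *)
Definition attrtab (goal own : nat -> bool) (M j : nat) : nat :=
  prec 0 (fun j T =>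
    let c := M - S j in
    let v b := (ch c b <? M) && negb (tget T (ch c b - S c) =? 0) in
    npair (b2n (goal c || (if own c then v false || v true else v false && v true))) T) j.

(** Positions with codes from [M] on count as failures, so this approximates the attractor from
    below as the horizon [M] grows. Truncating by code rather than by depth permits a single
    backward pass over the codes. *)
Definition attr (goal own : nat -> bool) (M c : nat) : bool :=
  (c <? M) && negb (tget (attrtab goal own M (M - c)) 0 =? 0).

Lemma tget_S v T i : tget (npair v T) (S i) = tget T i.
Proof. unfold tget. now rewrite Nat.iter_succ_r, p2_pair. Qed.

Lemma attrtab_get goal own M j d : j <= M -> M - j <= d -> d < M ->
  tget (attrtab goal own M j) (d - (M - j)) = tget (attrtab goal own M (M - d)) 0.
Proof.
  induction j as [|j IH]; intros L1 L2 L3; [lia|].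
  destruct (Nat.eq_dec d (M - S j)) as [->|N].
  - rewrite Nat.sub_diag. f_equal. f_equal. lia.
  - unfold attrtab at 1. rewrite prec_S. fold (attrtab goal own M j). cbv zeta.
    replace (d - (M - S j)) with (S (d - (M - j))) by lia.
    rewrite tget_S. apply IH; lia.
Qed.

(** Replaces the table by a recursion over the game tree; everything about attractors except
    computability is derived from this equation. *)
Lemma attr_eq goal own M c : attr goal own M c = (c <? M) && (goal c ||
  if own c then attr goal own M (ch c false) || attr goal own M (ch c true)
  else attr goal own M (ch c false) && attr goal own M (ch c true)).
Proof.
  unfold attr at 1. destruct (Nat.ltb_spec c M) as [L|]; [|reflexivity]. simpl.
  replace (M - c) with (S (M - S c)) by lia.
  unfold attrtab. rewrite prec_S. fold (attrtab goal own M (M - S c)). cbv zeta.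
  replace (M - S (M - S c)) with c by lia.
  assert (E : forall b, (ch c b <? M) &&
     negb (tget (attrtab goal own M (M - S c)) (ch c b - S c) =? 0) = attr goal own M (ch c b)).
  { intro b. unfold attr. destruct (Nat.ltb_spec (ch c b) M) as [L'|]; auto. simpl.
    pose proof (ch_gt c b).
    rewrite <- (attrtab_get goal own M (M - S c) (ch c b)) by lia.
    do 4 f_equal. lia. }
  rewrite !E. unfold tget at 1. simpl. rewrite p1_pair.
  now destruct (goal c || _).
Qed.

Lemma cf_iter_p2 i T : cf i -> cf T -> cf (fun p x => Nat.iter (i p x) p2 (T p x)).
Proof.
  intros Hi HT. apply (cf_ext (fun p x => prec (T p x) (fun _ r => p2 r) (i p x))); [cfs|].
  intros. unfold prec. induction (i p x); simpl; congruence.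
Qed.
#[global] Hint Resolve cf_iter_p2 : cf.

Lemma cfb_attr goal own M c :
  cfb (fun p z => goal p (p1 z) (p2 z)) -> cfb (fun p z => own p (p1 z) (p2 z)) ->
  cf M -> cf c -> cfb (fun p x => attr (goal p x) (own p x) (M p x) (c p x)).
Proof.
  intros Hg Ho HM Hc.
  apply (cfb_call3 (fun p x M c => attr (goal p x) (own p x) M c) (fun _ x => x) M c); auto; try cfs.
  unfold attr. apply cfb_andb; [cfs|]. apply cfb_negb, cfb_eqb; [|cfs].
  unfold tget. apply cf_p1. apply cf_iter_p2; [cfs|]. unfold attrtab.
  apply cf_prec; [cfs|cfs|]. cbv zeta. unfold tget.
  apply cf_npair; [|cfs]. apply cf_b2n, cfb_orb.
  - apply (cfb_call2 goal); auto; cfs.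
  - apply cfb_if; [apply (cfb_call2 own); auto; cfs| |]; cfs.
Qed.

Section Attractor.
Variables goal own : nat -> bool.
Let A := attr goal own.

Lemma attr_goal c : goal c = true -> A (S c) c = true.
Proof.
  intro H. unfold A. rewrite attr_eq, H. simpl. rewrite andb_true_r. apply Nat.ltb_lt. lia.
Qed.
Lemma attr_lt M c : A M c = true -> c < M.
Proof. unfold A. rewrite attr_eq, andb_true_iff, Nat.ltb_lt. tauto. Qed.
Lemma attr_child M c : A M c = true -> goal c = false ->
  if own c then exists b, A M (ch c b) = true else forall b, A M (ch c b) = true.
Proof.
  unfold A. rewrite attr_eq, andb_true_iff. intros [_ H] G. rewrite G in H. simpl in H.
  destruct (own c).
  - apply orb_true_iff in H as [H|H]; eauto.
  - apply andb_true_iff in H as [H1 H2]. intros []; auto.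
Qed.
Lemma attr_intro M c : c < M ->
  (if own c then exists b, A M (ch c b) = true else forall b, A M (ch c b) = true) ->
  A M c = true.
Proof.
  unfold A. intros L H. rewrite attr_eq. apply andb_true_iff. split; [now apply Nat.ltb_lt|].
  apply orb_true_iff. right. destruct (own c).
  - apply orb_true_iff. destruct H as [[] H]; auto.
  - now rewrite !H.
Qed.
Lemma attr_mono M M' : M <= M' -> forall c, A M c = true -> A M' c = true.
Proof.
  intro L.
  assert (K : forall k c, M - c <= k -> A M c = true -> A M' c = true).
  { induction k as [|k IH]; intros c Lk H; pose proof (attr_lt _ _ H); [lia|].
    destruct (goal c) eqn:G.
    - unfold A. rewrite attr_eq, G. simpl. rewrite andb_true_r. apply Nat.ltb_lt. lia.
    - apply attr_intro; [lia|]. pose proof (attr_child _ _ H G) as C.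
      assert (forall b, A M (ch c b) = true -> A M' (ch c b) = true)
        by (intros b; apply IH; pose proof (ch_gt c b); lia).
      destruct (own c); [destruct C as [b C]; eauto|auto]. }
  intros c. apply (K (M - c)). lia.
Qed.
End Attractor.

(* Ranks are shifted by one so that [0] can stand for infinity. *)
Definition is_rank (f : nat -> bool) (r : nat) : Prop :=
  match r with
  | 0 => forall M, f M = false
  | S M => f M = true /\ forall M', M' < M -> f M' = false
  end.

Lemma is_rank_exists f : exists r, is_rank f r.
Proof.
  destruct (classic (exists M, f M = true)) as [[M H]|N].
  - induction M as [M IH] using lt_wf_ind.
    destruct (classic (exists M', M' < M /\ f M' = true)) as [(M' & L & H')|N]; eauto.
    exists (S M). split; auto. intros M' L. destruct (f M') eqn:E; auto. exfalso. eauto.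
  - exists 0. intro M. destruct (f M) eqn:E; auto. exfalso. eauto.
Qed.
Lemma is_rank_pos f r : is_rank f r -> (r <> 0 <-> exists M, f M = true).
Proof.
  destruct r as [|M]; simpl; intro H; split.
  - congruence.
  - intros [M E]. rewrite H in E. discriminate.
  - intros _. exists M. tauto.
  - lia.
Qed.
Lemma is_rank_le f r M : is_rank f r -> f M = true -> r <> 0 /\ r <= S M.
Proof.
  destruct r as [|m]; simpl; intros H E.
  - rewrite H in E. discriminate.
  - split; [lia|]. destruct (le_lt_dec m M); [lia|].
    destruct H as [_ H]. rewrite (H M) in E by auto. discriminate.
Qed.

(** * Games of the difference hierarchy *)

Section Levels.
(** Levels run from [0] to [n]. At position [c] player [own c] moves, [sn l c] says that [c] is
    known to lie in [U_l], [P l] is the player favoured by [U_l], and [R l c] is the shifted rank of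
    [c] in [V_l]. *)
Variable n : nat.
Variable own : nat -> bool.
Variable sn : nat -> nat -> bool.
Variable P : nat -> bool.
Variable R : nat -> nat -> nat.

(** Only ranks of levels below [l] matter, so [HR] determines [R] by recursion on the level. The
    guards keep the truncated subtractions from pointing to a wrong level. *)
Definition goal (l c : nat) : bool :=
  sn l c && ((l =? 0) || (R (l - 1) c =? 0)) || (2 <=? l) && negb (R (l - 2) c =? 0).
Definition force (l : nat) : nat -> nat -> bool :=
  attr (goal l) (fun c => Bool.eqb (own c) (P l)).

Hypothesis sn_ch : forall l c b, sn l c = true -> sn l (ch c b) = true.
Hypothesis P_S : forall l, P (S l) = negb (P l).
Hypothesis HR : forall l c, is_rank (fun M => force l M c) (R l c).

Lemma force_child l M c : force l M c = true -> goal l c = false ->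
  if Bool.eqb (own c) (P l) then exists b, force l M (ch c b) = true
  else forall b, force l M (ch c b) = true.
Proof. exact (attr_child _ _ M c). Qed.

Definition V (l c : nat) : Prop := R l c <> 0.

Lemma V_force l c : V l c <-> exists M, force l M c = true.
Proof. exact (is_rank_pos _ _ (HR l c)). Qed.

Lemma goal_spec l c : goal l c = true <->
  (sn l c = true /\ (forall k, l = S k -> ~ V k c)) \/ (exists k, l = S (S k) /\ V k c).
Proof.
  unfold goal, V.
  rewrite orb_true_iff, !andb_true_iff, orb_true_iff, negb_true_iff, Nat.leb_le, !Nat.eqb_eq, Nat.eqb_neq.
  split.
  - intros [[H1 H2]|[H1 H2]]; [left|right].
    + split; auto. intros k ->. simpl in H2. rewrite Nat.sub_0_r in H2. destruct H2; lia.
    + exists (l - 2). split; auto; lia.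
  - intros [[H1 H2]|[k [-> H2]]]; [left|right].
    + split; auto. destruct l as [|k]; auto. right. simpl. rewrite Nat.sub_0_r.
      specialize (H2 k eq_refl). lia.
    + split; [lia|]. simpl. rewrite Nat.sub_0_r. auto.
Qed.

Lemma V_goal l c : goal l c = true -> V l c.
Proof. intro H. apply V_force. exists (S c). now apply attr_goal. Qed.

Lemma V_SS l c : V l c -> V (S (S l)) c.
Proof. intro H. apply V_goal, goal_spec. right. eauto. Qed.

Lemma V_add l k c : V l c -> V (l + 2 * k) c.
Proof.
  intro H. induction k as [|k IH]; [now rewrite Nat.add_0_r|].
  replace (l + 2 * S k) with (S (S (l + 2 * k))) by lia. now apply V_SS.
Qed.

(** The complement of an attractor is a trap. Branching is binary, so if both children were forced,
    the sum of their horizons would serve for both and hence for the parent. *)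
Lemma notV_child l c : ~ V l c ->
  if Bool.eqb (own c) (P l) then forall b, ~ V l (ch c b) else exists b, ~ V l (ch c b).
Proof.
  intro N. destruct (Bool.eqb (own c) (P l)) eqn:E.
  - intros b H. apply N. apply V_force in H as [M H]. apply V_force.
    exists M. apply attr_intro; [pose proof (attr_lt _ _ _ _ H); pose proof (ch_gt c b); lia|].
    rewrite E. eauto.
  - destruct (classic (V l (ch c false))) as [H0|]; eauto.
    destruct (classic (V l (ch c true))) as [H1|]; eauto.
    exfalso. apply N. apply V_force in H0 as [M0 H0], H1 as [M1 H1]. apply V_force.
    exists (M0 + M1). apply attr_intro.
    + pose proof (attr_lt _ _ _ _ H0). pose proof (ch_gt c false). lia.
    + rewrite E. intros []; eapply attr_mono; try eassumption; lia.
Qed.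

(** Before the goal the attractor supplies the move. At a goal position in [U_l] outside [V_(l-1)],
    the favoured player can stay outside, since [V_(l-1)] belongs to the opponent, and [U_l]
    persists. In [V_(l-2)] the induction hypothesis applies. *)
Lemma V_child l c : V l c ->
  if Bool.eqb (own c) (P l) then exists b, V l (ch c b) else forall b, V l (ch c b).
Proof.
  revert c. induction l as [l IH] using lt_wf_ind. intros c H.
  destruct (goal l c) eqn:G.
  - apply goal_spec in G as [[G N]|[k [-> Hk]]].
    + destruct l as [|k].
      * assert (forall b, V 0 (ch c b)).
        { intro b. apply V_goal, goal_spec. left. split; auto. lia. }
        destruct Bool.eqb; auto. now exists true.
      * pose proof (notV_child k c (N k eq_refl)) as C.
        assert (forall b, ~ V k (ch c b) -> V (S k) (ch c b)).
        { intros b Hb. apply V_goal, goal_spec. left. split; auto. now intros k' [= <-]. }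
        rewrite P_S. destruct (own c), (P k); simpl in *; auto;
          destruct C as [b C]; eauto.
    + specialize (IH k ltac:(lia) c Hk). rewrite !P_S, negb_involutive.
      destruct Bool.eqb.
      * destruct IH as [b IH]. exists b. now apply V_SS.
      * intro b. now apply V_SS.
  - apply V_force in H as [M H]. pose proof (force_child _ _ _ H G) as C.
    destruct Bool.eqb.
    + destruct C as [b C]. exists b. apply V_force. eauto.
    + intro b. apply V_force. exists M. apply C.
Qed.

(** In a common position, moves staying in [V_l] combine with moves towards the goal of [V_(l+1)].
    Within the horizon this reaches a position of [V_l] that is also a goal of level [l+1], hence
    lies in [V_(l-1)], which the induction on the level excludes. *)
Lemma V_disjoint l c : V l c -> ~ V (S l) c.
Proof.
  revert c. induction l as [l IH] using lt_wf_ind.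
  assert (K : forall k M c, M - c <= k -> V l c -> force (S l) M c = true -> False).
  { induction k as [|k IHk]; intros M c L H F; pose proof (attr_lt _ _ _ _ F); [lia|].
    destruct (goal (S l) c) eqn:G.
    - apply goal_spec in G as [[_ N]|[j [E Hj]]].
      + exact (N l eq_refl H).
      + injection E as ->. apply (IH j ltac:(lia) c Hj H).
    - pose proof (force_child _ _ _ F G) as C.
      pose proof (V_child l c H) as D. rewrite P_S in C.
      assert (J : forall b, V l (ch c b) -> force (S l) M (ch c b) = true -> False).
      { intro b. apply IHk. pose proof (ch_gt c b). lia. }
      destruct (own c), (P l); simpl in *;
        (destruct D as [b D]; exact (J b D (C b))) || (destruct C as [b C]; exact (J b (D b) C)). }
  intros c H H'. apply V_force in H' as [M F]. exact (K (M - c) M c (le_n _) H F).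
Qed.

Lemma P_add l k : P (l + 2 * k) = P l.
Proof.
  induction k as [|k IH]; [now rewrite Nat.add_0_r|].
  replace (l + 2 * S k) with (S (S (l + 2 * k))) by lia.
  now rewrite !P_S, negb_involutive.
Qed.

Lemma V_same_parity l m c : l <= m -> P l = P m -> V l c -> V m c.
Proof.
  intros L E H. destruct (Nat.Even_or_Odd (m - l)) as [[k K]|[k K]].
  - replace m with (l + 2 * k) by lia. now apply V_add.
  - replace m with (S (l + 2 * k)) in E by lia. rewrite P_S, P_add in E. now destruct (P l).
Qed.
Lemma V_other_parity l m c : l < m -> P l <> P m -> V l c -> ~ V m c.
Proof.
  intros L E H. destruct m as [|m]; [lia|]. apply V_disjoint.
  apply V_same_parity with (l := l); auto; [lia|].
  rewrite P_S in E. now destruct (P l), (P m).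
Qed.

Definition lev (c : nat) : nat := bmin (fun l => negb (R l c =? 0)) (S n).

Lemma lev_le c : lev c <= S n.
Proof. apply bmin_le. Qed.
Lemma lev_V c : lev c <= n -> V (lev c) c.
Proof.
  intro L. assert (H := bmin_true (fun l => negb (R l c =? 0)) (S n) ltac:(unfold lev in L; lia)).
  apply negb_true_iff, Nat.eqb_neq in H. exact H.
Qed.
Lemma lev_notV c l : l < lev c -> ~ V l c.
Proof.
  intros L H. apply bmin_lt in L. apply negb_false_iff, Nat.eqb_eq in L. auto.
Qed.
Lemma lev_min c l : V l c -> l <= n -> lev c <= l.
Proof.
  intros H L. destruct (le_lt_dec (lev c) l); auto. exfalso. exact (lev_notV c l l0 H).
Qed.

(** Restricts only the player who wins from [c]. Minimality of the rank is phrased through horizons: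
    one that suffices after the other move suffices after the chosen one. Outside all [V_l] the
    winner must avoid [V_n] whenever possible. *)
Definition optimal (s : nat -> bool) : Prop := forall c,
  (lev c <= n -> own c = P (lev c) -> forall M,
     force (lev c) M (ch c (negb (s c))) = true -> force (lev c) M (ch c (s c)) = true) /\
  (lev c = S n -> own c = P (S n) -> V n (ch c (s c)) -> V n (ch c (negb (s c)))).

Lemma optimal_step s c b : optimal s -> (own c = P (lev c) -> b = s c) ->
  P (lev (ch c b)) = P (lev c) /\ lev (ch c b) <= lev c /\
  (lev c <= n -> goal (lev c) c = false -> forall M,
     force (lev c) M c = true -> force (lev c) M (ch c b) = true).
Proof.
  intros Hs Hb. destruct (Hs c) as [Hs1 Hs2].
  destruct (le_lt_dec (lev c) n) as [L|L].
  - pose proof (V_child _ _ (lev_V c L)) as C.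
    assert (F : forall M, goal (lev c) c = false ->
       force (lev c) M c = true -> force (lev c) M (ch c b) = true).
    { intros M G F. pose proof (force_child _ _ _ F G) as D.
      destruct (Bool.eqb (own c) (P (lev c))) eqn:E; [|apply D].
      apply eqb_prop in E. destruct D as [b' D]. rewrite (Hb E).
      destruct (Bool.bool_dec b' (s c)) as [->|N]; auto.
      apply Hs1; auto. replace (negb (s c)) with b'; auto. now destruct b', (s c). }
    assert (H : V (lev c) (ch c b)).
    { destruct (Bool.eqb (own c) (P (lev c))) eqn:E; [|apply C].
      apply eqb_prop in E. destruct C as [b' D]. rewrite (Hb E).
      destruct (Bool.bool_dec b' (s c)) as [->|N]; auto.
      apply V_force in D as [M D]. apply V_force. exists M.
      apply Hs1; auto. replace (negb (s c)) with b'; auto. now destruct b', (s c). }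
    assert (L' : lev (ch c b) <= lev c) by now apply lev_min.
    split; [|auto].
    destruct (Bool.bool_dec (P (lev (ch c b))) (P (lev c))) as [E|N]; auto. exfalso.
    assert (lev (ch c b) <> lev c) by congruence.
    apply (V_other_parity _ _ (ch c b)) in N; [auto|lia|apply lev_V; lia].
  - assert (E : lev c = S n) by (pose proof (lev_le c); lia).
    (* No [V_l] contains [c]. Player [P n] cannot enter [V_n], and the other player, the winner,
       does so only if both children lie in it. *)
    assert (N : ~ V n (ch c b)).
    { pose proof (notV_child n c (lev_notV c n L)) as C.
      destruct (Bool.eqb (own c) (P n)) eqn:Eo; [apply C|].
      assert (Eo' : own c = P (S n)).
      { rewrite P_S. now destruct (own c), (P n). }
      rewrite (Hb ltac:(congruence)). destruct C as [b' C].
      destruct (Bool.bool_dec b' (s c)) as [->|D]; auto.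
      intro H. apply C. apply (Hs2 E Eo') in H.
      replace b' with (negb (s c)); auto. now destruct b', (s c). }
    split; [|split; [rewrite E; apply lev_le|lia]].
    destruct (Bool.bool_dec (P (lev (ch c b))) (P (lev c))) as [E'|D]; auto. exfalso.
    rewrite E, P_S in D.
    destruct (le_lt_dec (lev (ch c b)) n) as [L'|L'].
    + apply N, V_same_parity with (l := lev (ch c b)); auto.
      * now destruct (P (lev (ch c b))), (P n).
      * now apply lev_V.
    + assert (E' : lev (ch c b) = S n) by (pose proof (lev_le (ch c b)); lia).
      rewrite E', P_S in D. auto.
Qed.

Lemma sn_pre l x t u : t <= u -> sn l (pre x t) = true -> sn l (pre x u) = true.
Proof. intros L H. induction L; auto. rewrite pre_S. auto. Qed.

(** The level never increases, hence becomes constant at some [l] of the right parity. If [l <= n],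
    its goal is reached, and not through [V_(l-2)], as that would lower the level; so [U_l] is
    entered. An earlier [U_g] is never entered, since that would put the play into [V_g]. *)
Lemma optimal_win s x : optimal s ->
  (forall t, own (pre x t) = P (lev 0) -> x t = s (pre x t)) ->
  exists l, l <= S n /\ P l = P (lev 0) /\
    (l <= n -> exists t, sn l (pre x t) = true) /\
    forall g t, g < l -> sn g (pre x t) = false.
Proof.
  intros Hs Hx.
  assert (HP : forall t, P (lev (pre x t)) = P (lev 0)).
  { induction t as [|t IH]; auto. rewrite pre_S.
    destruct (optimal_step s (pre x t) (x t) Hs) as [E _]; [|congruence].
    intro E. apply Hx. congruence. }
  assert (St : forall t, lev (pre x (S t)) <= lev (pre x t) /\
     (lev (pre x t) <= n -> goal (lev (pre x t)) (pre x t) = false -> forall M,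
     force (lev (pre x t)) M (pre x t) = true -> force (lev (pre x t)) M (pre x (S t)) = true)).
  { intro t. rewrite pre_S. apply (optimal_step s (pre x t) (x t) Hs).
    intro E. apply Hx. congruence. }
  assert (T : exists t0, forall t, t0 <= t -> lev (pre x t) = lev (pre x t0)).
  { assert (K : forall k t, lev (pre x t) <= k ->
      exists t0, forall t, t0 <= t -> lev (pre x t) = lev (pre x t0)).
    { induction k as [k IH] using lt_wf_ind. intros t L.
      destruct (classic (exists u, t <= u /\ lev (pre x u) < lev (pre x t))) as [(u & Lu & D)|N].
      - apply (IH (lev (pre x u)) ltac:(lia) u). lia.
      - exists t. intros u Lu.
        assert (lev (pre x u) <= lev (pre x t)).
        { clear - Lu St. induction Lu; auto. destruct (St m). lia. }
        destruct (Nat.eq_dec (lev (pre x u)) (lev (pre x t))); auto.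
        exfalso. apply N. exists u. split; auto. lia. }
    apply (K (lev (pre x 0)) 0). auto. }
  destruct T as [t0 T]. set (l := lev (pre x t0)) in *.
  exists l. split; [apply lev_le|]. split; [apply HP|]. split.
  - intro L.
    assert (K : exists t, t0 <= t /\ goal l (pre x t) = true).
    { apply NNPP. intro N.
      destruct (proj1 (V_force l (pre x t0)) (lev_V _ L)) as [M HM].
      assert (HF : forall k, force l M (pre x (t0 + k)) = true).
      { induction k as [|k IH]; [now rewrite Nat.add_0_r|].
        rewrite Nat.add_succ_r. destruct (St (t0 + k)) as [_ S2].
        rewrite T in S2 by lia. apply S2; auto.
        destruct (goal l (pre x (t0 + k))) eqn:G; auto.
        exfalso. apply N. exists (t0 + k). split; auto. lia. }
      (* The horizon [M] would remain valid forever, but a position of depth [k] has a code of at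
         least [k]. *)
      assert (HL : forall k, k <= pre x k).
      { induction k as [|k IH]; [lia|]. rewrite pre_S.
        pose proof (ch_gt (pre x k) (x k)). lia. }
      pose proof (attr_lt _ _ _ _ (HF M)). pose proof (HL (t0 + M)). lia. }
    destruct K as (t & Lt & G). exists t. apply goal_spec in G as [[G _]|[k [E Hk]]]; auto.
    exfalso. apply (lev_notV (pre x t) k); auto. rewrite T by auto. lia.
  - intros g t Lg. destruct (sn g (pre x t)) eqn:E; auto. exfalso.
    apply (sn_pre g x t (t0 + t)) in E; [|lia].
    assert (N : forall j, j < l -> ~ V j (pre x (t0 + t))).
    { intros j Lj. apply lev_notV. rewrite T by lia. auto. }
    apply (N g Lg). apply V_goal, goal_spec. left. split; auto.
    intros k ->. apply N. lia.
Qed.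

End Levels.

(** * Weihrauch reductions through total functionals *)

(** With total [K] and [H], the only domain condition left in a reduction is that of the realizer of
    [g]. *)
Lemma W_le_intro {X Y X' Y' : rspace} (f : mvf X Y) (g : mvf X' Y') (K H : B -> nat -> nat) :
  cf K -> cf H ->
  (forall p x, names X p x -> in_dom f x ->
     exists x', names X' (H p) x' /\ in_dom g x' /\
       forall r y', names Y' r y' -> g x' y' ->
         exists y, names Y (K (bpair p r)) y /\ f x y) ->
  W_le f g.
Proof.
  intros [eK HK] [eH HH] Hred.
  exists {| pdom := fun _ => True; pval := K |}, {| pdom := fun _ => True; pval := H |}.
  split; [exists eK; simpl; auto|]. split; [exists eH; simpl; auto|].
  intros G HG p x Hx Dx. simpl.
  destruct (Hred p x Hx Dx) as (x' & Nx' & Dx' & Hy).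
  destruct (HG _ _ Nx' Dx') as (Hd & y' & Ny' & Gy').
  split; [auto|]. eauto.
Qed.

Lemma bfst_bpair p q : bfst (bpair p q) = p.
Proof.
  extensionality m. unfold bfst, bpair. now rewrite Nat.even_mul, Nat.div2_double.
Qed.
Lemma bsnd_bpair p q : bsnd (bpair p q) = q.
Proof.
  extensionality m. unfold bsnd, bpair.
  rewrite Nat.even_add, Nat.even_mul. simpl Nat.even. rewrite Nat.add_1_r.
  now rewrite Nat.div2_succ_double.
Qed.

Lemma cf_bfst f : cf f -> cf (fun z x => bfst z (f z x)).
Proof. intro. unfold bfst. cfs. Qed.
Lemma cf_bsnd f : cf f -> cf (fun z x => bsnd z (f z x)).
Proof. intro. unfold bsnd. cfs. Qed.
#[global] Hint Resolve cf_bfst cf_bsnd : cf.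

Lemma cf_compose (F G : B -> nat -> nat) : cf F -> cf G -> cf (fun p x => F (G p) x).
Proof.
  intros HF HG. apply (cf_sub F (fun p _ => G p) (fun _ x => x)); auto; [|cfs].
  apply cf_call1; auto. cfs.
Qed.

Lemma cf_bpair (F G : B -> nat -> nat) h : cf F -> cf G -> cf h ->
  cf (fun p x => bpair (F p) (G p) (h p x)).
Proof.
  intros. unfold bpair. apply cf_if; [cfs|apply cf_call1|apply cf_call1]; auto; cfs.
Qed.

(** Where the iterated [bpair] of [pow_space] stores entry [k] of component [i]. *)
Fixpoint idx (i k : nat) : nat :=
  match i with 0 => 2 * k | S j => 2 * idx j k + 1 end.

Fixpoint ptup (X : rspace) (N : nat) (a : nat -> carrier X) : carrier (pow_space X N) :=
  match N with
  | 0 => tt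
  | S m => (a 0, ptup X m (fun i => a (S i)))
  end.

Lemma ptup_surj (X : rspace) (d : carrier X) N : forall z : carrier (pow_space X N),
  exists a, z = ptup X N a.
Proof.
  induction N as [|N IH]; simpl.
  - intros []. now exists (fun _ => d).
  - intros [x z]. destruct (IH z) as [a ->].
    now exists (fun i => match i with 0 => x | S j => a j end).
Qed.

Lemma ptup_names (X : rspace) N : forall r a, names (pow_space X N) r (ptup X N a) <->
  forall i, i < N -> names X (fun k => r (idx i k)) (a i).
Proof.
  induction N as [|N IH]; intros r a; simpl.
  - split; auto. intros; lia.
  - rewrite IH. split.
    + intros [H0 H1] [|i] L; [exact H0|]. apply H1. lia.
    + intro H. split; [apply (H 0); lia|]. intros i L. apply (H (S i)). lia.
Qed.

Lemma ptup_mvf {X Y : rspace} (f : mvf X Y) N : forall a b,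
  pow_mvf f N (ptup X N a) (ptup Y N b) <-> forall i, i < N -> f (a i) (b i).
Proof.
  induction N as [|N IH]; intros a b; simpl.
  - split; auto. intros; lia.
  - unfold prod_mvf. simpl. rewrite IH. split.
    + intros [H0 H1] [|i] L; [exact H0|]. apply H1. lia.
    + intro H. split; [apply (H 0); lia|]. intros i L. apply (H (S i)). lia.
Qed.

(** Inverse of [idx]: every odd number stands for one application of [bsnd]. Since [i <= idx i k],
    [z] rounds are enough. *)
Definition unidx (z : nat) : nat :=
  let y := Nat.iter z (fun y => if Nat.odd (p2 y) then npair (S (p1 y)) (Nat.div2 (p2 y)) else y)
             (npair 0 z) in
  npair (p1 y) (Nat.div2 (p2 y)).

Lemma odd_double_1 m : Nat.odd (2 * m + 1) = true.
Proof. exact (odd_2m m true). Qed.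

Lemma unidx_idx i k : unidx (idx i k) = npair i k.
Proof.
  unfold unidx. cbv zeta.
  set (f := fun y => if Nat.odd (p2 y) then npair (S (p1 y)) (Nat.div2 (p2 y)) else y).
  assert (H : forall i j m, i <= m -> Nat.iter m f (npair j (idx i k)) = npair (j + i) (2 * k)).
  { clear i. induction i as [|i IH]; intros j m L.
    - rewrite Nat.add_0_r. clear L. induction m as [|m IH]; [reflexivity|].
      rewrite Nat.iter_succ, IH. unfold f. rewrite p2_pair.
      now rewrite Nat.odd_mul.
    - destruct m as [|m]; [lia|]. rewrite Nat.iter_succ_r.
      replace (f (npair j (idx (S i) k))) with (npair (S j) (idx i k)).
      + rewrite IH by lia. f_equal. lia.
      + unfold f. rewrite p1_pair, p2_pair. cbn [idx]. rewrite odd_double_1.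
        now rewrite Nat.add_1_r, Nat.div2_succ_double. }
  rewrite H.
  - now rewrite p1_pair, p2_pair, Nat.div2_double.
  - clear. induction i; simpl; lia.
Qed.

Lemma cf_unidx f : cf f -> cf (fun p x => unidx (f p x)).
Proof.
  intro H. apply (cf_call1 (fun _ => unidx)); auto. unfold unidx.
  assert (K : cf (fun _ z => Nat.iter z (fun y =>
     if Nat.odd (p2 y) then npair (S (p1 y)) (Nat.div2 (p2 y)) else y) (npair 0 z))).
  { apply (cf_ext (fun _ z => prec (npair 0 z) (fun _ y =>
       if Nat.odd (p2 y) then npair (S (p1 y)) (Nat.div2 (p2 y)) else y) z)); [cfs|].
    reflexivity. }
  cbv zeta. cfs.
Qed.
#[global] Hint Resolve cf_unidx : cf.

(** * Codes of outcome sets and membership in the difference hierarchy *)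

Fixpoint mkcode (f : nat -> bool) (k : nat) : nat :=
  match k with 0 => 0 | S m => (if f m then 2 ^ m else 0) + mkcode f m end.

Lemma mkcode_lt f k : mkcode f k < 2 ^ k.
Proof. induction k as [|k IH]; simpl; [lia|]. destruct (f k); lia. Qed.

Lemma mkcode_in f k o : in_code (mkcode f k) o <-> o < k /\ f o = true.
Proof.
  unfold in_code. induction k as [|k IH].
  - cbn [mkcode]. rewrite Nat.bits_0. split; [discriminate|lia].
  - cbn [mkcode]. pose proof (mkcode_lt f k) as L.
    destruct (Nat.lt_trichotomy o k) as [Lo|[->|Lo]].
    + assert (E : Nat.testbit ((if f k then 2 ^ k else 0) + mkcode f k) o = Nat.testbit (mkcode f k) o).
      { destruct (f k); auto.
        rewrite <- (Nat.mod_pow2_bits_low _ k) by auto.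
        rewrite <- (Nat.mod_pow2_bits_low (mkcode f k) k) by auto.
        f_equal. rewrite <- (Nat.mul_1_l (2 ^ k)) at 1.
        rewrite Nat.add_comm. apply Nat.Div0.mod_add. }
      rewrite E, IH. intuition lia.
    + assert (E : Nat.testbit ((if f k then 2 ^ k else 0) + mkcode f k) k = f k).
      { rewrite Nat.testbit_eqb.
        replace (((if f k then 2 ^ k else 0) + mkcode f k) / 2 ^ k) with (b2n (f k)).
        - now destruct (f k).
        - apply Nat.div_unique with (r := mkcode f k); auto. destruct (f k); simpl; lia. }
      rewrite E. intuition lia.
    + assert (E : Nat.testbit ((if f k then 2 ^ k else 0) + mkcode f k) o = false).
      { apply (Nat.testbit_false). rewrite Nat.div_small; auto.
        apply Nat.lt_le_trans with (2 ^ S k).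
        - simpl. destruct (f k); lia.
        - apply Nat.pow_le_mono_r; lia. }
      rewrite E. split; [discriminate|lia].
Qed.

Lemma cf_mkcode f k : cfb (fun p z => f p (p1 z) (p2 z)) -> cf k ->
  cf (fun p x => mkcode (f p x) (k p x)).
Proof.
  intros Hf Hk. apply (cf_ext (fun p x => prec 0 (fun m r => (if f p x m then 2 ^ m else 0) + r) (k p x))).
  - apply cf_prec; [cfs|cfs|]. apply cf_add; [|cfs]. apply cf_if; [|cfs|cfs].
    apply (cfb_call2 f); auto; cfs.
  - intros p x. induction (k p x) as [|m IH]; simpl; congruence.
Qed.

(** The index in [Dm] is unique, so exhibiting the least one, with [m] for none, reduces membership
    to a comparison of parities. *)
Lemma Dm_min m q x l : l <= m -> (l < m -> covered (comp q l) x) ->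
  (forall g, g < l -> ~ covered (comp q g) x) ->
  (Dm m q x <-> Nat.odd l <> Nat.odd m).
Proof.
  intros Ll H1 H2. unfold Dm. split.
  - intros (be & Lb & Hb & Hg & Ho).
    destruct (Nat.lt_trichotomy be l) as [L|[->|L]]; auto; exfalso.
    + apply (H2 be L), Hb. lia.
    + apply (Hg l L), H1. lia.
  - intro Ho. exists l. auto.
Qed.

(** * Solving games *)

Lemma cfb_seen (U : B -> nat -> nat -> nat) c :
  cf (fun p z => U p (p1 z) (p2 z)) -> cf c -> cfb (fun p x => seen (U p x) (c p x)).
Proof.
  intros HU Hc. unfold seen. apply cfb_bexists; [cfs|].
  assert (cf (fun p z => U p (p1 z) (p2 z))) by exact HU.
  assert (cf (fun p z => c p (p1 z))) by (apply (cf_call1 c); auto; cfs).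
  cfs.
Qed.

Section Solve.
Variable n : nat.

(* An oracle [q] contains a name of a game in column [0] and the ranks of level [l],
   as far as they are known, in column [S l]. *)
Definition gown (q : B) (d : nat) : bool := negb (q (npair 0 (npair 1 d)) =? 0).
Definition gname (q : B) (th j : nat) : nat := q (npair 0 (npair 3 (npair (npair 0 th) j))).
(** In the game with threshold set [th] player 1, coded [false], wants the outcome in [th]. A play
    with least index [l] is in the named set of [Dm (S n)] when the parities of [l] and [S n]
    differ, and the tag [1] complements this. *)
Definition gfav (q : B) (th l : nat) : bool :=
  negb (xorb (xorb (Nat.odd l) (Nat.odd (S n))) (gname q th 0 =? 1)).
Definition gseen (q : B) (th l d : nat) : bool := seen (fun i => gname q th (S (npair l i))) d.
Definition grank (q : B) (th l d : nat) : nat := q (npair (S l) (npair th d)).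
Definition gforce (q : B) (th l M d : nat) : bool :=
  force (gown q) (gseen q th) (gfav q th) (grank q th) l M d.

Lemma cfb_gown d : cf d -> cfb (fun q x => gown q (d q x)).
Proof. intro. unfold gown. cfs. Qed.
Lemma cf_gname th j : cf th -> cf j -> cf (fun q x => gname q (th q x) (j q x)).
Proof. intros. unfold gname. cfs. Qed.
#[local] Hint Resolve cfb_gown cf_gname : cf.
Lemma cfb_gfav th l : cf th -> cf l -> cfb (fun q x => gfav q (th q x) (l q x)).
Proof. intros. unfold gfav. cfs. Qed.
Lemma cf_grank th l d : cf th -> cf l -> cf d -> cf (fun q x => grank q (th q x) (l q x) (d q x)).
Proof. intros. unfold grank. cfs. Qed.
Lemma cfb_gseen th l d : cf th -> cf l -> cf d -> cfb (fun q x => gseen q (th q x) (l q x) (d q x)).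
Proof.
  intros. apply (cfb_call3 gseen); auto. unfold gseen. apply cfb_seen; cfs.
Qed.
#[local] Hint Resolve cfb_gfav cf_grank cfb_gseen : cf.
Lemma cfb_gforce th l M d : cf th -> cf l -> cf M -> cf d ->
  cfb (fun q x => gforce q (th q x) (l q x) (M q x) (d q x)).
Proof.
  intros. apply (cfb_call4 gforce); auto. unfold gforce, force.
  apply cfb_attr; [unfold goal| | |]; cfs.
Qed.
#[local] Hint Resolve cfb_gforce : cf.

(** The [i]-th approximation to the ranks of level [l] searches for a horizon below [i] and answers
    [0], for infinity, as long as none is found. All other columns are copied. *)
Definition step (l : nat) (q : B) (y : nat) : nat :=
  if p1 (p1 y) =? S l then
    let m := bmin (fun M => gforce q (p1 (p2 (p1 y))) l M (p2 (p2 (p1 y)))) (p2 y) in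
    if m <? p2 y then S m else 0
  else q (p1 y).

Lemma cf_step l : cf (step l).
Proof. unfold step. cbv zeta. cfs. Qed.

Definition next (l : nat) (q : B) : B := fun z =>
  if p1 z =? S l then
    epsilon (inhabits 0) (is_rank (fun M => gforce q (p1 (p2 z)) l M (p2 (p2 z))))
  else q z.

(** The bounded search changes its answer at most once, when the least horizon comes into reach. *)
Lemma step_lim l q : is_lim (step l q) (next l q).
Proof.
  intro z. unfold step, next. autorewrite with pr.
  destruct (p1 z =? S l) eqn:Ez.
  - set (f := fun M => gforce q (p1 (p2 z)) l M (p2 (p2 z))).
    pose proof (epsilon_spec (inhabits 0) _ (is_rank_exists f)) as H.
    destruct (epsilon (inhabits 0) (is_rank f)) as [|M]; simpl in H.
    + exists 0. intros i _. autorewrite with pr. rewrite Ez. fold f.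
      pose proof (bmin_le f i). cbv zeta.
      destruct (Nat.ltb_spec (bmin f i) i) as [L|]; auto.
      apply bmin_true in L. congruence.
    + exists (S M). intros i L. autorewrite with pr. rewrite Ez. fold f. cbv zeta.
      destruct H as [H1 H2].
      assert (E : bmin f i = M).
      { destruct (Nat.lt_trichotomy (bmin f i) M) as [D|[D|D]]; auto; exfalso.
        - pose proof (bmin_true f i ltac:(lia)) as T.
          rewrite (H2 _ D) in T. discriminate.
        - apply bmin_lt in D. congruence. }
      rewrite E. destruct (Nat.ltb_spec M i); auto; lia.
  - exists 0. intros i _. autorewrite with pr. now rewrite Ez.
Qed.

Definition stage0 (p : B) (z : nat) : nat := if p1 z =? 0 then p (p2 z) else 0.

Fixpoint stage (p : B) (l : nat) : B :=
  match l with 0 => stage0 p | S m => next m (stage p m) end.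

(** A computable name of [stage p l] in the [l]-th jump: each level is computed under the limits
    already present and contributes one further limit. *)
Fixpoint stagelim (l : nat) : B -> nat -> nat :=
  match l with 0 => stage0 | S m => fun p => liftn m (step m) (stagelim m p) end.

Lemma cf_stagelim l : cf (stagelim l).
Proof.
  induction l as [|l IH]; simpl.
  - unfold stage0. cfs.
  - apply cf_compose; auto. apply cf_liftn, cf_step.
Qed.

Lemma stagelim_lim p l : lim_iter l (stagelim l p) (stage p l).
Proof.
  induction l as [|l IH]; [intro; reflexivity|].
  apply lim_iter_is_lim with (q := step l (stage p l)).
  - apply (liftn_lim l (step l)); auto. apply cf_step.
  - apply step_lim.
Qed.

(** After [n] limits the ranks of level [n] are still unknown; the value [n] stands for both levels
    [n] and [S n]. *)
Definition glev (q : B) (th d : nat) : nat := bmin (fun l => negb (grank q th l d =? 0)) n.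

(* [bad q th d b t]: at stage [t] it is known that [b] is not an optimal move at position [d]. *)
Definition bad (q : B) (th d : nat) (b : bool) (t : nat) : bool :=
  let l := glev q th d in
  if l <? n then
    negb (grank q th l (ch d (negb b)) =? 0) &&
    ((grank q th l (ch d b) =? 0) || (grank q th l (ch d (negb b)) <? grank q th l (ch d b)))
  else
    let b' := if Bool.eqb (gown q d) (gfav q th n) then b else negb b in
    gforce q th n t (ch d (negb b')) && negb (gforce q th n t (ch d b')).

(** Bit [<th,d>] of a point is the move at [d] in the threshold game [th]. A word is enumerated when
    its last letter, at index [j], is recognised as bad at stage [p2 i]. *)
Definition solset (q : B) (i : nat) : nat :=
  let j := pred (len (p1 i)) in
  if negb (len (p1 i) =? 0) && bad q (p1 j) (p2 j) (bit (p1 i) j) (p2 i)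
  then S (p1 i) else 0.

Definition losttest (q : B) (z : nat) : nat := b2n (gforce q (p1 z) n (p2 z) 0).

Lemma cfb_bad th d b t : cf th -> cf d -> cfb b -> cf t ->
  cfb (fun q x => bad q (th q x) (d q x) (b q x) (t q x)).
Proof.
  intros Hth Hd Hb Ht. unfold bad.
  assert (cf (fun q x => glev q (th q x) (d q x))).
  { apply (cf_call2 glev); auto. unfold glev. cfs. }
  cbv zeta. cfs.
Qed.
#[local] Hint Resolve cfb_bad : cf.
Lemma cf_solset : cf solset.
Proof. unfold solset. cbv zeta. cfs. Qed.
Lemma cf_losttest : cf losttest.
Proof. unfold losttest. cfs. Qed.

Section Correct.
Variable p : B.
Let q := stage p n.

Lemma stage_col0 l m : stage p l (npair 0 m) = p m.
Proof.
  induction l as [|l IH]; simpl.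
  - unfold stage0. now autorewrite with pr.
  - unfold next. rewrite p1_pair. exact IH.
Qed.

Lemma stage_stable l l' z : l < l' -> stage p l' (npair (S l) z) = stage p (S l) (npair (S l) z).
Proof.
  induction 1 as [|m L IH]; auto. rewrite <- IH. simpl. unfold next at 1.
  rewrite p1_pair. destruct (Nat.eqb_spec (S l) (S m)); auto. lia.
Qed.

Definition rk (th l d : nat) : nat := grank (stage p (S l)) th l d.

Lemma grank_stage th l l' d : l < l' -> grank (stage p l') th l d = rk th l d.
Proof. apply stage_stable. Qed.

Definition pforce (th : nat) := force (gown q) (gseen q th) (gfav q th) (rk th).

(** Level [l] consults only the ranks of levels [l-1] and [l-2], which are final from stage [l]
    on. *)
Lemma gforce_stage th l l' M d : l <= l' -> gforce (stage p l') th l M d = pforce th l M d.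
Proof.
  intro L. unfold gforce, pforce, force.
  assert (Ename : gname (stage p l') = gname q).
  { unfold gname, q. extensionality a. extensionality b. now rewrite !stage_col0. }
  assert (Eown : gown (stage p l') = gown q).
  { unfold gown, q. extensionality a. now rewrite !stage_col0. }
  assert (Efav : gfav (stage p l') = gfav q).
  { unfold gfav. now rewrite Ename. }
  assert (Eseen : gseen (stage p l') = gseen q).
  { unfold gseen. now rewrite Ename. }
  rewrite Eown, Efav, Eseen. f_equal.
  extensionality c. unfold goal.
  destruct l as [|[|l]].
  - reflexivity.
  - simpl Nat.sub. now rewrite grank_stage by lia.
  - now rewrite !grank_stage by lia.
Qed.

Lemma rk_rank th l d : is_rank (fun M => pforce th l M d) (rk th l d).
Proof.
  unfold rk, grank. simpl. unfold next. autorewrite with pr. rewrite Nat.eqb_refl.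
  replace (fun M => pforce th l M d) with (fun M => gforce (stage p l) th l M d).
  - apply epsilon_spec, is_rank_exists.
  - extensionality M. now apply gforce_stage.
Qed.

Lemma gfav_S th l : gfav q th (S l) = negb (gfav q th l).
Proof.
  unfold gfav. rewrite (Nat.odd_succ l), <- Nat.negb_odd.
  now destruct (Nat.odd l), (Nat.odd (S n)), (gname q th 0 =? 1).
Qed.
Lemma gseen_ch th l c b : gseen q th l c = true -> gseen q th l (ch c b) = true.
Proof. apply seen_ch. Qed.

Lemma glev_lev th d : glev q th d < n -> lev n (rk th) d = glev q th d.
Proof.
  intro L. unfold lev.
  assert (H := bmin_true _ _ L). fold (glev q th d) in H. cbv beta in H.
  unfold q in H. rewrite grank_stage in H by exact L.
  apply Nat.le_antisymm.
  - apply lev_min; [|lia]. apply negb_true_iff, Nat.eqb_neq in H. exact H.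
  - destruct (le_lt_dec (glev q th d) (lev n (rk th) d)) as [|D]; auto. exfalso.
    assert (D' : lev n (rk th) d < n) by lia.
    apply bmin_lt in D. unfold q in D. rewrite grank_stage in D by exact D'.
    apply negb_false_iff, Nat.eqb_eq in D. apply (lev_V n (rk th) d) in D; auto. lia.
Qed.
Lemma glev_lev_ge th d : n <= glev q th d -> n <= lev n (rk th) d.
Proof.
  intro L. destruct (le_lt_dec n (lev n (rk th) d)) as [|D]; auto. exfalso.
  pose proof (lev_V n (rk th) d ltac:(lia)) as H. apply H.
  rewrite <- (grank_stage th _ n) by auto. fold q.
  assert (D' : lev n (rk th) d < glev q th d) by lia.
  apply bmin_lt in D'. now apply negb_false_iff, Nat.eqb_eq in D'.
Qed.

(** Two ranks cannot each exceed the other, and at level [n] the horizons are monotone. This leaves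
    a permitted move at every position. *)
Lemma not_bad_both th d t t' : bad q th d false t = true -> bad q th d true t' = true -> False.
Proof.
  unfold bad. cbv zeta. destruct (glev q th d <? n); simpl negb.
  - rewrite !andb_true_iff, !negb_true_iff, !orb_true_iff, !Nat.eqb_eq, !Nat.eqb_neq, !Nat.ltb_lt. lia.
  - assert (K : forall b, gforce q th n t (ch d (negb b)) && negb (gforce q th n t (ch d b)) = true ->
        gforce q th n t' (ch d b) && negb (gforce q th n t' (ch d (negb b))) = true -> False).
    { intros b. rewrite !andb_true_iff, !negb_true_iff. intros [H1 H2] [H3 H4].
      destruct (le_lt_dec t t') as [L|L].
      - pose proof (attr_mono _ _ t t' L _ H1) as H5.
        unfold gforce, force in *. congruence.
      - pose proof (attr_mono _ _ t' t (Nat.lt_le_incl _ _ L) _ H3) as H5.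
        unfold gforce, force in *. congruence. }
    destruct (Bool.eqb (gown q d) (gfav q th n)); simpl.
    + exact (K false).
    + exact (K true).
Qed.

Lemma solset_covered x : covered (solset q) x <->
  exists th d t, bad q th d (x (npair th d)) t = true.
Proof.
  unfold covered, solset. cbv zeta. split.
  - intros (i & k & E & H). destruct (negb _ && _) eqn:C; [|discriminate]. injection E as <-.
    apply andb_true_iff in C as [C1 C2]. apply negb_true_iff, Nat.eqb_neq in C1.
    apply is_prefix_word in H as [u H]. rewrite H in *. rewrite len_pre in *.
    rewrite bit_pre in C2 by lia. exists (p1 (pred u)), (p2 (pred u)), (p2 i).
    now rewrite npair_surj.
  - intros (th & d & t & H). exists (npair (pre x (S (npair th d))) t), (pre x (S (npair th d))).
    autorewrite with pr. rewrite len_pre. simpl pred. autorewrite with pr.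
    rewrite bit_pre by lia. simpl. rewrite H. split; auto.
    apply is_prefix_word. eauto.
Qed.

(** The bits are constrained independently of each other. As [p] is arbitrary here, this covers all
    numbers [th], whether or not they code upper sets. *)
Lemma solset_nonempty : exists x, ~ covered (solset q) x.
Proof.
  assert (C : forall j, exists b, forall t, bad q (p1 j) (p2 j) b t = false).
  { intro j. destruct (classic (forall t, bad q (p1 j) (p2 j) false t = false)) as [|N]; eauto.
    exists true. intro t. destruct (bad q (p1 j) (p2 j) true t) eqn:E; auto. exfalso.
    apply N. intro t'. destruct (bad q (p1 j) (p2 j) false t') eqn:E'; auto.
    exfalso. exact (not_bad_both _ _ _ _ E' E). }
  apply fun_choice in C as [x Hx]. exists x. rewrite solset_covered.
  intros (th & d & t & H). specialize (Hx (npair th d) t). autorewrite with pr in Hx. congruence.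
Qed.

(** Below level [n] ranks are compared directly. From level [n] on, [bad] makes the player of [V_n]
    hasten and the opponent delay. Delaying includes staying outside [V_n] where possible, so one
    test serves without knowing whether the position lies in [V_n]. *)
Lemma solset_optimal x th : ~ covered (solset q) x ->
  optimal n (gown q) (gseen q th) (gfav q th) (rk th) (fun d => x (npair th d)).
Proof.
  rewrite solset_covered. intros N d.
  assert (Nb : forall t, bad q th d (x (npair th d)) t = false).
  { intro t. destruct (bad _ _ _ _ t) eqn:E; auto. exfalso. eauto. }
  clear N. set (b := x (npair th d)) in *. cbv beta. unfold bad in Nb. cbv zeta in Nb.
  fold (pforce th).
  destruct (Nat.ltb_spec (glev q th d) n) as [L|L].
  - pose proof (glev_lev th d L) as E. specialize (Nb 0).
    unfold q in Nb. rewrite !grank_stage in Nb by exact L. fold q in Nb.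
    rewrite E. split; [|lia]. intros _ _ M F.
    set (l := glev q th d) in *.
    pose proof (rk_rank th l (ch d (negb b))) as R1. pose proof (rk_rank th l (ch d b)) as R2.
    destruct (is_rank_le _ _ M R1 F) as [R3 R4].
    apply andb_false_iff in Nb. rewrite negb_false_iff, orb_false_iff, Nat.eqb_eq, Nat.eqb_neq, Nat.ltb_ge in Nb.
    destruct Nb as [Nb|[Nb1 Nb2]]; [lia|].
    destruct (rk th l (ch d b)) as [|m]; [lia|]. destruct R2 as [R2 _].
    exact (attr_mono _ _ m M ltac:(lia) _ R2).
  - pose proof (glev_lev_ge th d L) as L'.
    assert (Nb' : forall t, pforce th n t (ch d (negb (if eqb (gown q d) (gfav q th n) then b else negb b))) = true ->
       pforce th n t (ch d (if eqb (gown q d) (gfav q th n) then b else negb b)) = true).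
    { intros t H. specialize (Nb t).
      assert (E : forall c, gforce q th n t c = pforce th n t c) by (intro; now apply gforce_stage).
      rewrite !E, H in Nb. simpl in Nb. now apply negb_false_iff in Nb. }
    clear Nb. split.
    + intros L2 Eo M. assert (E : lev n (rk th) d = n) by lia. rewrite E in *.
      rewrite Eo, eqb_reflx in Nb'. apply Nb'.
    + intros E Eo H. rewrite Eo, gfav_S in Nb'.
      replace (eqb (negb (gfav q th n)) (gfav q th n)) with false in Nb'
        by now destruct (gfav q th n).
      rewrite negb_involutive in Nb'.
      apply (V_force _ _ _ _ (rk_rank th)) in H as [M H].
      apply (V_force _ _ _ _ (rk_rank th)). exists M. now apply Nb'.
Qed.

Lemma losttest_zero th : (forall t, losttest q (npair th t) = 0) <-> ~ V (rk th) n 0.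
Proof.
  rewrite (V_force _ _ _ _ (rk_rank th)). fold (pforce th).
  unfold losttest. split.
  - intros H [M F]. specialize (H M). autorewrite with pr in H. unfold q in H.
    rewrite gforce_stage in H by auto. now rewrite F in H.
  - intros N t. autorewrite with pr. unfold q. rewrite gforce_stage by auto.
    destruct (pforce th n t 0) eqn:E; auto. exfalso. eauto.
Qed.

Definition winner (th : nat) : bool := gfav q th (lev n (rk th) 0).

(** A level of the parity of [n] puts the root into [V_n], and one of the other parity keeps it out.
    So this single bit determines the parity of the level, although not the level. *)
Lemma winner_test th b : (b = true <-> ~ V (rk th) n 0) ->
  winner th = if b then gfav q th (S n) else gfav q th n.
Proof.
  unfold winner. intro H.
  pose proof (lev_le n (rk th) 0) as L.
  destruct b.
  - assert (N : ~ V (rk th) n 0) by (now apply H). clear H.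
    destruct (le_lt_dec (lev n (rk th) 0) n) as [L'|L'].
    + destruct (Bool.bool_dec (gfav q th (lev n (rk th) 0)) (gfav q th n)) as [E|E].
      * exfalso. apply N.
        apply (V_same_parity _ _ _ _ (gfav_S th) (rk_rank th)) with (l := lev n (rk th) 0); auto.
        now apply lev_V.
      * rewrite gfav_S. destruct (gfav q th n), (gfav q th (lev n (rk th) 0)); auto; congruence.
    + f_equal. lia.
  - assert (Hn : V (rk th) n 0).
    { apply NNPP. intro N. apply H in N. discriminate. }
    assert (L' : lev n (rk th) 0 <= n) by now apply lev_min.
    destruct (Bool.bool_dec (gfav q th (lev n (rk th) 0)) (gfav q th n)) as [E|E]; auto.
    exfalso. refine (V_other_parity _ _ _ _ (gseen_ch th) (gfav_S th) (rk_rank th) _ _ 0 _ E (lev_V _ _ _ L') Hn).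
    destruct (Nat.eq_dec (lev n (rk th) 0) n) as [E'|]; [|lia]. rewrite E' in E. congruence.
Qed.

End Correct.
End Solve.

(** * From games to closed choice *)

Section Upper.
Variable n : nat.

Definition kpref (z : B) (a b : nat) : bool := negb (bfst z (npair 2 (npair a b)) =? 0).
Definition upcode (z : B) (o : nat) : nat :=
  mkcode (fun o' => (o' =? o) || kpref z o o') (bfst z (npair 0 0)).
Definition supcode (z : B) (o : nat) : nat :=
  mkcode (fun o' => kpref z o o') (bfst z (npair 0 0)).
(* The least index [2 ^ th - 1] of component [th] of the answer to the LPO instances
   is shifted by one because entry [0] holds the number of instances. *)
Definition kwin (z : B) (th : nat) : bool :=
  if bsnd (bsnd z) (2 ^ th) =? 1 then gfav n (stage0 (bfst z)) th (S n)
  else gfav n (stage0 (bfst z)) th n.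
(** The value of the game: player 1 can secure at least [o], and player 2 can prevent anything
    better for player 1. *)
Definition kval (z : B) : nat :=
  bmin (fun o => negb (kwin z (upcode z o)) && kwin z (supcode z o)) (bfst z (npair 0 0)).
(** Player 1 plays to secure the value and player 2 plays to prevent more. *)
Definition ksol (z : B) (j : nat) : nat :=
  bfst (bsnd z)
    (npair (if bfst z (npair 1 j) =? 0 then upcode z (kval z) else supcode z (kval z)) j).

(** There is one LPO instance for each code below [2 ^ k], with [k] the number of outcomes, so the
    code is itself the component index. *)
Definition hsol (p : B) : B :=
  bpair (liftn n (solset n) (stagelim n n p))
    (fun z => if z =? 0 then 2 ^ p (npair 0 0)
              else liftn n (losttest n) (stagelim n n p)
                     (unshuf n (p1 (unidx (pred z))) (p2 (unidx (pred z))))).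

Lemma cf_bfst_bsnd f : cf f -> cf (fun z x => bfst (bsnd z) (f z x)).
Proof. intro. unfold bfst, bsnd. cfs. Qed.
Lemma cf_bsnd_bsnd f : cf f -> cf (fun z x => bsnd (bsnd z) (f z x)).
Proof. intro. unfold bsnd. cfs. Qed.
#[local] Hint Resolve cf_bfst_bsnd cf_bsnd_bsnd : cf.

Lemma cf_ksol : cf ksol.
Proof.
  assert (cfb (fun z x => kpref z (p1 x) (p2 x))) as Hp by (unfold kpref; cfs).
  assert (forall f g, cf f -> cf g -> cfb (fun z x => kpref z (f z x) (g z x))) as Hp'
    by (intros; now apply (cfb_call2 kpref)).
  assert (forall f, cf f -> cf (fun z x => upcode z (f z x))) as Hu.
  { intros f Hf. apply (cf_call1 upcode); auto. unfold upcode. apply cf_mkcode; [|cfs].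
    apply cfb_orb; [cfs|apply Hp'; cfs]. }
  assert (forall f, cf f -> cf (fun z x => supcode z (f z x))) as Hs.
  { intros f Hf. apply (cf_call1 supcode); auto. unfold supcode. apply cf_mkcode; [|cfs].
    apply Hp'; cfs. }
  assert (Hf : forall l, cfb (fun z x => gfav n (stage0 (bfst z)) x l)).
  { intro l. unfold gfav, gname, stage0. cfs. }
  assert (forall f, cf f -> cfb (fun z x => kwin z (f z x))) as Hw.
  { intros f Hf'. apply (cfb_call1 kwin); auto. unfold kwin.
    pose proof (Hf (S n)). pose proof (Hf n). cfs. }
  assert (cf (fun z x => kval z)) as Hv.
  { unfold kval. apply cf_bmin; [cfs|]. apply cfb_andb; [apply cfb_negb|]; apply Hw;
      [apply Hu|apply Hs]; cfs. }
  unfold ksol. apply cf_bfst_bsnd, cf_npair; [|cfs]. apply cf_if; [cfs|auto|auto].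
Qed.

Lemma cf_hsol : cf hsol.
Proof.
  unfold hsol. apply (cf_bpair _ _ (fun _ x => x)); [| |cfs].
  - apply cf_compose; [apply cf_liftn, cf_solset|apply cf_stagelim].
  - apply cf_if; [cfs|cfs|].
    apply (cf_call1 (fun p => liftn n (losttest n) (stagelim n n p))); [|cfs].
    apply cf_compose; [apply cf_liftn, cf_losttest|apply cf_stagelim].
Qed.

Section Named.
Variables (G : game) (p : B).
Hypothesis valid : valid_game G.
Hypothesis named : names (game_space (Dunion_name (S n))) p G.

Lemma named_own d : gown (stage n p n) d = g_d G (word_of d).
Proof.
  unfold gown. rewrite stage_col0. destruct named as (_ & H & _).
  pose proof (H d) as E. unfold comp in E. rewrite E. now destruct (g_d G (word_of d)).
Qed.

(** Only the winner has to follow [x]. [optimal_win] fixes the parity of the least index of an open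
    set met by the play, and [gfav] translates it into membership according to the tag. *)
Lemma named_win th x y : upper_code G false th ->
  ~ covered (solset n (stage n p n)) x ->
  (forall t, g_d G (word_of (pre y t)) = winner n p th -> y t = x (npair th (pre y t))) ->
  (in_code th (g_v G y) <-> winner n p th = false).
Proof.
  intros Hu Nx Hy.
  destruct (optimal_win n (gown (stage n p n)) (gseen (stage n p n) th) (gfav n (stage n p n) th)
     (rk n p th) (gseen_ch n p th) (gfav_S n p th) (rk_rank n p th)
     (fun d => x (npair th d)) y) as (l & Ll & Pl & H1 & H2).
  - now apply solset_optimal.
  - intros t E. apply Hy. rewrite <- named_own. exact E.
  - destruct named as (_ & _ & _ & Hn). specialize (Hn false th Hu). cbv [b2n] in Hn.
    set (nm := fun j => comp p 3 (npair (npair 0 th) j)) in Hn.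
    assert (En : gname (stage n p n) th = nm).
    { unfold gname, nm, comp. extensionality j. now rewrite stage_col0. }
    assert (C : forall g, covered (comp (tl nm) g) y <-> exists t, gseen (stage n p n) th g (pre y t) = true).
    { intro g. rewrite seen_covered. unfold gseen. rewrite En. reflexivity. }
    assert (D : Dm (S n) (tl nm) y <-> Nat.odd l <> Nat.odd (S n)).
    { apply Dm_min; auto.
      - intro L. apply C, H1. lia.
      - intros g L Hc. apply C in Hc as [t Ht]. rewrite H2 in Ht by auto. discriminate. }
    change (gfav n (stage n p n) th l = winner n p th) in Pl. rewrite <- Pl.
    unfold gfav. rewrite En. destruct Hn as [[E Hn]|[E Hn]]; rewrite Hn, D, E; simpl Nat.eqb;
      destruct (Nat.odd l), (Nat.odd (S n)); simpl; intuition congruence.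
Qed.

Lemma pref_named a b : a < g_k G -> b < g_k G ->
  negb (p (npair 2 (npair a b)) =? 0) = g_pref G a b.
Proof.
  intros La Lb. destruct named as (_ & _ & H & _). specialize (H a b La Lb).
  unfold comp in H. rewrite H. now destruct (g_pref G a b).
Qed.

Definition up (o : nat) : nat := mkcode (fun o' => (o' =? o) || g_pref G o o') (g_k G).
Definition sup (o : nat) : nat := mkcode (fun o' => g_pref G o o') (g_k G).

Lemma up_upper o : o < g_k G -> upper_code G false (up o).
Proof.
  intro Lo. split; [apply mkcode_lt|]. intros a b La Lb. unfold up. rewrite !mkcode_in. simpl.
  rewrite !orb_true_iff, !Nat.eqb_eq. intros [_ [->|H]] H'; split; auto.
  destruct valid as (_ & _ & T & _). right. eauto.
Qed.
Lemma sup_upper o : o < g_k G -> upper_code G false (sup o).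
Proof.
  intro Lo. split; [apply mkcode_lt|]. intros a b La Lb. unfold sup. rewrite !mkcode_in. simpl.
  intros [_ H] H'. split; auto. destruct valid as (_ & _ & T & _). eauto.
Qed.

Lemma winner_decided th x : upper_code G false th ->
  ~ covered (solset n (stage n p n)) x ->
  exists y, in_code th (g_v G y) <-> winner n p th = false.
Proof.
  intros Hu Nx. pose (s := fun w => x (npair th (code_of w))).
  exists (play s). apply (named_win th x (play s)); auto.
  intros t _. unfold play, s at 1. rewrite <- (hist_play s t). now rewrite code_of_word.
Qed.

Lemma pref_min (A : nat -> Prop) k : (forall o, A o -> o < k) -> k <= g_k G -> (exists o, A o) ->
  exists o, A o /\ forall o', A o' -> o' = o \/ g_pref G o o' = true.
Proof.
  revert A. destruct valid as (_ & Irr & T & Tot).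
  induction k as [|k IH]; intros A HA Lk [a Ha].
  - apply HA in Ha. lia.
  - destruct (classic (exists o, A o /\ o < k)) as [E|N].
    + destruct (IH (fun o => A o /\ o < k)) as (o & [Ho Lo] & Hm); [tauto|lia|auto|].
      destruct (classic (A k)) as [Hk|Nk].
      * destruct (Tot o k) as [P|P]; try lia.
        -- exists o. split; auto. intros o' Ho'. pose proof (HA _ Ho').
           destruct (Nat.eq_dec o' k) as [->|]; auto. apply Hm. split; auto. lia.
        -- exists k. split; auto. intros o' Ho'. pose proof (HA _ Ho').
           destruct (Nat.eq_dec o' k) as [->|]; auto. right.
           destruct (Hm o') as [->|P']; auto; [split; auto; lia|].
           apply (T k o o'); auto; lia.
      * exists o. split; auto. intros o' Ho'. pose proof (HA _ Ho'). apply Hm. split; auto.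
        destruct (Nat.eq_dec o' k) as [->|]; [contradiction|lia].
    + exists a. split; auto. intros o' Ho'. left. pose proof (HA _ Ho'). pose proof (HA _ Ha).
      destruct (Nat.eq_dec o' k); destruct (Nat.eq_dec a k); try congruence;
        exfalso; apply N; [exists a|exists o'|exists o']; split; auto; lia.
Qed.

(** Start at the least outcome, whose upper set is everything, and climb as long as player 1 also
    wins the strict upper set. *)
Lemma value_exists x : ~ covered (solset n (stage n p n)) x ->
  exists o, o < g_k G /\ winner n p (up o) = false /\ winner n p (sup o) = true.
Proof.
  intro Nx. pose proof valid as (Hv & Irr & T & Tot).
  (* The induction is on a bound for the number of outcomes that player 1 strictly prefers to
     [o]. *)
  assert (K : forall m o, length (filter (fun o' => g_pref G o o') (seq 0 (g_k G))) <= m ->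
     o < g_k G -> winner n p (up o) = false ->
     exists o, o < g_k G /\ winner n p (up o) = false /\ winner n p (sup o) = true).
  { induction m as [|m IH]; intros o Lm Lo Ho.
    all: destruct (winner n p (sup o)) eqn:E; [eauto|].
    all: destruct (winner_decided (sup o) x (sup_upper o Lo) Nx) as [y Hy].
    all: pose proof (proj2 Hy E) as Hin; apply mkcode_in in Hin as [L1 P1].
    - apply Nat.le_0_r, length_zero_iff_nil in Lm.
      assert (In (g_v G y) []) as [].
      rewrite <- Lm. apply filter_In. split; auto. apply in_seq. lia.
    - destruct (pref_min (fun o' => o' < g_k G /\ g_pref G o o' = true) (g_k G))
        as (o1 & [Lo1 P1'] & Hm); [tauto|auto|eauto|].
      apply (IH o1); auto.
      + apply Nat.lt_succ_r. apply Nat.lt_le_trans with (2 := Lm).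
        clear - T Irr Lo Lo1 P1'.
        assert (Ks : forall l, (forall a, In a l -> a < g_k G) ->
           length (filter (fun o' => g_pref G o1 o') l) <= length (filter (fun o' => g_pref G o o') l) /\
           (In o1 l -> length (filter (fun o' => g_pref G o1 o') l) < length (filter (fun o' => g_pref G o o') l))).
        { induction l as [|a l IHl]; intro Hl; simpl; [intuition|].
          destruct IHl as [I1 I2]; [intros; apply Hl; now right|].
          assert (La : a < g_k G) by (apply Hl; now left).
          destruct (g_pref G o1 a) eqn:E1.
          - rewrite (T o o1 a) by auto. simpl. split; [lia|].
            intros [->|Hin]; [|specialize (I2 Hin); lia].
            rewrite Irr in E1 by auto. discriminate.
          - destruct (g_pref G o a) eqn:E2; simpl; (split; [lia|]).
            + intros _. lia.
            + intros [->|Hin]; auto. congruence. }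
        apply Ks; [intros a Ha; apply in_seq in Ha; lia|apply in_seq; lia].
      (* As [o1] is the immediate successor of [o], the two sets coincide, and so do their codes. *)
      + replace (up o1) with (sup o); auto.
        assert (Ek : forall k, k <= g_k G -> mkcode (fun o' => g_pref G o o') k =
                       mkcode (fun o' => (o' =? o1) || g_pref G o1 o') k).
        { induction k as [|k IHk]; intro Lk; auto. simpl. rewrite IHk by lia.
          replace ((k =? o1) || g_pref G o1 k) with (g_pref G o k); auto.
          destruct (g_pref G o k) eqn:E1.
          - destruct (Hm k) as [-> | ->]; auto; [now rewrite Nat.eqb_refl|].
            now rewrite orb_true_r.
          - destruct (Nat.eqb_spec k o1) as [->|]; [congruence|].
            destruct (g_pref G o1 k) eqn:E2; auto.
            rewrite (T o o1 k) in E1; auto. }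
        now apply Ek. }
  destruct (pref_min (fun o => o < g_k G) (g_k G)) as (o & Lo & Hm); auto.
  { exists (g_v G (fun _ => false)). apply Hv. }
  apply (K _ o (le_n _) Lo).
  destruct (winner_decided (up o) x (up_upper o Lo) Nx) as [y Hy]. apply Hy.
  apply mkcode_in. split; auto. apply orb_true_iff. rewrite Nat.eqb_eq. auto.
Qed.

(** Player 1's part alone guarantees an outcome in [up o] and player 2's part alone keeps it out of
    [sup o]. Together they give exactly [o], and no deviation can improve on it. *)
Lemma value_NE x o s : ~ covered (solset n (stage n p n)) x -> o < g_k G ->
  winner n p (up o) = false -> winner n p (sup o) = true ->
  (forall d, s (word_of d) = x (npair (if g_d G (word_of d) then sup o else up o) d)) ->
  isNE G s.
Proof.
  intros Nx Lo Hup Hsup Hs. pose proof valid as (Hv & Irr & T & Tot).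
  assert (K1 : forall s', (forall w, g_d G w = false -> s' w = s w) ->
     in_code (up o) (g_v G (play s'))).
  { intros s' H. apply (named_win (up o) x); auto; [now apply up_upper|].
    intros t E. rewrite Hup in E. unfold play. rewrite <- hist_play, H by auto.
    now rewrite Hs, E. }
  assert (K2 : forall s', (forall w, g_d G w = true -> s' w = s w) ->
     ~ in_code (sup o) (g_v G (play s'))).
  { intros s' H Hin. apply (named_win (sup o) x) in Hin; auto; [congruence|now apply sup_upper|].
    intros t E. rewrite Hsup in E. unfold play. rewrite <- hist_play, H by auto.
    now rewrite Hs, E. }
  assert (E : g_v G (play s) = o).
  { pose proof (K1 s ltac:(auto)) as H1. pose proof (K2 s ltac:(auto)) as H2.
    apply mkcode_in in H1 as [L1 H1]. apply orb_true_iff in H1 as [H1|H1].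
    - now apply Nat.eqb_eq.
    - exfalso. apply H2, mkcode_in. auto. }
  intros a s' H. rewrite E. destruct a; simpl.
  - intro P. assert (H1 := K1 s' ltac:(intros w Ew; apply H; congruence)).
    apply mkcode_in in H1 as [L1 H1]. apply orb_true_iff in H1 as [H1|H1].
    + apply Nat.eqb_eq in H1. rewrite H1, Irr in P by auto. discriminate.
    + pose proof (T o _ o Lo L1 Lo H1 P) as C. rewrite Irr in C by auto. discriminate.
  - intro P. apply (K2 s').
    + intros w Ew. apply H. congruence.
    + apply mkcode_in. auto.
Qed.

(** Also provides the domain condition in the reduction to games. *)
Lemma NE_exists : exists s, isNE G s.
Proof.
  destruct (solset_nonempty n p) as [x Nx].
  destruct (value_exists x Nx) as (o & Lo & H1 & H2).
  exists (fun w => x (npair (if g_d G w then sup o else up o) (code_of w))).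
  apply (value_NE x o); auto. intro d. now rewrite code_of_word.
Qed.

End Named.

Lemma mkcode_ext f g k : (forall o, o < k -> f o = g o) -> mkcode f k = mkcode g k.
Proof. induction k as [|k IH]; intro H; simpl; auto. rewrite H, IH; auto. Qed.

Lemma S_idx_0 i : S (idx i 0) = 2 ^ i.
Proof. induction i as [|i IH]; simpl; auto. rewrite <- IH. lia. Qed.

Theorem NE_le_C2_LPO :
  W_le (NE_ap (S n)) (prod_mvf (jump_mvf C2 n) (star_mvf (jump_mvf LPO n))).
Proof.
  apply (W_le_intro _ _ ksol hsol cf_ksol cf_hsol).
  intros p G Hn [s0 [valid _]]. pose (q := stage n p n).
  pose proof Hn as (Ek & Hd & _). unfold comp in Ek, Hd.
  set (k := g_k G) in *.
  pose (inst := fun th t => losttest n q (npair th t)).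
  exists ((fun x => ~ covered (solset n q) x),
          existT _ (2 ^ k) (ptup (jumpn baire_space n) (2 ^ k) inst)).
  split; [|split].
  - split; simpl; unfold hsol.
    + rewrite bfst_bpair. exists (solset n q). split; [|reflexivity].
      apply (liftn_lim n (solset n)); [apply cf_solset|apply stagelim_lim].
    + rewrite bsnd_bpair. split; [simpl; congruence|]. apply ptup_names. intros i Li.
      exists (inst i). split; [|intro; reflexivity].
      replace (fun k0 => _) with (fun y => liftn n (losttest n) (stagelim n n p) (unshuf n i y)).
      * apply (unshuf_lim n i). apply (liftn_lim n (losttest n)); [apply cf_losttest|apply stagelim_lim].
      * extensionality y. unfold tl. cbn [Nat.eqb pred]. rewrite unidx_idx.
        now autorewrite with pr.
  - destruct (solset_nonempty n p) as [x Nx].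
    destruct (fun_choice (fun th b => b = true <-> forall t, inst th t = 0)) as [b Hb].
    { intro th. destruct (classic (forall t, inst th t = 0)); [exists true|exists false]; intuition congruence. }
    exists (x, existT _ (2 ^ k) (ptup bool_space (2 ^ k) b)). split; [exact Nx|].
    exists (ptup bool_space (2 ^ k) b). split; [reflexivity|].
    apply (ptup_mvf (jump_mvf LPO n : mvf (jumpn baire_space n) bool_space)). intros i _. apply Hb.
  - intros r [x [m z]] [Nx [N0 Nz]] [Hx (z' & Hz & Hb)]. simpl in *.
    pose proof (f_equal (@projT1 _ _) Hz) as E. simpl in E. clear N0. subst m.
    (* The answer has as many components as the question, and decidable equality of lengths inverts
       the dependent pair. *)
    apply (inj_pair2_eq_dec _ Nat.eq_dec) in Hz. subst z'.
    destruct (ptup_surj bool_space true (2 ^ k) z) as [b ->].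
    pose proof (proj1 (ptup_mvf (X := jumpn baire_space n) (Y := bool_space) LPO _ _ _) Hb) as Hb'.
    clear Hb. rename Hb' into Hb.
    pose proof (proj1 (ptup_names bool_space _ _ _) Nz) as Nz'. clear Nz. rename Nz' into Nz.
    set (z := bpair p r).
    assert (Ekk : bfst z (npair 0 0) = k) by (unfold z; now rewrite bfst_bpair).
    assert (Hwin : forall th, th < 2 ^ k -> kwin z th = winner n p th).
    { intros th L. rewrite (winner_test n p th (b th)).
      - specialize (Nz th L). simpl in Nz. unfold kwin, z. rewrite bsnd_bpair, bfst_bpair.
        unfold tl in Nz. rewrite S_idx_0 in Nz. rewrite Nz.
        assert (Ef : forall l, gfav n (stage0 p) th l = gfav n (stage n p n) th l).
        { intro l. change (stage0 p) with (stage n p 0). unfold gfav, gname. now rewrite !stage_col0. }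
        rewrite !Ef. now destruct (b th).
      - rewrite <- losttest_zero. apply (Hb th L). }
    assert (Hpref : forall a c, a < k -> c < k -> kpref z a c = g_pref G a c).
    { intros a c La Lc. unfold kpref, z. rewrite bfst_bpair. now apply pref_named. }
    assert (Hup : forall o, o < k -> upcode z o = up G o).
    { intros o Lo. unfold upcode, up. rewrite Ekk. fold k. apply mkcode_ext. intros c Lc.
      now rewrite Hpref. }
    assert (Hsup : forall o, o < k -> supcode z o = sup G o).
    { intros o Lo. unfold supcode, sup. rewrite Ekk. fold k. apply mkcode_ext. intros c Lc.
      now rewrite Hpref. }
    assert (Ht : forall o, o < k -> negb (kwin z (upcode z o)) && kwin z (supcode z o) =
       negb (winner n p (up G o)) && winner n p (sup G o)).
    { intros o Lo. rewrite Hup, Hsup by auto. rewrite !Hwin by apply mkcode_lt. reflexivity. }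
    (* The bounded search succeeds because the value exists. *)
    assert (Lv : kval z < k).
    { destruct (value_exists G p valid Hn x Hx) as (o & Lo & H1 & H2).
      destruct (le_lt_dec k (kval z)) as [L|]; auto. exfalso.
      assert (D : o < kval z) by (unfold k in *; lia). apply bmin_lt in D.
      rewrite Ht, H1, H2 in D by auto. discriminate. }
    pose proof Lv as Hv. unfold kval in Hv. rewrite Ekk in Hv. apply bmin_true in Hv.
    rewrite <- Ekk, <- Ekk in Hv at 1. fold (kval z) in Hv.
    rewrite Ht in Hv by auto. apply andb_true_iff in Hv as [H1 H2]. apply negb_true_iff in H1.
    assert (Hk : forall j, ksol z j =
      b2n (x (npair (if g_d G (word_of j) then sup G (kval z) else up G (kval z)) j))).
    { intro j. unfold ksol. rewrite Hup, Hsup by auto. unfold z at 1 2. rewrite bsnd_bpair, bfst_bpair.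
      rewrite Nx, Hd. f_equal. f_equal. f_equal. now destruct (g_d G (word_of j)). }
    exists (fun w => x (npair (if g_d G w then sup G (kval z) else up G (kval z)) (code_of w))).
    split.
    + intro j. rewrite code_of_word. apply Hk.
    + split; auto. apply (value_NE G p valid Hn x (kval z)); auto.
      intro d. now rewrite code_of_word.
Qed.
End Upper.

(** * From closed choice to games *)

(* [ph = 0] before player 2 has raised a challenge and [ph = S l] once [l] numbers have been
   picked after the challenge; [u] is the part of the current unary pick read so far. *)
Definition mk (ph t yc yx X I u : nat) : nat :=
  npair ph (npair t (npair yc (npair yx (npair X (npair I u))))).
Definition ph (s : nat) := p1 s.
Definition st_t (s : nat) := p1 (p2 s).
Definition st_yc (s : nat) := p1 (p2 (p2 s)).
Definition st_yx (s : nat) := p1 (p2 (p2 (p2 s))).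
Definition st_X (s : nat) := p1 (p2 (p2 (p2 (p2 s)))).
Definition st_I (s : nat) := p1 (p2 (p2 (p2 (p2 (p2 s))))).
Definition st_u (s : nat) := p2 (p2 (p2 (p2 (p2 (p2 s))))).

Lemma mk_eta s : s = mk (ph s) (st_t s) (st_yc s) (st_yx s) (st_X s) (st_I s) (st_u s).
Proof. unfold mk, ph, st_t, st_yc, st_yx, st_X, st_I, st_u. now rewrite !npair_surj. Qed.
Lemma ph_mk a b c d e f g : ph (mk a b c d e f g) = a.
Proof. apply p1_pair. Qed.
Lemma t_mk a b c d e f g : st_t (mk a b c d e f g) = b.
Proof. unfold st_t, mk. now autorewrite with pr. Qed.
Lemma yc_mk a b c d e f g : st_yc (mk a b c d e f g) = c.
Proof. unfold st_yc, mk. now autorewrite with pr. Qed.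
Lemma yx_mk a b c d e f g : st_yx (mk a b c d e f g) = d.
Proof. unfold st_yx, mk. now autorewrite with pr. Qed.
Lemma X_mk a b c d e f g : st_X (mk a b c d e f g) = e.
Proof. unfold st_X, mk. now autorewrite with pr. Qed.
Lemma I_mk a b c d e f g : st_I (mk a b c d e f g) = f.
Proof. unfold st_I, mk. now autorewrite with pr. Qed.
Lemma u_mk a b c d e f g : st_u (mk a b c d e f g) = g.
Proof. unfold st_u, mk. now autorewrite with pr. Qed.
#[global] Hint Rewrite ph_mk t_mk yc_mk yx_mk X_mk I_mk u_mk : mk.

(** * The challenge game *)

Section Challenge.
Variable n : nat.

(** After [N] claims, bits of [x] alternate with opportunities to challenge. A challenge makes the
    pair of claims and prefix the debated point [X]. A pick is a block of zeros closed by a one; its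
    length codes an offset, added to the bound [I] set by the previous pick, and the bound for the
    next pick. *)
Definition mstep (N s : nat) (b : bool) : nat :=
  if ph s =? 0 then
    if st_t s <? N then mk 0 (S (st_t s)) (ch (st_yc s) b) (st_yx s) 0 0 0
    else if Nat.even (st_t s - N) then mk 0 (S (st_t s)) (st_yc s) (ch (st_yx s) b) 0 0 0
    else if b then mk 1 (st_t s) (st_yc s) (st_yx s) (npair (st_yc s) (st_yx s)) 0 0
    else mk 0 (S (st_t s)) (st_yc s) (st_yx s) 0 0 0
  else if ph s =? S (S n) then s
  else if b then
    mk (S (ph s)) (st_t s) (st_yc s) (st_yx s)
       (npair (st_X s) (st_I s + p1 (st_u s))) (p2 (st_u s)) 0
  else mk (ph s) (st_t s) (st_yc s) (st_yx s) (st_X s) (st_I s) (S (st_u s)).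

Definition run (N : nat) (w : list bool) : nat := fold_left (mstep N) w (mk 0 0 0 0 0 0 0).

Definition mover (N s : nat) : bool :=
  if ph s =? 0 then negb (st_t s <? N) && Nat.odd (st_t s - N) else Nat.even (pred (ph s)).

Definition count (c : nat) : nat := fold_left (fun s b => s + b2n b) (word_of c) 0.

(** Index [be > 0] is reached after [S n - be] picks, so the least index tells how far the debate
    went and its parity blames the player whose pick is missing. After all picks index [0] may
    overrule index [1]; the [xorb] with the parity of [n] lets player 1 lose exactly when [T] is
    nonzero. *)
Definition hit (T : B) (be s : nat) : bool :=
  if be =? 0 then (ph s =? S (S n)) && xorb (Nat.odd n) (negb (T (st_X s) =? 0))
  else S (S n) - be <=? ph s.

(** The [j]-th name describes the plays with outcome below [j]. For [j = 0] nothing is covered; if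
    [j] exceeds one plus the number of positive claims, only index [n] is, which has the accepting
    parity. Otherwise an outcome below [j] means that player 1 lost the debate. *)
Definition ucond (T : B) (N j be c : nat) : bool :=
  negb (j =? 0) && (N <=? len c) &&
  (if S (count (st_yc (run N (word_of c)))) <? j then be =? n
   else (be <=? n) && hit T be (run N (word_of c))).

Definition uname (T : B) (N j : nat) : B := fun z =>
  if ucond T N j (p1 z) (p2 z) then S (p2 z) else 0.

Definition lost (T : B) (N : nat) (x : nat -> bool) : Prop := Dm (S n) (uname T N 1) x.

Definition outcome (T : B) (N : nat) (x : nat -> bool) : nat :=
  if excluded_middle_informative (lost T N x) then 0 else S (count (pre x N)).

Definition cgame (T : B) (N : nat) : game :=
  {| g_k := S (S N);
     g_d := fun w => mover N (run N w);
     g_pref := Nat.ltb;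
     g_v := outcome T N |}.

Lemma covered_if (f : nat -> bool) x :
  covered (fun i => if f i then S i else 0) x <-> exists t, f (pre x t) = true.
Proof.
  unfold covered. split.
  - intros (i & k & E & H). destruct (f i) eqn:F; [|discriminate]. injection E as <-.
    apply is_prefix_word in H as [t ->]. eauto.
  - intros [t H]. exists (pre x t), (pre x t). rewrite H. split; auto.
    apply is_prefix_word. eauto.
Qed.

Lemma comp_uname T N j be : comp (uname T N j) be =
  fun i => if ucond T N j be i then S i else 0.
Proof. extensionality i. unfold comp, uname. now autorewrite with pr. Qed.

Section Fixed.
Variables (N : nat) (T : B).

Definition stx (x : nat -> bool) (t : nat) : nat := run N (word_of (pre x t)).

Lemma stx_S x t : stx x (S t) = mstep N (stx x t) (x t).
Proof. unfold stx, run. rewrite pre_S, word_of_ch, fold_left_app. reflexivity. Qed.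

Lemma stx_ph_mono x t u : t <= u -> ph (stx x t) <= ph (stx x u).
Proof.
  induction 1 as [|u L IH]; auto. rewrite stx_S. unfold mstep.
  destruct (Nat.eqb_spec (ph (stx x u)) 0); [|destruct (ph (stx x u) =? S (S n)); auto];
  repeat match goal with |- context [if ?b then _ else _] => destruct b end;
    autorewrite with mk; lia.
Qed.
Lemma stx_frozen x t u : t <= u -> ph (stx x t) = S (S n) -> stx x u = stx x t.
Proof.
  intros L H. induction L as [|u L IH]; auto. rewrite stx_S, IH. unfold mstep.
  now rewrite H, Nat.eqb_refl.
Qed.

Lemma stx_early x t : t <= N -> stx x t = mk 0 t (pre x t) 0 0 0 0.
Proof.
  induction t as [|t IH]; intro L; [reflexivity|]. rewrite stx_S, IH by lia.
  unfold mstep. autorewrite with mk. simpl.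
  destruct (Nat.ltb_spec t N); [|lia]. now rewrite pre_S.
Qed.
Lemma stx_yc x t : N <= t -> st_yc (stx x t) = pre x N.
Proof.
  assert (K : N <= t -> st_yc (stx x t) = pre x N /\ (ph (stx x t) = 0 -> N <= st_t (stx x t))).
  { induction 1 as [|t L [IH1 IH2]].
    - rewrite stx_early by auto. now autorewrite with mk.
    - rewrite stx_S. unfold mstep.
      destruct (Nat.eqb_spec (ph (stx x t)) 0) as [E|E].
      + specialize (IH2 E). destruct (Nat.ltb_spec (st_t (stx x t)) N); [lia|].
        repeat match goal with |- context [if ?b then _ else _] => destruct b end;
          autorewrite with mk; (split; [auto|lia]).
      + destruct (ph (stx x t) =? S (S n)); auto.
        destruct (x t); autorewrite with mk; split; auto; lia. }
  intro L. now apply K.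
Qed.

Lemma ucond_pre j be x t : ucond T N j be (pre x t) = true <->
  j <> 0 /\ N <= t /\
  (if S (count (pre x N)) <? j then be = n else be <= n /\ hit T be (stx x t) = true).
Proof.
  unfold ucond. rewrite len_pre. fold (stx x t).
  rewrite !andb_true_iff, negb_true_iff, Nat.eqb_neq, Nat.leb_le.
  split.
  - intros [[H1 H2] H3]. rewrite stx_yc in H3 by auto. split; auto. split; auto.
    destruct (_ <? j).
    + now apply Nat.eqb_eq.
    + now rewrite andb_true_iff, Nat.leb_le in H3.
  - intros (H1 & H2 & H3). split; auto. rewrite stx_yc by auto.
    destruct (_ <? j).
    + now apply Nat.eqb_eq.
    + now rewrite andb_true_iff, Nat.leb_le.
Qed.

Lemma covered_uname j be x : covered (comp (uname T N j) be) x <->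
  j <> 0 /\ exists t, N <= t /\
    if S (count (pre x N)) <? j then be = n else be <= n /\ hit T be (stx x t) = true.
Proof.
  rewrite comp_uname, (covered_if (ucond T N j be)). split.
  - intros [t H]. apply ucond_pre in H as (H1 & H2 & H3). eauto.
  - intros [H1 [t [H2 H3]]]. exists t. apply ucond_pre. auto.
Qed.

Lemma Dm_uname j x : Dm (S n) (uname T N j) x <-> outcome T N x < j.
Proof.
  unfold outcome.
  destruct (Nat.eq_dec j 0) as [->|Hj].
  - split; [|lia]. rewrite (Dm_min _ _ _ (S n)); auto; [congruence|lia|].
    intros g _ H. apply covered_uname in H. tauto.
  - destruct (Nat.ltb_spec (S (count (pre x N))) j) as [L|L].
    + assert (C : forall be, covered (comp (uname T N j) be) x <-> be = n).
      { intro be. rewrite covered_uname. destruct (Nat.ltb_spec (S (count (pre x N))) j); [|lia].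
        split; [now intros (_ & _ & _ & H0)|]. intros ->. split; auto. now exists N. }
      rewrite (Dm_min _ _ _ n); auto.
      * rewrite Nat.odd_succ, <- Nat.negb_odd.
        destruct (excluded_middle_informative _); split; intros _; try lia;
          now destruct (Nat.odd n).
      * intros _. now apply C.
      * intros g Lg H. apply C in H. lia.
    + assert (C : forall be, covered (comp (uname T N j) be) x <-> covered (comp (uname T N 1) be) x).
      { intro be. rewrite !covered_uname.
        destruct (Nat.ltb_spec (S (count (pre x N))) j); [lia|].
        destruct (Nat.ltb_spec (S (count (pre x N))) 1); [lia|].
        split; intros [_ C]; (split; [lia|exact C]). }
      assert (E : Dm (S n) (uname T N j) x <-> lost T N x).
      { unfold lost, Dm. split; intros (be & H1 & H2 & H3 & H4); exists be;
          (split; [auto|split; [intro; apply C; auto|split; [intros g Lg Hg; apply (H3 g Lg), C, Hg|auto]]]). }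
      rewrite E. destruct (excluded_middle_informative _); split; auto; try lia; try tauto.
Qed.

Lemma covered_lost be x : covered (comp (uname T N 1) be) x <->
  be <= n /\ exists t, N <= t /\ hit T be (stx x t) = true.
Proof.
  rewrite covered_uname. change (S (count (pre x N)) <? 1) with false. cbv iota.
  split.
  - intros (_ & t & L & Lb & H). eauto.
  - intros [Lb (t & L & H)]. split; auto. exists t. auto.
Qed.

(** With [L] picks made the least index is [S n - L], the default [S n] being the case [L = 0]. Pick
    [L] is owed by player 1 exactly when [L] is odd. *)
Lemma lost_stuck x t0 L : L <= n -> (forall t, t0 <= t -> ph (stx x t) = S L) ->
  (lost T N x <-> Nat.odd L = true).
Proof.
  intros Ln H.
  assert (Hp : forall t, ph (stx x t) <= S L).
  { intro t. rewrite <- (H (t0 + t)) by lia. apply stx_ph_mono. lia. }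
  unfold lost. rewrite (Dm_min _ _ _ (S n - L)).
  - rewrite Nat.odd_sub by lia. now destruct (Nat.odd L), (Nat.odd (S n)).
  - lia.
  - intro Lt. apply covered_lost. split; [lia|]. exists (t0 + N). split; [lia|].
    unfold hit. destruct (Nat.eqb_spec (S n - L) 0); [lia|].
    apply Nat.leb_le. rewrite H by lia. lia.
  - intros g Lg C. apply covered_lost in C as [_ (t & _ & C)]. unfold hit in C.
    specialize (Hp t). destruct (Nat.eqb_spec g 0).
    + apply andb_true_iff in C as [C _]. apply Nat.eqb_eq in C. lia.
    + apply Nat.leb_le in C. lia.
Qed.

Lemma lost_check x t : ph (stx x t) = S (S n) ->
  (lost T N x <-> T (st_X (stx x t)) <> 0).
Proof.
  intro H.
  assert (Hc : covered (comp (uname T N 1) 0) x <->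
               xorb (Nat.odd n) (negb (T (st_X (stx x t)) =? 0)) = true).
  { rewrite covered_lost. unfold hit. simpl Nat.eqb. cbv iota. split.
    - intros [_ (u & _ & C)]. apply andb_true_iff in C as [C1 C2]. apply Nat.eqb_eq in C1.
      rewrite <- (stx_frozen x t (t + u)) by (auto; lia).
      now rewrite (stx_frozen x u (t + u)) by (auto; lia).
    - intro C. split; [lia|]. exists (t + N). split; [lia|].
      rewrite (stx_frozen x t (t + N)) by (auto; lia).
      now rewrite H, Nat.eqb_refl. }
  unfold lost. destruct (xorb (Nat.odd n) (negb (T (st_X (stx x t)) =? 0))) eqn:E.
  - rewrite (Dm_min _ _ _ 0); [|lia|now intros; apply Hc|intros; lia].
    rewrite Nat.odd_succ, <- Nat.negb_odd. change (Nat.odd 0) with false.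
    destruct (Nat.odd n), (Nat.eqb_spec (T (st_X (stx x t))) 0); simpl in *; intuition congruence.
  - rewrite (Dm_min _ _ _ 1).
    + rewrite (Nat.odd_succ n), <- Nat.negb_odd. change (Nat.odd 1) with true.
      destruct (Nat.odd n), (Nat.eqb_spec (T (st_X (stx x t))) 0); simpl in *; intuition congruence.
    + lia.
    + intro L. apply covered_lost. split; [lia|]. exists (t + N). split; [lia|].
      rewrite (stx_frozen x t (t + N)) by (auto; lia).
      unfold hit. simpl Nat.eqb. cbv iota. apply Nat.leb_le. lia.
    + intros g Lg. replace g with 0 by lia. rewrite Hc. congruence.
Qed.

Lemma run_snoc w b : run N (w ++ [b]) = mstep N (run N w) b.
Proof. unfold run. now rewrite fold_left_app. Qed.

Lemma stx_play s t : stx (play s) t = run N (hist s t).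
Proof. unfold stx. now rewrite hist_play. Qed.

Lemma length_hist s t : length (hist s t) = t.
Proof. induction t; simpl; auto. rewrite length_app. simpl. lia. Qed.

Lemma hist_agree s s' t : (forall i, i < t -> s' (hist s i) = s (hist s i)) ->
  forall i, i <= t -> hist s' i = hist s i.
Proof.
  intros H i. induction i as [|i IH]; intro L; auto. simpl.
  rewrite IH by lia. now rewrite H by lia.
Qed.

Lemma read_unary s t l m : ph (run N (hist s t)) = S l -> l <= n -> st_u (run N (hist s t)) = 0 ->
  (forall k, k < m -> s (hist s (t + k)) = false) ->
  run N (hist s (t + m)) =
    (let z := run N (hist s t) in
     mk (S l) (st_t z) (st_yc z) (st_yx z) (st_X z) (st_I z) m).
Proof.
  intros Hp Ll Hu. cbv zeta. induction m as [|m IH]; intro Hs.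
  - rewrite Nat.add_0_r. rewrite (mk_eta (run N (hist s t))) at 1. now rewrite Hp, Hu.
  - rewrite Nat.add_succ_r. simpl hist. rewrite run_snoc, Hs, IH by auto.
    unfold mstep. autorewrite with mk. simpl Nat.eqb.
    now destruct (Nat.eqb_spec l (S n)); [lia|].
Qed.

Lemma read_pick s t l m : ph (run N (hist s t)) = S l -> l <= n -> st_u (run N (hist s t)) = 0 ->
  (forall k, k < m -> s (hist s (t + k)) = false) -> s (hist s (t + m)) = true ->
  run N (hist s (S (t + m))) =
    (let z := run N (hist s t) in
     mk (S (S l)) (st_t z) (st_yc z) (st_yx z) (npair (st_X z) (st_I z + p1 m)) (p2 m) 0).
Proof.
  intros Hp Ll Hu Hs Hm. cbv zeta. simpl hist.
  rewrite run_snoc, Hm, (read_unary s t l m) by auto. cbv zeta.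
  unfold mstep. autorewrite with mk. simpl Nat.eqb.
  now destruct (Nat.eqb_spec l (S n)); [lia|].
Qed.

(** * Winning the debate about an iterated limit *)

Section Refute.
Variable r : nat -> B.
Hypothesis r_top : forall X, r n X = T X.
Hypothesis r_lim : forall l, l < n -> is_lim (r (S l)) (r l).

Definition sat (a : bool) (v : nat) : Prop := if a then v <> 0 else v = 0.
(** The invariant by which player [a] wins: on the own turn some admissible pick satisfies [sat a],
    on the opponent's turn all do. The bound [I] keeps the opponent from picking an index where
    convergence has not yet set in. *)
Definition good (a : bool) (l X I : nat) : Prop :=
  if l =? S n then sat a (T X)
  else if Bool.eqb (Nat.even l) a then exists j, I <= j /\ sat a (r l (npair X j))
  else forall j, I <= j -> sat a (r l (npair X j)).

(* The value of pick [l] is a limit of values at level [S l], so whoever picks a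
   satisfying value can also name a bound beyond which all of these satisfy. *)
Lemma good_mine a l X j : l <= n -> Nat.even l = a -> sat a (r l (npair X j)) ->
  exists i, good a (S l) (npair X j) i.
Proof.
  intros Ll E H. unfold good. simpl Nat.eqb.
  destruct (Nat.eqb_spec l n) as [->|].
  - exists 0. now rewrite <- r_top.
  - rewrite Nat.even_succ, <- Nat.negb_even, E.
    replace (Bool.eqb (negb a) a) with false by now destruct a.
    destruct (r_lim l ltac:(lia) (npair X j)) as [i Hi]. exists i. intros k Lk.
    now rewrite Hi.
Qed.
Lemma good_other a l X j i : l <= n -> Nat.even l <> a -> sat a (r l (npair X j)) ->
  good a (S l) (npair X j) i.
Proof.
  intros Ll E H. unfold good. simpl Nat.eqb.
  destruct (Nat.eqb_spec l n) as [->|].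
  - now rewrite <- r_top.
  - rewrite Nat.even_succ, <- Nat.negb_even.
    replace (Bool.eqb (negb (Nat.even l)) a) with true by now destruct a, (Nat.even l).
    (* The opponent's bound [i] cannot hide the limit: any index beyond both [i] and the modulus [k]
       works. *)
    destruct (r_lim l ltac:(lia) (npair X j)) as [k Hk]. exists (i + k). split; [lia|].
    rewrite Hk by lia. exact H.
Qed.

(** Induction on the number [k] of outstanding picks. The strategy [s] is altered only where [a]
    moves, and the history up to [t] is kept. *)
Lemma refute a k : forall l s t, l + k = S n -> ph (run N (hist s t)) = S l ->
  st_u (run N (hist s t)) = 0 ->
  good a l (st_X (run N (hist s t))) (st_I (run N (hist s t))) ->
  exists s', (forall w, mover N (run N w) <> a -> s' w = s w) /\
    (forall i, i <= t -> hist s' i = hist s i) /\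
    (lost T N (play s') <-> a = true).
Proof.
  induction k as [|k IH]; intros l s t E Hp Hu Hg.
  - exists s. split; [auto|]. split; [auto|].
    rewrite (lost_check (play s) t) by (rewrite stx_play, Hp; lia).
    rewrite stx_play. unfold good in Hg.
    destruct (Nat.eqb_spec l (S n)); [|lia]. destruct a; simpl in Hg; intuition congruence.
  - unfold good in Hg. destruct (Nat.eqb_spec l (S n)); [lia|].
    set (z := run N (hist s t)) in *.
    destruct (Bool.eqb (Nat.even l) a) eqn:Ea.
    + apply eqb_prop in Ea. destruct Hg as (j & Lj & Hj).
      destruct (good_mine a l (st_X z) j ltac:(lia) Ea Hj) as [i Hi].
      (* The bound [st_I z] is added when the pick is read, so this offset yields [j]. *)
      set (u := npair (j - st_I z) i).
      (* On the own turn, [s2] writes [u] zeros followed by a one between times [t] and [t + u]. *)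
      pose (s2 := fun w => if Bool.eqb (mover N (run N w)) a && (t <=? length w) && (length w <=? t + u)
                           then length w =? t + u else s w).
      assert (H1 : forall i, i <= t -> hist s2 i = hist s i).
      { apply hist_agree. intros i' L. unfold s2. rewrite length_hist.
        destruct (Nat.leb_spec t i'); [lia|]. now rewrite andb_false_r. }
      assert (Hz : run N (hist s2 t) = z) by now rewrite H1.
      assert (Hs : forall v, v <= u -> s2 (hist s2 (t + v)) = (v =? u)).
      { induction v as [v IHv] using lt_wf_ind. intro Lv.
        assert (Hm : mover N (run N (hist s2 (t + v))) = a).
        { rewrite (read_unary s2 t l v); rewrite ?Hz; auto; try lia.
          - unfold mover. autorewrite with mk. exact Ea.
          - intros k' Lk. rewrite IHv by lia. apply Nat.eqb_neq. lia. }
        unfold s2 at 1. rewrite Hm, eqb_reflx, length_hist.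
        destruct (Nat.leb_spec t (t + v)), (Nat.leb_spec (t + v) (t + u)); try lia. simpl.
        destruct (Nat.eqb_spec (t + v) (t + u)), (Nat.eqb_spec v u); auto; lia. }
      pose proof (read_pick s2 t l u) as Hr. rewrite Hz in Hr.
      specialize (Hr Hp ltac:(lia) Hu). cbv zeta in Hr.
      assert (Hr' := Hr ltac:(intros k' Lk; rewrite Hs by lia; apply Nat.eqb_neq; lia)
                        ltac:(rewrite Hs by auto; apply Nat.eqb_refl)).
      clear Hr.
      destruct (IH (S l) s2 (S (t + u))) as (s' & A1 & A2 & A3).
      * lia.
      * rewrite Hr'. now autorewrite with mk.
      * rewrite Hr'. now autorewrite with mk.
      * rewrite Hr'. autorewrite with mk. unfold u. autorewrite with pr.
        replace (st_I z + (j - st_I z)) with j by lia. exact Hi.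
      * exists s'. split; [|split; auto].
        -- intros w Hw. rewrite A1 by auto. unfold s2.
           destruct (Bool.eqb (mover N (run N w)) a) eqn:Em; auto.
           apply eqb_prop in Em. contradiction.
        -- intros i' L. rewrite A2 by lia. now apply H1.
    + assert (Ea' : Nat.even l <> a) by (intro; subst a; now rewrite eqb_reflx in Ea).
      destruct (classic (exists m, s (hist s (t + m)) = true)) as [Hm|Hm].
      * assert (Hl : exists m, s (hist s (t + m)) = true /\ forall k, k < m -> s (hist s (t + k)) = false).
        { destruct Hm as [m Hm]. induction m as [m IHm] using lt_wf_ind.
          destruct (classic (exists m', m' < m /\ s (hist s (t + m')) = true)) as [(m' & L & H)|N']; eauto.
          exists m. split; auto. intros k' L. destruct (s (hist s (t + k'))) eqn:E'; auto.
          exfalso. eauto. }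
        clear Hm. destruct Hl as (m & Hm & Hk).
        pose proof (read_pick s t l m Hp ltac:(lia) Hu Hk Hm) as Hr. cbv zeta in Hr. fold z in Hr.
        destruct (IH (S l) s (S (t + m))) as (s' & A1 & A2 & A3).
        -- lia.
        -- rewrite Hr. now autorewrite with mk.
        -- rewrite Hr. now autorewrite with mk.
        -- rewrite Hr. autorewrite with mk. apply good_other; auto; [lia|]. apply Hg. lia.
        -- exists s'. split; [auto|split; auto]. intros i' L. apply A2. lia.
      (* An opponent who never closes the block owes pick [l] forever and loses by [lost_stuck]. *)
      * assert (Hf : forall m, s (hist s (t + m)) = false).
        { intro m. destruct (s (hist s (t + m))) eqn:E'; auto. exfalso. eauto. }
        exists s. split; [auto|]. split; [auto|].
        rewrite (lost_stuck (play s) t l).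
        -- rewrite <- Nat.negb_even. destruct (Nat.even l), a; simpl; intuition congruence.
        -- lia.
        -- intros t' L. rewrite stx_play. replace t' with (t + (t' - t)) by lia.
           rewrite (read_unary s t l) by (auto; lia). cbv zeta. now autorewrite with mk.
Qed.

End Refute.
End Fixed.

Lemma tower n' : forall p q, lim_iter n' p q -> exists r : nat -> B,
  (forall k, r 0 k = q k) /\ r n' = p /\ forall l, l < n' -> is_lim (r (S l)) (r l).
Proof.
  induction n' as [|m IH]; intros p q H; simpl in H.
  - exists (fun _ => p). split; [exact H|]. split; auto. intros; lia.
  - destruct H as (q' & L & H). destruct (IH q' q H) as (r & R0 & Rm & Rl).
    exists (fun l => if l =? S m then p else r l). split; [|split].
    + exact R0.
    + now rewrite Nat.eqb_refl.
    + intros l Ll. destruct (Nat.eqb_spec (S l) (S m)) as [E|]; destruct (Nat.eqb_spec l (S m)); try lia.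
      * injection E as ->. now rewrite Rm.
      * apply Rl. lia.
Qed.

End Challenge.

(** * Counting positive claims *)

Lemma count_pre_S x t : count (pre x (S t)) = count (pre x t) + b2n (x t).
Proof. unfold count. rewrite pre_S, word_of_ch, fold_left_app. reflexivity. Qed.

Lemma count_mono x y N : (forall i, i < N -> x i = true -> y i = true) ->
  count (pre x N) <= count (pre y N).
Proof.
  induction N as [|N IH]; intro H; [auto|]. rewrite !count_pre_S.
  specialize (IH ltac:(intros; apply H; auto)).
  specialize (H N (le_n _)). destruct (x N); simpl; [rewrite H by auto; simpl|]; lia.
Qed.
Lemma count_eq x y N : (forall i, i < N -> x i = true -> y i = true) ->
  count (pre y N) <= count (pre x N) -> forall i, i < N -> x i = y i.
Proof.
  induction N as [|N IH]; intros H L i Li; [lia|]. rewrite !count_pre_S in L.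
  pose proof (count_mono x y N ltac:(intros; apply H; auto)) as M.
  assert (HN := H N (le_n _)).
  assert (E : x N = y N).
  { destruct (x N), (y N); simpl in L; auto; lia. }
  destruct (Nat.eq_dec i N) as [->|]; auto.
  apply IH; try lia; [intros; apply H; auto|]. rewrite E in L. lia.
Qed.

Lemma pre_ext x y t : (forall i, i < t -> x i = y i) -> pre x t = pre y t.
Proof.
  intro H. unfold pre. f_equal. apply map_ext_in. intros i Hi. apply in_seq in Hi. apply H. lia.
Qed.

(** * Equilibria of the challenge game *)

Section ChallengeNE.
Variables (n N : nat) (T : B) (r : nat -> B).
Hypothesis r_top : forall X, r n X = T X.
Hypothesis r_lim : forall l, l < n -> is_lim (r (S l)) (r l).
Variables (qA : B) (qs : nat -> B).
(** The pair [<i,k>] is evidence against player 1: for [i < N] an entry refuting claim [i],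
    otherwise an enumerated cylinder that contains the one of the current prefix. *)
Hypothesis r_bot : forall yc yx i k,
  r 0 (npair (npair yc yx) (npair i k)) <> 0 <->
  (i < N /\ bit yc i = true /\ qs i k <> 0) \/
  (N <= i /\ exists c, qA k = S c /\ prefb c yx = true).

Notation stx := (stx n N).
Notation run := (run n N).

Definition quiet (z : nat -> bool) (t : nat) : Prop :=
  forall t', t' < t -> N <= t' -> Nat.odd (t' - N) = true -> z t' = false.
Definition bits (z : nat -> bool) (m : nat) : bool := z (N + 2 * m).

(** After the claims every second letter, beginning with the first, is a bit of [x]; hence half of
    the elapsed time is rounded up. *)
Lemma stx_quiet z t : quiet z t ->
  stx z t = mk 0 t (pre z (Nat.min t N)) (pre (bits z) (Nat.div2 (S (t - N)))) 0 0 0.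
Proof.
  induction t as [|t IH]; intro Hq; [reflexivity|].
  rewrite stx_S, IH by (intros t' L; apply Hq; lia).
  unfold mstep. autorewrite with mk. simpl Nat.eqb. cbv iota.
  destruct (Nat.ltb_spec t N) as [L|L].
  - rewrite !Nat.min_l by lia. rewrite pre_S.
    now replace (S t - N) with (t - N) by lia.
  - rewrite !Nat.min_r by lia. replace (S t - N) with (S (t - N)) by lia.
    rewrite <- (Nat.negb_odd (t - N)).
    pose proof (Nat.div2_odd (t - N)) as D. set (m := Nat.div2 (t - N)) in *.
    destruct (Nat.odd (t - N)) eqn:O; simpl negb; cbv iota; unfold Nat.b2n in D.
    + rewrite Hq by auto. rewrite D.
      replace (S (S (2 * m + 1))) with (S (2 * S m)) by lia.
      replace (S (2 * m + 1)) with (2 * S m) by lia.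
      now rewrite Nat.div2_succ_double, Nat.div2_double.
    + rewrite D. replace (S (S (2 * m + 0))) with (2 * S m) by lia.
      rewrite Nat.add_0_r, Nat.div2_succ_double, Nat.div2_double, pre_S.
      unfold bits at 3. now replace (N + 2 * m) with t by lia.
Qed.

Lemma stx_call z m : let t := N + 2 * m + 1 in quiet z t -> z t = true ->
  stx z (S t) = mk 1 t (pre z N) (pre (bits z) (S m))
                  (npair (pre z N) (pre (bits z) (S m))) 0 0.
Proof.
  intros t Hq Ht. rewrite stx_S, Ht, stx_quiet by auto. unfold mstep. autorewrite with mk.
  simpl Nat.eqb. cbv iota. rewrite Nat.min_r by (unfold t; lia).
  destruct (Nat.ltb_spec t N); [unfold t in *; lia|].
  replace (t - N) with (2 * m + 1) by (unfold t; lia).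
  rewrite Nat.even_add, Nat.even_mul. simpl Nat.even. cbv iota.
  replace (S (2 * m + 1)) with (2 * S m) by lia. now rewrite Nat.div2_double.
Qed.

Lemma lost_never z : (forall t, ph (stx z t) = 0) -> ~ lost n T N z.
Proof.
  intros H. unfold lost. rewrite (Dm_min _ _ _ (S n)); auto; [lia|].
  intros g Lg C. apply covered_lost in C as [_ (t & _ & C)]. unfold hit in C. rewrite H in C.
  destruct (Nat.eqb_spec g 0); [discriminate|]. apply Nat.leb_le in C. lia.
Qed.

Lemma pre_play s s' t : hist s' t = hist s t -> pre (play s') t = pre (play s) t.
Proof. intro H. rewrite <- (code_of_word (pre (play s') t)), <- (code_of_word (pre (play s) t)).
  now rewrite !hist_play, H. Qed.

(** Before a challenge player 2 follows the schedule [f], indexed by time; player 1 and the debate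
    remain as in [s]. *)
Definition call (s : list bool -> bool) (f : nat -> bool) (w : list bool) : bool :=
  if (ph (run w) =? 0) && mover N (run w) then f (length w) else s w.

Lemma play_quiet z s f t : z = play (call s f) -> quiet z t -> N <= t -> Nat.odd (t - N) = true ->
  z t = f t.
Proof.
  intros -> Hq L O. unfold play at 1. unfold call at 1.
  rewrite <- stx_play, stx_quiet by auto. unfold mover. autorewrite with mk. simpl Nat.eqb. cbv iota.
  destruct (Nat.ltb_spec t N); [lia|]. simpl. now rewrite O, length_hist.
Qed.

Lemma call_quiet s f t : (forall t', t' < t -> f t' = false) -> quiet (play (call s f)) t.
Proof.
  induction t as [|t IH]; intros Hf t' L; [lia|]. intros LN O.
  assert (Q : quiet (play (call s f)) t) by (apply IH; auto).
  destruct (Nat.eq_dec t' t) as [->|]; [|apply Q; auto; lia].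
  rewrite (play_quiet _ s f) by auto. apply Hf. lia.
Qed.

Definition silent (s : list bool -> bool) := call s (fun _ => false).

Lemma pre_silent s m : pre (play (call s (fun i => i =? m))) m = pre (play (silent s)) m.
Proof.
  apply pre_play. apply (hist_agree _ _ m); auto. intros i L. unfold silent, call.
  rewrite length_hist. destruct (_ && _); auto. apply Nat.eqb_neq. lia.
Qed.

Lemma play_pre x y t i : pre x t = pre y t -> i < t -> x i = y i.
Proof. intros E L. rewrite <- (bit_pre x t i L), E. now apply bit_pre. Qed.

Section NE.
Variable s : list bool -> bool.
Hypothesis NE : isNE (cgame n T N) s.
(** The solution is read off the play without any challenge, in which all of [x] is produced. *)
Let z := play (silent s).

(** Otherwise player 2 could stay silent up to bit [m], challenge, and win the debate with [j] as
    first pick. The resulting outcome [0] would be a strict improvement. *)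
Lemma not_refuted m j : outcome n T N (play s) <> 0 ->
  r 0 (npair (npair (pre z N) (pre (bits z) (S m))) j) = 0.
Proof.
  intro Ho. destruct (Nat.eq_dec (r 0 (npair (npair (pre z N) (pre (bits z) (S m))) j)) 0) as [|Hj]; auto.
  exfalso. set (t := N + 2 * m + 1). pose (s2 := call s (fun i => i =? t)).
  assert (Hpre : pre (play s2) t = pre z t) by apply pre_silent.
  assert (Q : quiet (play s2) t).
  { apply call_quiet. intros t' L. apply Nat.eqb_neq. lia. }
  assert (Ht : play s2 t = true).
  { rewrite (play_quiet _ s (fun i => i =? t)); auto.
    - apply Nat.eqb_refl.
    - unfold t. lia.
    - unfold t. replace (N + 2 * m + 1 - N) with (2 * m + 1) by lia. apply odd_double_1. }
  pose proof (stx_call (play s2) m Q Ht) as E. cbv zeta in E. fold t in E.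
  rewrite (pre_ext (play s2) z N) in E by (intros i L; apply (play_pre _ _ t); auto; unfold t; lia).
  rewrite (pre_ext (bits (play s2)) (bits z) (S m)) in E
    by (intros i L; apply (play_pre (play s2) z t (N + 2 * i)); auto; unfold t; lia).
  rewrite stx_play in E.
  destruct (refute n N T r r_top r_lim true (S n) 0 s2 (S t)) as (s' & A1 & A2 & A3).
  - auto.
  - rewrite E. now autorewrite with mk.
  - rewrite E. now autorewrite with mk.
  - rewrite E. autorewrite with mk. unfold good. simpl. exists j. split; [lia|exact Hj].
  - apply (NE true s').
    + intros w Hw. simpl in Hw. rewrite A1 by auto. unfold s2, call.
      destruct (mover N (run w)); [congruence|]. now rewrite andb_false_r.
    + simpl. apply Nat.ltb_lt. unfold outcome at 1.
      destruct (excluded_middle_informative _) as [|L]; [lia|]. exfalso. apply L. now apply A3.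
Qed.

(** Player 1 can deviate to the sound claims [b] and the point [xA], against which no evidence
    exists, and then cannot lose. An equilibrium must pay at least as much. *)
Lemma value_lower b xA : (forall i, i < N -> b i = true -> forall k, qs i k = 0) ->
  ~ covered qA xA -> S (count (pre b N)) <= outcome n T N (play s).
Proof.
  intros Hb HA.
  pose (s1 := fun w => if (ph (run w) =? 0) && negb (mover N (run w)) then
      if st_t (run w) <? N then b (st_t (run w)) else xA (len (st_yx (run w))) else s w).
  assert (Hs1 : forall w, mover N (run w) = true -> s1 w = s w).
  { intros w Hw. unfold s1. rewrite Hw. now rewrite andb_false_r. }
  assert (Hst : forall t, quiet (play s1) t -> run (hist s1 t) =
     mk 0 t (pre (play s1) (Nat.min t N)) (pre (bits (play s1)) (Nat.div2 (S (t - N)))) 0 0 0).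
  { intros t Q. now rewrite <- stx_play, stx_quiet. }
  assert (Hc : forall t, quiet (play s1) t -> t < N -> play s1 t = b t).
  { intros t Q L. unfold play, s1 at 1. rewrite Hst by auto. unfold mover. autorewrite with mk.
    simpl Nat.eqb. destruct (Nat.ltb_spec t N); [reflexivity|lia]. }
  assert (Hx : forall m, quiet (play s1) (N + 2 * m) -> bits (play s1) m = xA m).
  { intros m Q. unfold bits, play, s1 at 1. rewrite Hst by auto. unfold mover. autorewrite with mk.
    simpl Nat.eqb. destruct (Nat.ltb_spec (N + 2 * m) N); [lia|].
    replace (N + 2 * m - N) with (2 * m) by lia. rewrite len_pre.
    rewrite Nat.odd_mul, Nat.div2_succ_double. reflexivity. }
  assert (Hq : forall t u, t <= u -> quiet (play s1) u -> quiet (play s1) t).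
  { intros t u L Q t' L'. apply Q. lia. }
  assert (Hpre : forall t, N <= t -> quiet (play s1) t -> pre (play s1) N = pre b N).
  { intros t L Q. apply pre_ext. intros i Li. apply Hc; auto. apply (Hq i t); auto. lia. }
  assert (K : exists s', (forall w, mover N (run w) <> false -> s' w = s w) /\
              ~ lost n T N (play s') /\ pre (play s') N = pre b N).
  (* Without a challenge player 1 does not lose. Otherwise the first challenge is met by the debate
     strategy of [refute] for player 1. *)
  { destruct (classic (forall t, quiet (play s1) t)) as [Q|NQ].
    - exists s1. split; [|split].
      + intros w Hw. apply Hs1. now destruct (mover N (run w)).
      + apply lost_never. intro t. rewrite stx_quiet by auto. now autorewrite with mk.
      + now apply (Hpre N).
    - assert (C : exists t, N <= t /\ Nat.odd (t - N) = true /\ play s1 t = true /\ quiet (play s1) t).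
      { apply NNPP. intro NC. apply NQ. induction t as [|t IH]; intros t' L LN O; [lia|].
        destruct (Nat.eq_dec t' t) as [->|]; [|apply IH; auto; lia].
        destruct (play s1 t) eqn:E; auto. exfalso. apply NC. exists t. auto. }
      destruct C as (t & LN & O & Ht & Q).
      pose proof (Nat.div2_odd (t - N)) as D. rewrite O in D. unfold Nat.b2n in D.
      set (m := Nat.div2 (t - N)) in *. assert (Et : t = N + 2 * m + 1) by lia.
      rewrite Et in Q, Ht.
      pose proof (stx_call (play s1) m Q Ht) as E. cbv zeta in E. rewrite <- Et in *.
      rewrite (Hpre t) in E by auto.
      rewrite (pre_ext (bits (play s1)) xA (S m)) in E
        by (intros i L; apply Hx; apply (Hq _ t); auto; lia).
      rewrite stx_play in E.
      destruct (refute n N T r r_top r_lim false (S n) 0 s1 (S t)) as (s' & A1 & A2 & A3).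
      + auto.
      + rewrite E. now autorewrite with mk.
      + rewrite E. now autorewrite with mk.
      + rewrite E. autorewrite with mk. unfold good. simpl. intros j _.
        rewrite <- (npair_surj j).
        destruct (Nat.eq_dec (r 0 (npair (npair (pre b N) (pre xA (S m))) (npair (p1 j) (p2 j)))) 0)
          as [|Hj]; auto. exfalso. apply r_bot in Hj as [(Hi & Hbit & Hk)|(Hi & c & Hk & Hp)].
        * rewrite bit_pre in Hbit by auto. apply Hk, Hb; auto.
        * apply HA. exists (p2 j - 0), c. rewrite Nat.sub_0_r. split; auto.
          apply prefb_pre in Hp as (u & _ & ->). apply is_prefix_word. eauto.
      + exists s'. split; [|split].
        * intros w Hw. rewrite A1 by auto. apply Hs1. now destruct (mover N (run w)).
        * intro L. apply A3 in L. discriminate.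
        * rewrite <- (Hpre t) by auto. apply pre_play, A2. lia. }
  destruct K as (s' & A1 & A2 & A3).
  assert (E : outcome n T N (play s') = S (count (pre b N))).
  { unfold outcome. destruct (excluded_middle_informative _); [contradiction|]. now rewrite A3. }
  rewrite <- E.
  destruct (le_lt_dec (outcome n T N (play s')) (outcome n T N (play s))) as [|L]; auto.
  exfalso. apply (NE false s').
  - intros w Hw. now apply A1.
  - simpl. now apply Nat.ltb_lt.
Qed.

(** The lower bound makes the outcome nonzero, so no evidence exists against the silent play: its
    positive claims are true and its bits avoid every enumerated cylinder. The bound also makes the
    claims as numerous as the true ones, hence equal to them. *)
Lemma cgame_NE xA : ~ covered qA xA ->
  (forall i, i < N -> (z i = true <-> forall k, qs i k = 0)) /\ ~ covered qA (bits z).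
Proof.
  intro HA.
  destruct (fun_choice (fun i b => b = true <-> forall k, qs i k = 0)) as [b Hb].
  { intro i. destruct (classic (forall k, qs i k = 0)); [exists true|exists false]; intuition congruence. }
  assert (L := value_lower b xA ltac:(intros i _; apply Hb) HA).
  assert (Ho : outcome n T N (play s) <> 0) by lia.
  assert (R : forall m j, r 0 (npair (npair (pre z N) (pre (bits z) (S m))) j) = 0)
    by (intros; now apply not_refuted).
  assert (Hz : forall i, i < N -> z i = true -> b i = true).
  { intros i Li Hi. apply Hb. intro k. specialize (R 0 (npair i k)).
    destruct (Nat.eq_dec (qs i k) 0) as [|Hk]; auto. exfalso. revert R. apply r_bot. left.
    rewrite bit_pre by auto. auto. }
  (* Player 2 has no move among the first [N] letters, so silencing does not affect the claims. *)
  assert (Hs : pre (play s) N = pre z N).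
  { unfold z. symmetry. apply pre_play. apply (hist_agree s _ N); auto. intros i Li.
    unfold silent, call. rewrite <- stx_play, stx_early by lia.
    unfold mover. autorewrite with mk. simpl Nat.eqb. destruct (Nat.ltb_spec i N); [reflexivity|lia]. }
  unfold outcome in L. destruct (excluded_middle_informative _); [lia|].
  rewrite Hs in L. split.
  - intros i Li. rewrite (count_eq z b N Hz ltac:(lia) i Li). apply Hb.
  - intros (i & c & Hc & Hp). apply is_prefix_word in Hp as [t ->].
    specialize (R t (npair N i)). revert R. apply r_bot. right. split; auto.
    exists (pre (bits z) t). split; auto. apply prefb_pre. exists t. auto.
Qed.

End NE.
End ChallengeNE.

(** * The computable reduction to games *)

Lemma cf_bsnd_bfst f : cf f -> cf (fun z x => bsnd (bfst z) (f z x)).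
Proof. intro. unfold bfst, bsnd. cfs. Qed.
#[local] Hint Resolve cf_bsnd_bfst : cf.

Lemma cf_idx i k : cf i -> cf k -> cf (fun p x => idx (i p x) (k p x)).
Proof.
  intros Hi Hk. apply (cf_ext (fun p x => prec (2 * k p x) (fun _ v => 2 * v + 1) (i p x))); [cfs|].
  intros p x. induction (i p x) as [|m IH]; [reflexivity|]. rewrite prec_S, <- IH. reflexivity.
Qed.
Lemma cf_iter_div2 i c : cf i -> cf c -> cf (fun p x => Nat.iter (i p x) Nat.div2 (c p x)).
Proof.
  intros Hi Hc. apply (cf_ext (fun p x => prec (c p x) (fun _ v => Nat.div2 v) (i p x))); [cfs|].
  reflexivity.
Qed.
Lemma cf_count f : cf f -> cf (fun p x => count (f p x)).
Proof.
  intro. unfold count. apply (cf_fold (fun _ _ s b => s + b2n b) (fun _ _ => 0) f); cfs.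
Qed.
#[local] Hint Resolve cf_idx cf_iter_div2 cf_count : cf.

Lemma testbit_iter c o : Nat.testbit c o = Nat.odd (Nat.iter o Nat.div2 c).
Proof.
  revert c. induction o as [|o IH]; intro c; [reflexivity|].
  rewrite Nat.iter_succ_r. apply IH.
Qed.

Section Lower.
Variable n : nat.

Lemma cf_run N f : cf N -> cf f -> cf (fun p x => run n (N p x) (word_of (f p x))).
Proof.
  intros HN Hf. apply (cf_call2 (fun _ N c => run n N (word_of c))); auto.
  unfold run. apply (cf_fold (fun _ x => mstep n (p1 x)) (fun _ _ => mk 0 0 0 0 0 0 0) (fun _ x => p2 x)).
  - unfold mk. cfs.
  - cfs.
  - unfold mstep, mk, ph, st_t, st_yc, st_yx, st_X, st_I, st_u. cfs.
Qed.
#[local] Hint Resolve cf_run : cf.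

Lemma cfb_mover N f : cf N -> cf f -> cfb (fun p x => mover (N p x) (f p x)).
Proof. intros. unfold mover, ph, st_t. cfs. Qed.
#[local] Hint Resolve cfb_mover : cf.

Lemma cf_uname : cf (fun T x => uname n T (p1 x) (p1 (p2 x)) (p2 (p2 x))).
Proof.
  unfold uname, ucond, hit, ph, st_X, st_yc. cfs.
Qed.

(** The table of evidence for a family [R] with [N] in column [0], the closed set in column [1] and
    LPO instance [i] in column [S (S i)]. *)
Definition exclude (R : B) (z : nat) : nat :=
  if p1 (p2 z) <? R (npair 0 0)
  then b2n (bit (p1 (p1 z)) (p1 (p2 z)) && negb (R (npair (S (S (p1 (p2 z)))) (p2 (p2 z))) =? 0))
  else b2n (negb (R (npair 1 (p2 (p2 z))) =? 0) && prefb (pred (R (npair 1 (p2 (p2 z))))) (p2 (p1 z))).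

(* The family [N, q_A, q_0, ..., q_(N-1), 0, 0, ...] of [n]-fold limit names. *)
Definition inst (p : B) (i k : nat) : nat :=
  if i =? 0 then bsnd p 0
  else if i =? 1 then bfst p k
  else if i - 2 <? bsnd p 0 then bsnd p (S (idx (i - 2) k))
  else 0.

Definition table (p : B) : B :=
  liftn n exclude (fun z => inst p (p1 (shuf n z)) (p2 (shuf n z))).

(** In the order of the numbers an upper set of player 1 is a final segment and one of player 2 an
    initial segment. The [xorb] searches for the least member or the least nonmember respectively,
    with [S (S N)] for none. *)
Definition threshold (N a c : nat) : nat :=
  bmin (fun o => xorb (Nat.odd (Nat.iter o Nat.div2 c)) (negb (a =? 0))) (S (S N)).

(** [uname] describes outcomes below a threshold. This is an upper set for player 2, tag [0], and
    the complement of one for player 1, tag [1]. *)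
Definition hgame (p : B) (z : nat) : nat :=
  let N := bsnd p 0 in
  let x := p2 z in
  if p1 z =? 0 then S (S N)
  else if p1 z =? 1 then b2n (mover N (run n N (word_of x)))
  else if p1 z =? 2 then b2n (p1 x <? p2 x)
  else if p2 x =? 0 then b2n (p1 (p1 x) =? 0)
  else uname n (table p) N (threshold N (p1 (p1 x)) (p2 (p1 x))) (pred (p2 x)).

Definition follow (z : B) (t : nat) : nat :=
  let N := bsnd (bfst z) 0 in
  prec 0 (fun t c => ch c (if (N <=? t) && Nat.odd (t - N) then false else negb (bsnd z c =? 0))) t.

Definition kgame (z : B) : B :=
  let N := bsnd (bfst z) 0 in
  bpair (fun m => bsnd z (follow z (N + 2 * m)))
        (fun x => if x =? 0 then N else bsnd z (follow z (p1 (unidx (pred x))))).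

Lemma cf_exclude : cf exclude.
Proof. unfold exclude. cfs. Qed.
Lemma cf_table : cf table.
Proof.
  unfold table. apply cf_compose; [apply cf_liftn, cf_exclude|]. unfold inst. cfs.
Qed.
Lemma cf_hgame : cf hgame.
Proof.
  unfold hgame. cbv zeta.
  assert (cf (fun p x => uname n (table p) (bsnd p 0) (threshold (bsnd p 0) (p1 (p1 (p2 x))) (p2 (p1 (p2 x))))
                (pred (p2 (p2 x))))).
  { apply (cf_call3 (fun p u v w => uname n (table p) u v w) (fun p _ => bsnd p 0)); [|cfs| |cfs].
    - apply (cf_compose (fun T x => uname n T (p1 x) (p1 (p2 x)) (p2 (p2 x))) table);
        [apply cf_uname|apply cf_table].
    - unfold threshold. cfs. }
  cfs.
Qed.
Lemma cf_kgame : cf kgame.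
Proof.
  assert (forall f, cf f -> cf (fun z x => follow z (f z x))).
  { intros f Hf. apply (cf_call1 follow); auto. unfold follow. cbv zeta. cfs. }
  unfold kgame. cbv zeta. apply (cf_bpair (fun z m => bsnd z (follow z (bsnd (bfst z) 0 + 2 * m)))
    (fun z x => if x =? 0 then bsnd (bfst z) 0 else bsnd z (follow z (p1 (unidx (pred x)))))
    (fun _ x => x)); cfs.
Qed.

Lemma cgame_valid T N : valid_game (cgame n T N).
Proof.
  split; [|split; [|split]]; simpl.
  - intro x. unfold outcome. destruct (excluded_middle_informative _); [lia|].
    assert (H : forall t, count (pre x t) <= t).
    { induction t as [|t IH]; [auto|]. rewrite count_pre_S. destruct (x t); simpl; lia. }
    specialize (H N). lia.
  - intros a _. apply Nat.ltb_irrefl.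
  - intros a b c _ _ _. rewrite !Nat.ltb_lt. lia.
  - intros a b _ _. rewrite !Nat.ltb_lt. lia.
Qed.

Lemma threshold_spec T N (a : bool) c v : upper_code (cgame n T N) a c -> v < S (S N) ->
  (in_code c v <-> if a then v < threshold N (b2n a) c else threshold N (b2n a) c <= v).
Proof.
  intros [_ H] Lv. simpl in H. unfold in_code in *. setoid_rewrite testbit_iter in H.
  rewrite testbit_iter. unfold threshold.
  set (f := fun o => xorb (Nat.odd (Nat.iter o Nat.div2 c)) (negb (b2n a =? 0))).
  pose proof (bmin_lt f (S (S N))) as H1. pose proof (bmin_true f (S (S N))) as H2.
  set (j := bmin f (S (S N))) in *. unfold f in H1, H2.
  destruct a; simpl in H1, H2, H.
  - split.
    + intro Hv. destruct (le_lt_dec j v) as [L|]; auto. exfalso.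
      specialize (H2 ltac:(lia)).
      destruct (Nat.eq_dec j v) as [E|].
      * rewrite E, Hv in H2. discriminate.
      * rewrite (H v j) in H2; auto; [discriminate|lia|]. apply Nat.ltb_lt. lia.
    + intro L. specialize (H1 v L). now destruct (Nat.odd _).
  - split.
    + intro Hv. destruct (le_lt_dec j v) as [L|L]; auto. specialize (H1 v L).
      rewrite Hv in H1. discriminate.
    + intro L. specialize (H2 ltac:(lia)). rewrite xorb_false_r in H2.
      destruct (Nat.eq_dec j v) as [E|]; [now rewrite <- E|].
      apply (H j v); auto; [lia|]. apply Nat.ltb_lt. lia.
Qed.

Lemma cgame_named p :
  names (game_space (Dunion_name (S n))) (hgame p) (cgame n (table p) (bsnd p 0)).
Proof.
  set (N := bsnd p 0). cbn [names game_space]. unfold comp, hgame. cbv zeta. fold N.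
  split; [now autorewrite with pr|]. split; [|split].
  - intro j. now autorewrite with pr.
  - intros a b _ _. autorewrite with pr. simpl. now autorewrite with pr.
  - intros a c Hu. set (j := threshold N (b2n a) c).
    match goal with |- Dunion_name _ ?f _ => set (q := f) end. unfold Dunion_name.
    assert (E0 : q 0 = b2n (negb a)).
    { unfold q. autorewrite with pr. simpl. now destruct a. }
    assert (Et : tl q = uname n (table p) N j).
    { extensionality x. unfold tl, q. autorewrite with pr. simpl. reflexivity. }
    rewrite E0, Et.
    assert (Hv : forall x, outcome n (table p) N x < S (S N)) by (intro; apply cgame_valid).
    destruct a; [left|right]; (split; [reflexivity|]); intro x;
      rewrite (threshold_spec (table p) N _ c _ Hu (Hv x)), Dm_uname.
    + reflexivity.
    + fold j. lia.
Qed.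

(** The silent play never leaves phase [0], so the parity of the time after [N] decides who
    moves. *)
Lemma play_silent N s t : play (silent n N s) t =
  if (N <=? t) && Nat.odd (t - N) then false else s (hist (silent n N s) t).
Proof.
  unfold play, silent, call at 1.
  fold (silent n N s). rewrite <- stx_play, stx_quiet by (now apply call_quiet).
  unfold mover. autorewrite with mk. simpl Nat.eqb. cbv iota. simpl andb at 1.
  now replace (N <=? t) with (negb (t <? N)) by (rewrite Nat.ltb_antisym; apply negb_involutive).
Qed.

Lemma follow_spec N s p r t : bsnd p 0 = N -> (forall j, r j = b2n (s (word_of j))) ->
  follow (bpair p r) t = pre (play (silent n N s)) t.
Proof.
  intros EN Hr. unfold follow. cbv zeta. rewrite bfst_bpair, bsnd_bpair, EN.
  induction t as [|t IH]; [reflexivity|]. rewrite prec_S, IH, pre_S. f_equal.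
  rewrite Hr, hist_play, play_silent.
  destruct (_ && _); auto. now destruct (s _).
Qed.

Theorem C2_LPO_le_NE :
  W_le (prod_mvf (jump_mvf C2 n) (star_mvf (jump_mvf LPO n))) (NE_ap (S n)).
Proof.
  apply (W_le_intro _ _ kgame hgame cf_kgame cf_hgame).
  intros p [A [N tup]] [HA [HN Ht]] [[xA ys] [HxA _]].
  destruct HA as (qA & LA & HA). simpl fst in *. simpl snd in *. cbn [projT1 projT2] in *.
  destruct (ptup_surj (jumpn baire_space n) (fun _ => 0) N tup) as [qs ->].
  pose proof (proj1 (ptup_names (jumpn baire_space n) _ _ _) Ht) as Hq. clear Ht.
  set (T := table p).
  exists (cgame n T N). rewrite <- HN. split; [apply cgame_named|].
  split.
  { destruct (NE_exists n _ _ (cgame_valid T (bsnd p 0)) (cgame_named p)) as [s Hs].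
    exists s. split; auto. apply cgame_valid. }
  rewrite HN.
  intros r s Hr [_ NE]. 
  (* The [n]-fold limit of the table is the evidence for the actual inputs; columns past the last
     instance are constantly [0]. *)
  assert (HT : lim_iter n T (exclude (fun z =>
     match p1 z with 0 => N | 1 => qA (p2 z) | S (S i) => if i <? N then qs i (p2 z) else 0 end))).
  { apply (liftn_lim n exclude cf_exclude).
    apply (shuf_lim n (inst p) (fun i k => match i with 0 => N | 1 => qA k | S (S i) => if i <? N then qs i k else 0 end)).
    intros [|[|i]]; unfold inst; simpl Nat.eqb; cbv iota; simpl Nat.sub.
    - rewrite HN. apply lim_iter_const.
    - exact LA.
    - rewrite HN, Nat.sub_0_r. destruct (Nat.ltb_spec i N) as [L|L]; [|apply lim_iter_const].
      destruct (Hq i L) as (q & Lq & Eq).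
      replace (qs i) with q by (extensionality k; apply Eq). exact Lq. }
  destruct (tower n T _ HT) as (rr & R0 & Rn & Rl).
  destruct (cgame_NE n N T rr (fun X => f_equal (fun f => f X) Rn) Rl qA qs) with (s := s) (xA := xA)
    as [H1 H2]; auto.
  - intros yc yx i k. rewrite R0. unfold exclude. autorewrite with pr.
    destruct (Nat.ltb_spec i N) as [L|L].
    + destruct (bit yc i), (Nat.eqb_spec (qs i k) 0); simpl; intuition (try congruence; try lia).
    + destruct (qA k) as [|c]; simpl.
      * split; [congruence|]. intros [(C & _)|(_ & c & C & _)]; [lia|discriminate].
      * destruct (prefb c yx) eqn:E; simpl; split; try congruence.
        -- intros _. right. eauto.
        -- intros [(C & _)|(_ & c' & [= <-] & C)]; [lia|congruence].
  - now apply HA.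
  - set (z := play (silent n N s)) in *.
    (* At player 1's turns the silent play uses the moves of [s], so its letters can be read off the
       name [r]. *)
    assert (Hf : forall t, (N <=? t) && Nat.odd (t - N) = false -> r (follow (bpair p r) t) = b2n (z t)).
    { intros t Et. rewrite (follow_spec N s p r t HN Hr), Hr, hist_play.
      unfold z. now rewrite play_silent, Et. }
    exists (bits N z, existT _ N (ptup bool_space N z)).
    split; [split|split].
    + simpl fst. unfold kgame. cbv zeta. rewrite bfst_bpair. intro m.
      rewrite bfst_bpair, bsnd_bpair, HN. apply Hf.
      replace (N + 2 * m - N) with (2 * m) by lia. now rewrite Nat.odd_mul, andb_false_r.
    + simpl snd. unfold kgame. cbv zeta. rewrite !bsnd_bpair, bfst_bpair, HN.
      split; [reflexivity|]. apply ptup_names. intros i Li. simpl.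
      unfold tl. simpl Nat.eqb. cbv iota. simpl pred.
      pose proof (unidx_idx i 0) as E. rewrite E, p1_pair.
      apply Hf. now destruct (Nat.leb_spec N i); [lia|].
    + apply HA. exact H2.
    + exists (ptup bool_space N z). split; [reflexivity|].
      apply (proj2 (ptup_mvf (X := jumpn baire_space n) (Y := bool_space) LPO _ _ _)).
      intros i Li. exact (H1 i Li).
Qed.
End Lower.

Theorem theorem30 (n : nat) :
  W_equiv (NE_ap (S n))
          (prod_mvf (jump_mvf C2 n) (star_mvf (jump_mvf LPO n))).
Proof. split; [apply NE_le_C2_LPO|apply C2_LPO_le_NE]. Qed.
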